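(* Let $E\subseteq\mathbb{R}^{n+1}$ be a nonempty closed set, let $\theta>1$ and $0<\gamma<1$. Then the following statements are equivalent: (i) $E$ is $(c,\delta,\theta)$-weakly porous for some $c,\delta\in(0,1)$. (ii) $E$ is an $\alpha$-improving parabolic weakly porous set for some $\alpha>0$ (that is, $E$ is $(c_0,\delta_0,\theta)$-weakly porous for some $c_0,\delta_0\in(0,1)$ and is $\alpha$-improving). (iii) $\operatorname{dist}_p(\cdot,E)^{-\beta(n+p)}\in A_1^+(\gamma)$ for some $\beta>0$. Moreover, the dependencies are quantitative: in each implication the constants in the conclusion can be chosen depending only on $n,p,d,\theta,\gamma$ and the constants in the hypothesis.
   Context: Throughout, $n\ge 1$ is an integer, $1<p<\infty$, and $d\ge1$ is a fixed integer with $dp\ge\log_2 9$. Points of $\mathbb{R}^{n+1}$ are written $(x,t)$ with $x\in\mathbb{R}^n$, $t\in\mathbb{R}$; $|\cdot|$ is Lebesgue measure. Parabolic metric: $\operatorname{dist}_p((x,t),(y,s))=\max\{\|x-y\|_\infty,|t-s|^{1/p}\}$; $\operatorname{dist}_p((x,t),E)=\inf_{(y,s)\in E}\operatorname{dist}_p((x,t),(y,s))$. Parabolic rectangles: for $x\in\mathbb{R}^n$, $t\in\mathbb{R}$, $L>0$, $0\le\gamma\le1/2$, let $Q(x,L)=\prod_{i}[x_i-L/2,x_i+L/2)$ and $R(\gamma)=R(x,t,L,\gamma)=Q(x,L)\times[t-L^p,t-\gamma L^p)$. Side lengths: $l_x(R(\gamma))=L$, $l_t(R(\gamma))=(1-\gamma)L^p$.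 For $\theta\in\mathbb{R}$, $R^\theta(\gamma)=R(\gamma)+(0,\theta\, l_t(R(\gamma)))$. Dyadic lattice: $\mathcal{D}_1(R(\gamma))$ is the partition of $R(\gamma)$ obtained by dividing each spatial edge into $2^d$ equal half-open intervals and the temporal edge into $k$ equal half-open intervals, where $k=\lceil 2^{dp}\rceil$ if $0\le\gamma\le 1-\frac{2^{dp}+1}{2^{dp+1}}$ and $k=\lfloor2^{dp}\rfloor$ if $1-\frac{2^{dp}+1}{2^{dp+1}}<\gamma\le\frac12$. Its members are again parabolic rectangles with truncation parameter in $[0,1/2]$. Put $\mathcal{D}_0(R(\gamma))=\{R(\gamma)\}$, $\mathcal{D}_{i+1}(R(\gamma))=\bigcup_{P\in\mathcal{D}_i(R(\gamma))}\mathcal{D}_1(P)$, $\mathcal{D}(R(\gamma))=\bigcup_{i\ge0}\mathcal{D}_i(R(\gamma))$. Weak porosity: for a nonempty closed $E$, a set $A$ is $E$-free if $A\cap E=\emptyset$. $\mathcal{F}(R(\gamma_0))$ is the collection of maximal (with respect to inclusion) $E$-free members of $\mathcal{D}(R(\gamma_0))$, and $\mathcal{M}(R(\gamma_0))\in\mathcal{F}(R(\gamma_0))$ is a member with largest $l_x$ ($\mathcal{M}(R(\gamma_0))=\emptyset$ if $\mathcal{F}(R(\gamma_0))=\emptyset$). For $c,\delta\in(0,1)$, $\theta\in\mathbb{R}$, $E$ is $(c,\delta,\theta)$-weakly porous if for every parabolic rectangle $R(\gamma_0)$ with $0\le\gamma_0\le1/2$ there are finitely many pairwise disjoint $E$-free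 $P_1,\dots,P_N\in\mathcal{D}(R(\gamma_0))$ with $|P_k|\ge\delta|\mathcal{M}(R^\theta(\gamma_0))|$ for all $k$ and $\sum_{k=1}^N|P_k|\ge c|R(\gamma_0)|$. $\alpha$-improvement: a $(c_0,\delta_0,\theta)$-weakly porous set $E$ is $\alpha$-improving if there are constants $\alpha,K>0$ such that for every $0<\delta\le\delta_0$ the set $E$ is $(c,\delta,\theta)$-weakly porous for some $0<c<1$ with $1-c\le K\delta^\alpha$. Parabolic Muckenhoupt class: for $0<\gamma<1$ let $R^-(\gamma)=Q(x,L)\times(t-L^p,t-\gamma L^p)$ and $R^+(\gamma)=Q(x,L)\times(t+\gamma L^p,t+L^p)$. A nonnegative $w\in L^1_{\mathrm{loc}}(\mathbb{R}^{n+1})$ belongs to $A_1^+(\gamma)$ if there is $C>0$ with $\frac{1}{|R^-(\gamma)|}\int_{R^-(\gamma)}w\,dx\,dt\le C\operatorname{ess\,inf}_{R^+(\gamma)}w$ for all such pairs (all $x,t,L$). *)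

(* Defs.v *)
From HB Require Import structures.
From mathcomp Require Import all_boot all_order all_algebra.
From mathcomp Require Import all_classical all_reals all_analysis ess_sup_inf.

Set Implicit Arguments.
Unset Strict Implicit.
Unset Printing Implicit Defensive.

Import Order.TTheory GRing.Theory Num.Theory.
Import numFieldNormedType.Exports.

Local Open Scope classical_set_scope.
Local Open Scope ring_scope.

(** * Lebesgue measure on [R^n] and on [R^n x R] *)

Definition rV_display : measure_display.
Proof. exact. Qed.

Section measurable_rV.
Context {R : realType} {n : nat}.

Let coord : 'I_n -> 'rV[R]_n -> R := fun i x => x ord0 i.

Let rV_set0 : g_sigma_preimage coord set0.
Proof. exact: sigma_algebra0. Qed.

Let rV_setC A : g_sigma_preimage coord A -> g_sigma_preimage coord (~` A).
Proof. exact: sigma_algebraC. Qed.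

Let rV_bigcup (F : (set 'rV[R]_n)^nat) :
  (forall i, g_sigma_preimage coord (F i)) ->
  g_sigma_preimage coord (\bigcup_i (F i)).
Proof. exact: sigma_algebra_bigcup. Qed.

(* The Borel sigma-algebra of R^n, as the one generated by the coordinates. *)
HB.instance Definition _ := @isMeasurable.Build rV_display 'rV[R]_n
  (g_sigma_preimage coord) rV_set0 rV_setC rV_bigcup.

Lemma measurable_coord (i : 'I_n) :
  measurable_fun [set: 'rV[R]_n] (fun x : 'rV[R]_n => x ord0 i).
Proof.
move=> _ Y mY; rewrite setTI; apply: sub_sigma_algebra => /=.
rewrite -bigcup_seq/=; exists i => /=; first by rewrite mem_index_enum.
by exists Y => //; rewrite setTI.
Qed.

Lemma measurable_fun_rVP d (T : measurableType d) (f : T -> 'rV[R]_n) :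
  (forall i, measurable_fun [set: T] (fun t => f t ord0 i)) ->
  measurable_fun [set: T] f.
Proof.
move=> mf _ Y mY; rewrite setTI.
have : (g_sigma_preimage (fun i t => coord i (f t))) `<=` @measurable _ T.
  apply: smallest_sub; first exact: sigma_algebra_measurable.
  rewrite -bigcup_seq => A [i _] /= [B mB <-].
  exact: mf.
apply; rewrite (g_sigma_preimage_comp coord f).
by exists Y => //; rewrite setTI.
Qed.

End measurable_rV.

Section lebesgue_rV.
Context {R : realType}.

Definition rV_cons n (z : 'rV[R]_n * measurableTypeR R) : 'rV[R]_n.+1 :=
  row_mx (const_mx z.2 : 'rV[R]_1) z.1.

Lemma measurable_rV_cons n : measurable_fun setT (@rV_cons n).
Proof.
apply: measurable_fun_rVP => i; case: (split_ordP (i : 'I_(1 + n))) => j ->.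
  apply: eq_measurable_fun measurable_snd => z _ /=.
  by rewrite (row_mxEl (const_mx z.2 : 'rV[R]_1) z.1) mxE.
apply: (eq_measurable_fun (fun z : 'rV[R]_n * R => z.1 ord0 j)).
  by move=> z _; rewrite [RHS](row_mxEr (const_mx z.2 : 'rV[R]_1) z.1).
exact: measurableT_comp (measurable_coord j) measurable_fst.
Qed.

Section rV_push.
Context {n : nat}.
Variable m : {measure set ('rV[R]_n * measurableTypeR R) -> \bar R}.

Definition rV_push : set 'rV[R]_n.+1 -> \bar R := pushforward m (@rV_cons n).

(* Picked up by unification as the side condition of [pushforward]. *)
Let mcons := @measurable_rV_cons n.

Let rV_push0 : rV_push set0 = 0%E.
Proof. exact: measure0. Qed.

Let rV_push_ge0 A : (0 <= rV_push A)%E.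
Proof. exact: measure_ge0. Qed.

Let rV_push_sigma_additive : semi_sigma_additive rV_push.
Proof.
exact: (@measure_semi_sigma_additive _ _ _ (pushforward m (@rV_cons n))).
Qed.

HB.instance Definition _ := isMeasure.Build _ _ _ rV_push
  rV_push0 rV_push_ge0 rV_push_sigma_additive.

End rV_push.

(* Iterated product of the one-dimensional Lebesgue measure, transported along
   R^n x R = R^(n+1). *)
Fixpoint lebesgue_rV n : {measure set 'rV[R]_n -> \bar R} :=
  if n is m.+1 then rV_push (lebesgue_rV m \x lebesgue_measure)%E
  else \d_(0 : 'rV[R]_0).

Definition lebesgue_xt n : {measure set ('rV[R]_n * measurableTypeR R) -> \bar R} :=
  (lebesgue_rV n \x lebesgue_measure)%E.

Lemma lebesgue_rV_box n (A : 'I_n -> set R) : (forall i, measurable (A i)) ->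
  lebesgue_rV n [set x | forall i, A i (x ord0 i)] =
  (\prod_(i < n) lebesgue_measure (A i))%E.
Proof.
elim: n A => [|n IH] A mA /=.
  by rewrite big_ord0 diracE mem_set//= => -[].
pose B := [set x : 'rV[R]_n | forall i, A (lift ord0 i) (x ord0 i)].
have mB : measurable B.
  have -> : B = \big[setI/setT]_(i < n)
      ((fun x : 'rV[R]_n => x ord0 i) @^-1` A (lift ord0 i)).
    rewrite -bigcap_seq; apply/seteqP; split => x Bx i /=.
      by move=> _; exact: Bx.
    by apply: (Bx i); rewrite /= mem_index_enum.
  apply: bigsetI_measurable => i _; rewrite -[X in measurable X]setTI.
  by apply: measurable_coord => //; exact: mA.
have consE (z : 'rV[R]_n * R) : (rV_cons z ord0 ord0 = z.2) *
    (forall i, rV_cons z ord0 (lift ord0 i) = z.1 ord0 i).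
  split=> [|i]; rewrite /rV_cons.
    rewrite (_ : ord0 = lshift n (ord0 : 'I_1)); last exact/val_inj.
    by rewrite (row_mxEl (const_mx z.2 : 'rV[R]_1) z.1) mxE.
  rewrite (_ : lift ord0 i = rshift 1 i); last exact/val_inj.
  by rewrite (row_mxEr (const_mx z.2 : 'rV[R]_1) z.1).
have boxE : @rV_cons n @^-1` [set x | forall i, A i (x ord0 i)] = B `*` A ord0.
  apply/seteqP; split => -[x t] /= => [Axt|[Bx At] i].
    split => [i|]; first by have := Axt (lift ord0 i); rewrite consE.
    by have := Axt ord0; rewrite consE.
  by case: (unliftP ord0 i) => [k|] ->; rewrite consE//; exact: Bx.
rewrite /rV_push /pushforward boxE product_measure1E//; last exact: mA.
by rewrite /B (IH (fun i => A (lift ord0 i)))// big_ord_recl muleC.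
Qed.

End lebesgue_rV.

(** * Parabolic rectangles *)

Section parabolic.
Context {R : realType} {n : nat}.
Variables (p : R) (d : nat).

Local Notation point := ('rV[R]_n * R)%type.

(* The norm of 'rV[R]_n is the sup norm; [x `^ a] is the real power, with
   [0 `^ a = 0] for a != 0. *)
Definition distp (z w : point) : R :=
  Num.max `|z.1 - w.1| (`|z.2 - w.2| `^ p^-1).

Definition distp_set (E : set point) (z : point) : R :=
  inf [set distp z w | w in E].

Definition cube (x : 'rV[R]_n) (L : R) : set 'rV[R]_n :=
  [set y | forall i, x ord0 i - L / 2 <= y ord0 i < x ord0 i + L / 2].

Record prect := PRect {
  pr_x : 'rV[R]_n;
  pr_t : R;
  pr_L : R;
  pr_gamma : R }.

Definition is_prect (P : prect) : Prop :=
  0 < pr_L P /\ 0 <= pr_gamma P <= 2^-1.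

Definition rect (P : prect) : set point :=
  cube (pr_x P) (pr_L P) `*`
  `[pr_t P - pr_L P `^ p, pr_t P - pr_gamma P * pr_L P `^ p[.

Definition l_x (P : prect) : R := pr_L P.

Definition l_t (P : prect) : R := (1 - pr_gamma P) * pr_L P `^ p.

Definition shift (theta : R) (P : prect) : prect :=
  PRect (pr_x P) (pr_t P + theta * l_t P) (pr_L P) (pr_gamma P).

(** * The dyadic lattice *)

Definition ntime (gamma : R) : nat :=
  let a := 2 `^ (d%:R * p) in
  if gamma <= 1 - (a + 1) / (2 `^ (d%:R * p + 1))
  then `|Num.ceil a|%N else `|Num.floor a|%N.

(* The cells of the partition of P are described by their edge lengths and lower
   corners; when l_x P > 0 these determine all four fields of P', so that the
   truncation parameter of a cell need not be computed. *)
Definition dyadic1 (P : prect) : set prect :=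
  [set P' | exists (j : 'I_n -> 'I_(2 ^ d)) (k : 'I_(ntime (pr_gamma P))),
    [/\ l_x P' = l_x P / 2 ^+ d,
        l_t P' = l_t P / (ntime (pr_gamma P))%:R,
        forall i, pr_x P' ord0 i - l_x P' / 2 =
                  pr_x P ord0 i - l_x P / 2 + (j i)%:R * l_x P' &
        pr_t P' - pr_L P' `^ p = pr_t P - pr_L P `^ p + k%:R * l_t P']].

Fixpoint dyadic (i : nat) (P : prect) : set prect :=
  if i is i'.+1 then \bigcup_(P' in dyadic i' P) dyadic1 P' else [set P].

Definition lattice (P : prect) : set prect := \bigcup_i dyadic i P.

(** * Weak porosity *)

Definition free (E A : set point) : Prop := A `&` E = set0.

Definition maxfree (E : set point) (P : prect) : set prect :=
  [set Q | [/\ lattice P Q, free E (rect Q) &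
    forall Q', lattice P Q' -> free E (rect Q') ->
      rect Q `<=` rect Q' -> rect Q' = rect Q]].

(* The set M(P), with [xget] as choice function. Members of [maxfree E P] with the
   same l_x are of the same generation, hence the measure of M(P) does not depend
   on the choice. *)
Definition largest (E : set point) (P : prect) : set point :=
  xget set0 [set rect Q | Q in
    [set Q | maxfree E P Q /\ forall Q', maxfree E P Q' -> l_x Q' <= l_x Q]].

Local Notation mu := (@lebesgue_xt R n).

Definition weakly_porous (c delta theta : R) (E : set point) : Prop :=
  forall P0, is_prect P0 ->
  exists (N : nat) (P : 'I_N -> prect),
  [/\ forall k, lattice P0 (P k),
      trivIset setT (fun k => rect (P k)),
      forall k, free E (rect (P k)),
      forall k, (delta%:E * mu (largest E (shift theta P0)) <=
                 mu (rect (P k)))%E &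
      (c%:E * mu (rect P0) <= \sum_(k < N) mu (rect (P k)))%E].

(* alpha-improvement, with the constant K. *)
Definition improving (delta0 theta alpha K : R) (E : set point) : Prop :=
  forall delta, 0 < delta <= delta0 ->
  exists c, [/\ 0 < c < 1, 1 - c <= K * delta `^ alpha &
                weakly_porous c delta theta E].

(** * The parabolic Muckenhoupt class *)

Definition Rminus (gamma : R) (x : 'rV[R]_n) (t L : R) : set point :=
  cube x L `*` `]t - L `^ p, t - gamma * L `^ p[.

Definition Rplus (gamma : R) (x : 'rV[R]_n) (t L : R) : set point :=
  cube x L `*` `]t + gamma * L `^ p, t + L `^ p[.

(* [w] is replaced by +oo outside A so as to use [ess_inf], which is taken over
   the whole space. *)
Definition ess_inf_on (A : set point) (w : point -> \bar R) : \bar R :=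
  ess_inf mu (patch (cst +oo%E) A w).

Definition L1loc (w : point -> \bar R) : Prop :=
  forall K, compact K -> mu.-integrable K w.

(* w belongs to the parabolic Muckenhoupt class A_1^+(gamma) with constant C. *)
Definition A1plus (gamma C : R) (w : point -> \bar R) : Prop :=
  [/\ forall z, (0 <= w z)%E, L1loc w &
    forall x t L, 0 < L ->
    ((mu (Rminus gamma x t L))^-1 * \int[mu]_(z in Rminus gamma x t L) w z
     <= C%:E * ess_inf_on (Rplus gamma x t L) w)%E].

(* dist^(-a) for a > 0, with value +oo where the distance vanishes (whereas
   [0 `^ (- a) = 0]). *)
Definition dist_weight (E : set point) (a : R) (z : point) : \bar R :=
  if distp_set E z == 0 then +oo%E else (distp_set E z `^ (- a))%:E.

(** * The three conditions, with their constants *)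

Definition porous_with (theta c delta : R) (E : set point) : Prop :=
  [/\ 0 < c < 1, 0 < delta < 1 & weakly_porous c delta theta E].

Definition improving_with (theta c0 delta0 alpha K : R) (E : set point) : Prop :=
  [/\ porous_with theta c0 delta0 E, 0 < alpha, 0 < K &
      improving delta0 theta alpha K E].

Definition A1plus_with (gamma beta C : R) (E : set point) : Prop :=
  [/\ 0 < beta, 0 < C & A1plus gamma C (dist_weight E (beta * (n%:R + p)))].

End parabolic.

(* Main.v *)
(* Write [D] for the distance to [E]. Since (i) is part of (ii), the content is
   (i) => (iii) and (iii) => (ii). Each of (i) and (iii) yields a density estimate: if
   [y] lies in a forward time translate of a rectangle, then [D >= e * D y] on a fixed
   proportion of that rectangle. As [p > 1], going a given distance in many small steps
   takes arbitrarily little time, so density estimates chain: every rectangle in the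
   past of [y], at a comparable scale, has a point [z] with [D z >= e' * D y].
   For (i) => (iii), a Calderon-Zygmund selection with a time lag shows that the measure
   of [D < lam ^ k * D y] in a rectangle decays geometrically in [k], and summing over
   the layers bounds the integral of a small negative power of [D].
   For (iii) => (ii), Chebyshev's inequality bounds the measure of [D < lam * D y] by a
   multiple of [lam ^ (beta * (n + p))]; the lattice cells of side about [lam] times that
   of the largest free cell of the translate which meet [E] lie in this set, and the
   remaining ones are free. *)

Require Import Defs.
From mathcomp Require Import all_boot all_order all_algebra.
From mathcomp Require Import all_classical all_reals all_analysis.
From mathcomp Require Import ess_sup_inf measurable_realfun.
From mathcomp Require Import ring lra zify.

Import Order.TTheory GRing.Theory Num.Theory.
Import numFieldNormedType.Exports.

Local Open Scope classical_set_scope.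
Local Open Scope ring_scope.

Set Implicit Arguments.
Unset Strict Implicit.
Unset Printing Implicit Defensive.

(** * Parabolic distance and boxes *)

(** Information travels one way in time: if [D] is small on most of a cell, then it is small in the
    future of that cell, and nothing follows for its neighbours or its past. The selection therefore
    compares a selected cell with a lagged future, on which the next higher level is known, instead
    of with its parent. This has two costs. Futures of different cells may overlap, so the
    comparison is made on each vertical line separately, by a covering of the time axis; futures
    much taller than the lag keep the loss below the gain of the density estimate. Futures also
    stick out at the top of the rectangle, so the layers are cut at heights that decrease with k,
    and this works only because the cells selected for layer k are known beforehand to be small. The
    quantitative form comes from fixing every constant before the set [E] is introduced. *)

Section powR_superadditive.
Context {R : realType}.

(** Write u^p = u * u^(p - 1) and bound the second factor by (u + v)^(p - 1). Applied to p-th roots,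
    this gives the triangle inequality for the time part of [distp]. *)
Lemma powR_superadditive (p u v : R) : 1 <= p -> 0 <= u -> 0 <= v ->
  u `^ p + v `^ p <= (u + v) `^ p.
Proof.
move=> p1 u0 v0.
have p0 : 0 < p by lra.
rewrite -(mulr_powRB1 u0 p0) -(mulr_powRB1 v0 p0) -(mulr_powRB1 (addr_ge0 u0 v0) p0).
rewrite mulrDl lerD// ler_wpM2l// ge0_ler_powR ?nnegrE//; lra.
Qed.

Lemma powRK (p x : R) : p != 0 -> 0 <= x -> (x `^ p) `^ p^-1 = x.
Proof. by move=> p0 x0; rewrite -powRrM mulfV// powRr1. Qed.

Lemma powRVK (p x : R) : p != 0 -> 0 <= x -> (x `^ p^-1) `^ p = x.
Proof. by move=> p0 x0; rewrite -powRrM mulVf// powRr1. Qed.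

Lemma powRV_subadditive (p a b : R) : 1 <= p -> 0 <= a -> 0 <= b ->
  (a + b) `^ p^-1 <= a `^ p^-1 + b `^ p^-1.
Proof.
move=> p1 a0 b0; have p0 : p != 0 by lra.
have pV0 : 0 <= p^-1 by rewrite invr_ge0; lra.
have uv0 : 0 <= a `^ p^-1 + b `^ p^-1 by rewrite addr_ge0 ?powR_ge0.
rewrite -[leRHS](@powRK p)//.
apply: ge0_ler_powR; rewrite ?nnegrE ?addr_ge0 ?powR_ge0//.
apply: le_trans (powR_superadditive p1 (powR_ge0 _ _) (powR_ge0 _ _)).
by rewrite !powRVK.
Qed.

Lemma powR_leW (p a b : R) : 0 <= p -> 0 <= a -> a <= b -> a `^ p <= b `^ p.
Proof. by move=> p0 a0 ab; rewrite ge0_ler_powR ?nnegrE// (le_trans a0). Qed.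

Lemma powR_ltW (p a b : R) : 0 < p -> 0 <= a -> a < b -> a `^ p < b `^ p.
Proof. by move=> p0 a0 ab; rewrite gt0_ltr_powR ?nnegrE// (le_trans a0)// ltW. Qed.

End powR_superadditive.

Section rV_norm.
Context {R : realType} {n : nat}.
Implicit Types x : 'rV[R]_n.

Lemma rV_norm_leP x (r : R) : 0 <= r ->
  (`|x| <= r) <-> (forall i, `|x ord0 i| <= r).
Proof.
move=> r0; rewrite [`|x|]mx_normrE; split=> [xr i|xr].
  by apply: le_trans xr; exact: (le_bigmax _ (fun ij => `|x ij.1 ij.2|) (ord0, i)).
by apply: bigmax_le => // -[i j] _ /=; rewrite ord1.
Qed.

Lemma rV_coord_le x i : `|x ord0 i| <= `|x|.
Proof. exact: ((rV_norm_leP x (normr_ge0 x)).1 (lexx _) i). Qed.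

End rV_norm.

Section parabolic_distance.
Context {R : realType} {n : nat}.
Variable p : R.
Hypothesis hp : 1 < p.
Local Notation point := ('rV[R]_n * R)%type.
Implicit Types (E : set point) (z w v : point).

Let p_neq0 : p != 0. Proof. by move: hp; lra. Qed.
Let p_gt0 : 0 < p. Proof. by move: hp; lra. Qed.

Lemma distp_ge0 z w : 0 <= distp p z w.
Proof. by rewrite /distp le_max normr_ge0. Qed.

Lemma distpC z w : distp p z w = distp p w z.
Proof. by rewrite /distp distrC (distrC z.2). Qed.

Lemma distp_triangle z v w : distp p z w <= distp p z v + distp p v w.
Proof.
rewrite {1}/distp ge_max; apply/andP; split.
  rewrite (le_trans (ler_distD v.1 _ _))// lerD// /distp le_max lexx//.
apply: (@le_trans _ _ (`|z.2 - v.2| `^ p^-1 + `|v.2 - w.2| `^ p^-1)).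
  apply: le_trans (powRV_subadditive (ltW hp) (normr_ge0 _) (normr_ge0 _)).
  apply: powR_leW; rewrite ?normr_ge0 ?invr_ge0 ?(ltW p_gt0)//.
  exact: ler_distD.
by rewrite lerD// /distp le_max lexx orbT.
Qed.

Lemma distp_leP z w (r : R) : 0 <= r ->
  (distp p z w <= r) <->
  (forall i, `|z.1 ord0 i - w.1 ord0 i| <= r) /\ `|z.2 - w.2| <= r `^ p.
Proof.
move=> r0; rewrite /distp ge_max; split=> [/andP[zw1 zw2]|[zw1 zw2]].
  split=> [i|].
    by have := (rV_norm_leP _ r0).1 zw1 i; rewrite !mxE.
  by rewrite -[leLHS](@powRVK _ p)//; apply: powR_leW; rewrite ?powR_ge0 ?(ltW p_gt0).
apply/andP; split.
  by apply/(rV_norm_leP _ r0) => i; rewrite !mxE.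
by rewrite -[leRHS](@powRK _ p)//; apply: powR_leW; rewrite ?invr_ge0 ?(ltW p_gt0).
Qed.

Lemma distp_ltP z w (r : R) : 0 < r ->
  (forall i, `|z.1 ord0 i - w.1 ord0 i| < r) -> `|z.2 - w.2| < r `^ p ->
  distp p z w < r.
Proof.
move=> r0 zw1 zw2.
rewrite /distp gt_max; apply/andP; split; last first.
  by rewrite -[ltRHS](@powRK _ p) ?(ltW r0)//; apply: powR_ltW; rewrite ?invr_gt0 ?normr_ge0.
rewrite [`|_|]mx_normrE; apply: bigmax_lt => //= -[i j] _ /=; rewrite ord1.
by have := zw1 j; rewrite !mxE.
Qed.

Let has_lb E z : has_lbound [set distp p z w | w in E].
Proof. by exists 0 => _ [w _ <-]; exact: distp_ge0. Qed.

Lemma distp_set_ge0 E z : 0 <= distp_set p E z.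
Proof.
have [->|/set0P[w Ew]] := eqVneq E set0; last first.
  by apply: lb_le_inf => [|_ [v _ <-]]; [exists (distp p z w), w|exact: distp_ge0].
by rewrite /distp_set image_set0 inf0.
Qed.

Lemma distp_set_le E z w : E w -> distp_set p E z <= distp p z w.
Proof. by move=> Ew; apply: ge_inf; [exact: has_lb|exists w]. Qed.

Lemma distp_set_ltP E z (r : R) : E !=set0 -> distp_set p E z < r ->
  exists2 w, E w & distp p z w < r.
Proof.
move=> [w0 Ew0] zr.
have [||_ [w Ew <-] wr] := @inf_adherent _ [set distp p z w | w in E] (r - distp_set p E z).
- by rewrite subr_gt0.
- by split; [exists (distp p z w0), w0|].
by exists w => //; move: wr; rewrite addrC subrK.
Qed.

Lemma distp_set_lipschitz E z w : E !=set0 ->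
  distp_set p E z <= distp_set p E w + distp p z w.
Proof.
move=> E0; rewrite leNgt; apply/negP => H.
have [v Ev vr] : exists2 v, E v & distp p w v < distp_set p E z - distp p z w.
  by apply: distp_set_ltP => //; rewrite ltrBrDr.
have := distp_set_le z Ev; have := distp_triangle z w v; lra.
Qed.

End parabolic_distance.

Section boxes.
Context {R : realType} {n : nat}.
Local Notation point := ('rV[R]_n * R)%type.
Local Notation mu := (@lebesgue_xt R n).

(** The edge lengths are independent because the cells of the lattice have heights anywhere between
    l^p / 2 and l^p. *)
Definition box (a : 'rV[R]_n) (s l h : R) : set point :=
  [set x : 'rV[R]_n | forall i, a ord0 i <= x ord0 i < a ord0 i + l] `*` `[s, s + h[.

Lemma measurable_coord_box (A : 'I_n -> set R) : (forall i, measurable (A i)) ->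
  measurable [set x : 'rV[R]_n | forall i, A i (x ord0 i)].
Proof.
move=> mA.
have -> : [set x : 'rV[R]_n | forall i, A i (x ord0 i)] = \big[setI/setT]_(i < n)
    ((fun x : 'rV[R]_n => x ord0 i) @^-1` A i).
  rewrite -bigcap_seq; apply/seteqP; split => x Bx i /=.
    by move=> _; exact: Bx.
  by apply: (Bx i); rewrite /= mem_index_enum.
apply: bigsetI_measurable => i _; rewrite -[X in measurable X]setTI.
by apply: measurable_coord => //; exact: mA.
Qed.

Lemma measurable_slab (a : 'rV[R]_n) (l : R) (I : interval R) :
  measurable ([set x : 'rV[R]_n | forall i, a ord0 i <= x ord0 i < a ord0 i + l]
    `*` ([set` I] : set (measurableTypeR R))).
Proof.
apply: measurableX; last exact: measurable_itv.
apply: (@measurable_coord_box (fun i => [set` `[a ord0 i, a ord0 i + l[])) => i.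
exact: measurable_itv.
Qed.

Lemma mu_slab (a : 'rV[R]_n) (l : R) (I : interval R) : 0 <= l ->
  mu ([set x : 'rV[R]_n | forall i, a ord0 i <= x ord0 i < a ord0 i + l]
    `*` ([set` I] : set (measurableTypeR R)))
  = ((l ^+ n)%:E * lebesgue_measure [set` I])%E.
Proof.
move=> l0; rewrite /lebesgue_xt /=.
rewrite product_measure1E//; last first.
  apply: (@measurable_coord_box (fun i => [set` `[a ord0 i, a ord0 i + l[])) => i.
  exact: measurable_itv.
congr (_ * _)%E.
have -> : [set x : 'rV[R]_n | forall i, a ord0 i <= x ord0 i < a ord0 i + l] =
   [set x | forall i, [set` `[a ord0 i, a ord0 i + l[] (x ord0 i)].
  by apply/seteqP; split => x xi i; have := xi i; rewrite /= in_itv.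
rewrite [LHS](lebesgue_rV_box (A := fun i => [set` `[a ord0 i, a ord0 i + l[]));
  last by move=> i; exact: measurable_itv.
under eq_bigr => i _.
  rewrite lebesgue_measure_itv /= lte_fin.
  have -> : (if a ord0 i < a ord0 i + l then ((a ord0 i + l)%:E - (a ord0 i)%:E)%E else 0%E) = l%:E.
    have [|la] := ltP (a ord0 i) (a ord0 i + l).
      by move=> _; rewrite -EFinB; congr EFin; lra.
    by congr EFin; lra.
  over.
by rewrite prodEFin prodr_const card_ord.
Qed.

Lemma measurable_box a s l h : measurable (box a s l h : set ('rV[R]_n * measurableTypeR R)).
Proof. exact: measurable_slab. Qed.

Lemma mu_box a s l h : 0 <= l -> 0 <= h -> mu (box a s l h) = (l ^+ n * h)%:E.
Proof.
move=> l0 h0; rewrite /box mu_slab// lebesgue_measure_itv /= lte_fin.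
rewrite EFinM; congr (_ * _)%E; case: ltP => hs.
  by rewrite -EFinB; congr EFin; lra.
by congr EFin; lra.
Qed.

Lemma box_distp (p : R) (a : 'rV[R]_n) (s l h : R) (z w : point) : 1 < p -> 0 < l -> h <= l `^ p ->
  box a s l h z -> box a s l h w -> distp p z w <= l.
Proof.
move=> hp l0 hl [zx +] [wx +]; rewrite /= !in_itv/= => /andP[z1 z2] /andP[w1 w2].
apply/(distp_leP hp); first exact: ltW.
split => [q|]; last by rewrite ler_norml; apply/andP; split; lra.
have /andP[? ?] := zx q; have /andP[? ?] := wx q.
by rewrite ler_norml; apply/andP; split; lra.
Qed.

(** The sigma-algebra is generated by the coordinates, so a set that is open for the sup norm is
    exhibited as a countable union of boxes with rational centre and radius 1 / (m + 1). *)
Lemma measurable_neighborhood (U : set point) :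
  (forall z, U z -> exists2 e : R, 0 < e & forall w : point,
    (forall i, `|z.1 ord0 i - w.1 ord0 i| < e) -> `|z.2 - w.2| < e -> U w) ->
  measurable (U : set ('rV[R]_n * measurableTypeR R)).
Proof.
move=> openU.
pose B (q : 'rV[rat]_n * rat * nat) : set ('rV[R]_n * measurableTypeR R) :=
  [set x : 'rV[R]_n | forall i, [set` `](ratr (q.1.1 ord0 i) - q.2.+1%:R^-1),
      (ratr (q.1.1 ord0 i) + q.2.+1%:R^-1)[] (x ord0 i)] `*`
  [set` `](ratr q.1.2 - q.2.+1%:R^-1), (ratr q.1.2 + q.2.+1%:R^-1)[].
have -> : U = \bigcup_(q in [set q | B q `<=` U]) B q.
  apply/seteqP; split => [z Uz|z [q qU /qU//]].
  have [e e0 eU] := openU z Uz.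
  have [m me] : exists m : nat, m.+1%:R^-1 < e / 2.
    have := @near_infty_natSinv_lt R (PosNum (divr_gt0 e0 (ltr0n _ 2))) => -[m _ /(_ m (leqnn _)) /= H].
    by exists m.
  have m0 : 0 < m.+1%:R^-1 :> R by rewrite invr_gt0.
  move km : (m.+1%:R^-1) me m0 => k me m0.
  have ratP (x : R) : exists q : rat, `|x - ratr q| < k.
    have [|q] := @rat_in_itvoo _ x (x + k); first by rewrite ltrDl.
    by rewrite in_itv /= => /andP[? ?]; exists q; rewrite ltr_norml; apply/andP; split; lra.
  pose f (x : R) := projT1 (cid (ratP x)).
  have fP (x : R) : `|x - ratr (f x)| < k by exact: (projT2 (cid (ratP x))).
  exists ((\row_i f (z.1 ord0 i)), f z.2, m).
    rewrite /B /= km => w [/= w1 w2]; apply: eU => [i|].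
      have := w1 i; rewrite mxE in_itv /= => /andP[? ?].
      by move: (fP (z.1 ord0 i)); rewrite !ltr_norml => /andP[? ?]; apply/andP; split; lra.
    move: w2; rewrite in_itv /= => /andP[? ?].
    by move: (fP z.2); rewrite !ltr_norml => /andP[? ?]; apply/andP; split; lra.
  rewrite /B /= km; split => /= [i|].
    rewrite mxE in_itv/=; move: (fP (z.1 ord0 i)); rewrite !ltr_norml => /andP[? ?].
    by apply/andP; split; lra.
  by rewrite in_itv/=; have := fP z.2; rewrite !ltr_norml; lra.
rewrite bigcup_mkcond; apply: countable_bigcupT_measurable => [|q]; first exact: countableP.
case: ifP => _; last exact: measurable0.
apply: measurableX; last exact: measurable_itv.
apply: (@measurable_coord_box (fun i => [set` `](ratr (q.1.1 ord0 i) - q.2.+1%:R^-1),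
  (ratr (q.1.1 ord0 i) + q.2.+1%:R^-1)[])) => i.
exact: measurable_itv.
Qed.

Lemma open_measurable_xt (U : set point) : open U ->
  measurable (U : set ('rV[R]_n * measurableTypeR R)).
Proof.
move=> oU; apply: measurable_neighborhood => z Uz.
have /nbhs_ballP[e /= e0 eU] : nbhs z U by exact: open_nbhs_nbhs.
exists e => // w w1 w2; apply: eU; split => /=.
  by split=> // i j; rewrite ord1 -ball_normE /ball_/=; exact: w1.
by rewrite -ball_normE.
Qed.

Lemma measurable_distp_lt (p : R) (E : set point) (r : R) : 1 < p -> E !=set0 ->
  measurable ([set z | distp_set p E z < r] : set ('rV[R]_n * measurableTypeR R)).
Proof.
move=> hp E0; apply: measurable_neighborhood => z /= zr.
have p0 : 0 < p by lra.
pose t := (r - distp_set p E z).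
have t0 : 0 < t by rewrite subr_gt0.
(* [distp] is below t when the spatial distance is below t and the time distance is below t^p. *)
exists (Num.min t (t `^ p)); first by rewrite lt_min t0 powR_gt0.
move=> w w1 w2; apply: le_lt_trans (distp_set_lipschitz hp w z E0) _.
rewrite -ltrBrDl -/t distpC; apply: distp_ltP => // [i|].
  by apply: lt_le_trans (w1 i) _; rewrite ge_min lexx.
by apply: lt_le_trans w2 _; rewrite ge_min lexx orbT.
Qed.

End boxes.

(** * Chains of points with comparable distance to E *)

Section chains.
Context {R : realType} {n : nat}.
Local Notation point := ('rV[R]_n * R)%type.
Variables (p kappa theta m e : R).
Hypotheses (hkappa : 0 < kappa) (htheta : 1 < theta).
Hypotheses (hm : 0 < m <= 4^-1) (he : 0 < e <= 1).

(** The margin at the spatial faces turns a step into a directed move: if [y] lies close to one face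
    of the box, [z] is forced away from that face. *)
Definition step_property (D : point -> R) : Prop :=
  forall (a : 'rV[R]_n) (s l : R) (y : point), 0 < l ->
  (forall i, a ord0 i <= y.1 ord0 i < a ord0 i + l) ->
  s + theta * (kappa * l `^ p) < y.2 < s + (theta + 1) * (kappa * l `^ p) ->
  exists z : point, [/\ forall i, a ord0 i + 2 * (m * l) <= z.1 ord0 i < a ord0 i + l - 2 * (m * l),
    s <= z.2 < s + kappa * l `^ p & e * D y <= D z].

Variable D : point -> R.
Hypotheses (D_ge0 : forall z, 0 <= D z) (stepD : step_property D).

Section target.
Variables (b : 'rV[R]_n) (L l : R).
Hypotheses (l_gt0 : 0 < l) (lL : l <= L).

Let h := kappa * l `^ p.
Let h_gt0 : 0 < h. Proof. by rewrite mulr_gt0 // powR_gt0. Qed.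

Definition near_cube (X : R) (y : point) : Prop :=
  forall i, b ord0 i - X <= y.1 ord0 i < b ord0 i + L + X.

Lemma step_toward (X : R) (y : point) : near_cube X y ->
  exists z : point, [/\ near_cube (Num.max 0 (X - m * l)) z,
    y.2 - (theta + 1) * h <= z.2 <= y.2 - h / 2 & e * D y <= D z].
Proof.
move=> Xy; have [m0 m4] := andP hm.
have [h0 ht l0 lL'] := And4 h_gt0 htheta l_gt0 lL.
have ml0 : 0 < m * l by rewrite mulr_gt0.
have ml4 : m * l <= l / 4 by rewrite mulrC ler_wpM2l ?(ltW l_gt0).
(* The corner is chosen coordinate by coordinate. Outside the cube, [y] is put at distance m * l
   from the outer face, so the margin 2 * (m * l) moves [z] inwards by at least m * l. Inside, the
   box is kept within the cube. *)
pose c i := if y.1 ord0 i < b ord0 i then y.1 ord0 i - m * l else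
  if y.1 ord0 i < b ord0 i + L then Num.min (y.1 ord0 i) (b ord0 i + L - l)
  else y.1 ord0 i - l + m * l.
(* The term [2^-1] puts [y] at mid-height of the forward translate; as theta > 1, the step then goes
   back in time by at least h / 2. *)
have [||z [z1 z2 zD]] := @stepD (\row_i c i) (y.2 - (theta + 2^-1) * h) l y l_gt0.
- move=> i; rewrite mxE /c; case: (ltP (y.1 ord0 i) (b ord0 i)) => yb; first by apply/andP; split; lra.
  case: (ltP (y.1 ord0 i) (b ord0 i + L)) => ybL; last by apply/andP; split; lra.
  by case: (leP (y.1 ord0 i) (b ord0 i + L - l)) => ?; apply/andP; split; lra.
- by rewrite -/h; apply/andP; split; nra.
exists z; split => //; last first.
  rewrite -/h in z2; move/andP: z2 => [? ?].
  by apply/andP; split; nra.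
move=> i; have := z1 i; rewrite mxE /c => {z1}.
have /andP[X1 X2] := Xy i.
have [Y [-> Y0 YX]] : exists Y : R, [/\ Num.max 0 (X - m * l) = Y, 0 <= Y & X - m * l <= Y].
  by exists (Num.max 0 (X - m * l)); rewrite !le_max !lexx orbT.
clear - X1 X2 Y0 YX ml0 ml4 l0 lL'.
case: (ltP (y.1 ord0 i) (b ord0 i)) => yb; first by move=> /andP[? ?]; apply/andP; split; lra.
case: (ltP (y.1 ord0 i) (b ord0 i + L)) => ybL; last by move=> /andP[? ?]; apply/andP; split; lra.
by case: (leP (y.1 ord0 i) (b ord0 i + L - l)) => ? /andP[? ?]; apply/andP; split; lra.
Qed.

Lemma steps_toward (k : nat) (X : R) (y : point) : 0 <= X -> near_cube X y ->
  exists z : point, [/\ near_cube (Num.max 0 (X - k%:R * (m * l))) z,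
    y.2 - k%:R * ((theta + 1) * h) <= z.2 <= y.2 & e ^+ k * D y <= D z].
Proof.
move=> X0; have h0 := h_gt0; elim: k y => [|k IH] y Xy.
  exists y; rewrite !mul0r !subr0 expr0 mul1r lexx; split => //.
  by rewrite (max_idPr X0).
have [z [zX zt zD]] := IH y Xy.
have [w [wX wt wD]] := step_toward zX.
exists w; split.
- move=> i; have := wX i.
  suff -> : Num.max 0 (Num.max 0 (X - k%:R * (m * l)) - m * l) =
     Num.max 0 (X - k.+1%:R * (m * l)) by [].
  have ml0 : 0 < m * l by rewrite mulr_gt0//; case/andP: hm.
  have -> : X - k.+1%:R * (m * l) = X - k%:R * (m * l) - m * l by rewrite -natr1; ring.
  by case: (leP 0 (X - k%:R * (m * l))) => //= H; rewrite !max_l//; lra.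
- move/andP: zt wt => [? ?] /andP[? ?].
  have -> : k.+1%:R * ((theta + 1) * h) = k%:R * ((theta + 1) * h) + (theta + 1) * h.
    by rewrite -natr1; ring.
  by apply/andP; split; lra.
- rewrite exprS -mulrA; apply: le_trans wD.
  by rewrite ler_wpM2l//; case/andP: he => /ltW.
Qed.

Lemma near_cube_box (y : point) S H : near_cube 0 y -> S <= y.2 < S + H -> box b S L H y.
Proof.
move=> y0 y2; split => [i|]; last by rewrite /= in_itv.
by have := y0 i; rewrite subr0 addr0.
Qed.

(** A step goes back by at least h / 2 and at most (theta + 1) * h <= H. So the slab of height [H]
    is reached after at most [N] steps and cannot be jumped over; the factors e <= 1 of the
    remaining steps are given away. *)
Lemma steps_down (N : nat) (S H : R) (y : point) : near_cube 0 y ->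
  (theta + 1) * h <= H -> S <= y.2 < S + H + N%:R * (h / 2) ->
  exists z : point, box b S L H z /\ e ^+ N * D y <= D z.
Proof.
move=> + hH; elim: N y => [|N IH] y y0 yN.
  exists y; rewrite expr0 mul1r; split => //; apply: near_cube_box => //.
  by move: yN; rewrite mul0r addr0.
have [e0 e1] := andP he.
have [yH|Hy] := ltP y.2 (S + H).
  exists y; split; first by apply: near_cube_box => //; case/andP: yN => ->.
  by rewrite ler_piMl// exprn_ile1// ltW.
have [z [z0 z2 zD]] := step_toward y0.
have {}z0 : near_cube 0 z.
  have E : Num.max 0 (0 - m * l) = 0.
    by rewrite max_l// sub0r oppr_le0 mulr_ge0 ?(ltW l_gt0)//; case/andP: hm => /ltW.
  by move=> i; have := z0 i; rewrite E.
have [|w [wB wD]] := IH z z0.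
  move: yN z2; rewrite -natr1 mulrDl mul1r => /andP[? ?] /andP[? ?].
  by apply/andP; split; lra.
exists w; split => //; rewrite exprSr -mulrA; apply: le_trans wD.
by rewrite ler_wpM2l// exprn_ge0// ltW.
Qed.

End target.
End chains.

Lemma natr_ceil_exists {R : realType} (x : R) : 0 <= x -> exists k : nat, x <= k%:R <= x + 1.
Proof.
move=> x0; exists (Num.trunc x).+1; have /andP[x1 x2] := truncn_itv x0.
by rewrite (ltW x2) -natr1 lerD2r.
Qed.

(** A Harnack chain condition, one-sided in time and invariant under scaling: [e] may depend on [M]
    and [sigma] but not on [L]. *)
Definition chain_property {R : realType} {n : nat} (p M sigma e : R)
    (D : 'rV[R]_n * R -> R) : Prop :=
  forall (b : 'rV[R]_n) (S L H : R) (y : 'rV[R]_n * R), 0 < L -> sigma * L `^ p <= H ->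
  (forall i, b ord0 i - M * L <= y.1 ord0 i <= b ord0 i + M * L) ->
  S + H + sigma * L `^ p <= y.2 <= S + M * L `^ p ->
  exists z, box b S L H z /\ e * D y <= D z.

(* Since [p > 1], moving across a distance [M L] by steps of spatial size [eta L]
   takes a time of order [eta^(p - 1) L^p], which is below [sigma L^p] for small eta. *)
Lemma chain_lemma {R : realType} {n : nat} (p kappa theta m e M sigma : R) : 1 < p -> 0 < kappa ->
  1 < theta -> 0 < m <= 4^-1 -> 0 < e <= 1 -> 0 < M -> 0 < sigma ->
  exists e' : R, 0 < e' <= 1 /\
  forall D : 'rV[R]_n * R -> R, (forall z, 0 <= D z) ->
  step_property p kappa theta m e D -> chain_property p M sigma e' D.
Proof.
move=> hp kappa0 theta1 hm he M0 sigma0.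
have [m0 m4] := andP hm; have [e0 e1] := andP he.
(* About M / (m * eta) steps reach the cube, each costing at most (theta + 1) * kappa * eta^p * L^p
   in time. [A] is such that the total is at most A * eta^(p - 1) * L^p. *)
pose A := (theta + 1) * kappa * (M / m + 2).
have Mm0 : 0 < M / m by rewrite divr_gt0.
have A0 : 0 < A by rewrite !mulr_gt0//; lra.
have sA : 0 < sigma / A by rewrite divr_gt0.
pose eta := Num.min 1 ((sigma / A) `^ (p - 1)^-1).
have eta0 : 0 < eta by rewrite lt_min ltr01 powR_gt0.
have eta1 : eta <= 1 by rewrite ge_min lexx.
have p1 : 0 < p - 1 by lra.
have etap : eta `^ (p - 1) <= sigma / A.
  rewrite -[leRHS](@powRVK _ (p - 1)) ?(gt_eqF p1) ?(ltW sA)//.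
  by apply: powR_leW; rewrite ?(ltW p1) ?(ltW eta0)// ge_min lexx orbT.
have etaE : eta `^ p = eta * eta `^ (p - 1).
  by rewrite mulr_powRB1// ?(ltW eta0)//; lra.
have etap0 : 0 < eta `^ p by rewrite powR_gt0.
have [|k1 /andP[k1a k1b]] := @natr_ceil_exists _ (M / (m * eta) + 1).
  by rewrite addr_ge0// ltW// divr_gt0// mulr_gt0.
(* [N] further steps, each going back by at least h / 2, exhaust a time lapse of M * L^p. *)
have [|N /andP[Na _]] := @natr_ceil_exists _ (2 * M / (kappa * eta `^ p) + 1).
  by rewrite addr_ge0// ltW// divr_gt0// mulr_gt0.
exists (e ^+ (k1 + N)); split; first by rewrite exprn_gt0// exprn_ile1// ltW.
move=> D D0 stepD b S L H y L0 HL ynear yt.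
pose l := eta * L.
have l0 : 0 < l by rewrite mulr_gt0.
have lL : l <= L by rewrite ler_piMl// ltW.
have lp : l `^ p = eta `^ p * L `^ p by rewrite powRM ?(ltW eta0) ?(ltW L0).
have Lp0 : 0 < L `^ p by rewrite powR_gt0.
have k1h : k1%:R * ((theta + 1) * (kappa * l `^ p)) <= sigma * L `^ p.
  rewrite lp [X in X <= _](_ : _ = (theta + 1) * kappa * (k1%:R * eta `^ p) * L `^ p); last ring.
  rewrite ler_wpM2r ?(ltW Lp0)//.
  apply: (@le_trans _ _ (A * eta `^ (p - 1))); last by rewrite mulrC -ler_pdivlMr.
  rewrite /A -[leRHS]mulrA ler_wpM2l//; first by rewrite mulr_ge0 ?(ltW kappa0)//; lra.
  rewrite etaE mulrA ler_wpM2r ?powR_ge0//.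
  have -> : M / m + 2 = (M / (m * eta) + 2 / eta) * eta.
    by field; rewrite gt_eqF//= gt_eqF.
  rewrite ler_wpM2r ?(ltW eta0)//; apply: le_trans k1b _.
  rewrite -addrA lerD2l ler_pdivlMr//; lra.
have k1ge1 : 1 <= k1%:R :> R.
  by apply: le_trans k1a; rewrite lerDr ltW// divr_gt0// mulr_gt0.
have hH : (theta + 1) * (kappa * l `^ p) <= H.
  apply: le_trans HL; apply: le_trans k1h.
  by rewrite ler_peMl// !mulr_ge0 ?powR_ge0 ?(ltW kappa0)//; lra.
have ML0 : 0 <= M * L by rewrite mulr_ge0 ?ltW.
have [|z [z1 z2 zD]] := steps_toward kappa0 theta1 hm he stepD l0 lL k1 ML0 (y := y) (b := b).
  by move=> i; have /andP[y1 y2] := ynear i; clear - y1 y2 L0; apply/andP; split; lra.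
have {}z1 : near_cube b L 0 z.
  move=> i; have := z1 i; rewrite max_l// subr_le0.
  have -> : M * L = M / (m * eta) * (m * l).
    by rewrite /l; field; rewrite gt_eqF//= gt_eqF.
  by rewrite ler_wpM2r ?(ltW (mulr_gt0 m0 l0))//; clear - k1a; lra.
have [|w [wB wD]] := steps_down kappa0 theta1 hm he D0 stepD l0 lL (N := N) (S := S) z1 hH.
  move/andP: z2 yt => [? ?] /andP[? ?]; apply/andP; split; first lra.
  suff : M * L `^ p < N%:R * (kappa * l `^ p / 2).
    have : 0 <= H by apply: le_trans hH; rewrite !mulr_ge0 ?powR_ge0 ?(ltW kappa0)//; lra.
    lra.
  rewrite lp [X in _ < X](_ : _ = (N%:R * (kappa * eta `^ p / 2)) * L `^ p); last ring.
  rewrite ltr_pM2r// -ltr_pdivrMr; last by rewrite divr_gt0// mulr_gt0.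
  apply: lt_le_trans Na; rewrite [X in X < _](_ : _ = 2 * M / (kappa * eta `^ p)); first lra.
  by field; rewrite !gt_eqF.
exists w; split => //; rewrite addnC exprD -mulrA; apply: le_trans wD.
by rewrite ler_wpM2l// exprn_ge0// ltW.
Qed.

(** * From measure density to chains, and a covering argument *)

Lemma bernoulli_le {R : realType} (x : R) n : 0 <= x <= 1 -> 1 - n%:R * x <= (1 - x) ^+ n.
Proof.
move=> /andP[x0 x1]; elim: n => [|n IH]; first by rewrite mul0r subr0 expr0.
rewrite exprS; apply: (@le_trans _ _ ((1 - x) * (1 - n%:R * x))); last first.
  by rewrite ler_wpM2l// subr_ge0.
rewrite -natr1; have : 0 <= n%:R * (x * x) by rewrite !mulr_ge0.
nra.
Qed.

Definition sublevel {R : realType} {T : Type} (D : T -> R) (r : R) : set T :=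
  [set z | D z < r].

Section density.
Context {R : realType} {n : nat}.
Local Notation point := ('rV[R]_n * R)%type.
Local Notation mu := (@lebesgue_xt R n).
Variables (p kappa1 kappa2 theta c e : R) (D : point -> R).

(** A range of heights is allowed because porosity gives all of [l^p / 2, l^p], whereas the
    Muckenhoupt condition gives only the height (1 - gamma) * l^p. *)
Definition density_property : Prop :=
  forall (a : 'rV[R]_n) (s l h : R) (y : point), 0 < l ->
  kappa1 * l `^ p <= h <= kappa2 * l `^ p ->
  (forall i, a ord0 i <= y.1 ord0 i < a ord0 i + l) ->
  s + theta * h < y.2 < s + (theta + 1) * h ->
  (mu (box a s l h `&` sublevel D (e * D y)) <= ((1 - c) * (l ^+ n * h))%:E)%E.

(** With m = c / (8 n), removing the margin 2 m l at all spatial faces costs at most the fraction 4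
    n m = c / 2 of the box. What is left has proportion more than 1 - c, so the sublevel set cannot
    contain it. *)
Lemma density_step (kappa : R) : (0 < n)%N -> 0 < c < 1 -> 0 < kappa ->
  kappa1 <= kappa <= kappa2 ->
  (forall r, measurable (sublevel D r : set ('rV[R]_n * measurableTypeR R))) ->
  density_property ->
  step_property p kappa theta (c / (8 * n%:R)) e D.
Proof.
move=> n0 /andP[c0 c1] k0 /andP[k1 k2] mD dD a s l y l0 ya yt.
have lp0 : 0 < l `^ p by rewrite powR_gt0.
set h := kappa * l `^ p in yt *.
have h0 : 0 < h by rewrite mulr_gt0.
have nR : 1 <= n%:R :> R by rewrite ler1n.
set m := c / (8 * n%:R).
have m0 : 0 < m by rewrite divr_gt0// mulr_gt0//; lra.
have nm : n%:R * m = c / 8 by rewrite /m; field; rewrite pnatr_eq0 -lt0n.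
have m1 : m <= n%:R * m by rewrite ler_peMl// ltW.
have ml0 : 0 < m * l by rewrite mulr_gt0.
have ml1 : m * l <= l / 8 by rewrite [leRHS]mulrC ler_wpM2r ?(ltW l0)//; lra.
apply: contrapT => noz.
have := dD a s l h y l0 _ ya yt.
rewrite !ler_wpM2r ?(ltW lp0)// => /(_ isT); apply/negP; rewrite -ltNge.
pose B := box (\row_i (a ord0 i + 2 * m * l)) s (l - 4 * m * l) h.
apply: (@lt_le_trans _ _ (mu B)).
  rewrite mu_box ?(ltW h0)//; last lra.
  rewrite lte_fin mulrA ltr_pM2r//.
  have -> : l - 4 * m * l = (1 - 4 * m) * l by ring.
  rewrite exprMn ltr_pM2r ?exprn_gt0//.
  apply: lt_le_trans (bernoulli_le n (x := 4 * m) _); last by apply/andP; split; lra.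
  have -> : n%:R * (4 * m) = c / 2 by rewrite mulrCA nm; lra.
  lra.
apply: le_measure.
- by rewrite inE; exact: measurable_box.
- by rewrite inE; apply: measurableI; [exact: measurable_box|exact: mD].
move=> z [zx zt].
have {}zx i : a ord0 i + 2 * m * l <= z.1 ord0 i < a ord0 i + l - 2 * m * l.
  by have := zx i; rewrite mxE => /andP[? ?]; apply/andP; split; lra.
split.
  split => // i; have /andP[? ?] := zx i; apply/andP; split; lra.
rewrite /sublevel /= ltNge; apply/negP => zD; apply: noz; exists z; split => //.
by move=> i; rewrite (mulrA 2 m l); exact: zx.
Qed.

End density.

(** * A covering argument in the time variable *)

Section one_dimensional_covering.
Context {R : realType}.
Local Notation leb := (@lebesgue_measure R).

Lemma measurable_ray (W : set R) (T : R) : measurable (W : set (measurableTypeR R)) ->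
  measurable ((W `&` [set` `[T, +oo[]) : set (measurableTypeR R)).
Proof. by move=> mW; apply: measurableI => //; exact: measurable_itv. Qed.

(* From left to right: the leftmost uncovered point [t] of [W] takes the whole
   interval [[t, e[], which has length at least [eta]. *)
Lemma greedy_covering (W K : set R) (bot top eta rho : R) :
  measurable (W : set (measurableTypeR R)) -> measurable (K : set (measurableTypeR R)) ->
  0 < eta -> 0 < rho ->
  (forall t, W t -> bot <= t < top) ->
  (forall T, (exists2 t, W t & T <= t) ->
     exists t, [/\ W t, T <= t & forall t', W t' -> T <= t' -> t <= t']) ->
  (forall t, W t -> exists e : R, t + eta <= e /\
     ((rho * (e - t))%:E <= leb (K `&` [set` `[t, e[]))%E) ->
  (rho%:E * leb W <= leb K)%E.
Proof.
move=> mW mK eta0 rho0 Wbd Wmin WK.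
(* [k] bounds the number of intervals that can still be placed on [T, top), each of length at least
   [eta]. *)
have H (k : nat) (T : R) : top - T <= k%:R * eta ->
    (rho%:E * leb (W `&` [set` `[T, +oo[]) <= leb (K `&` [set` `[T, +oo[]))%E.
  elim: k T => [|k IH] T.
    rewrite mul0r => topT; rewrite [X in leb X](_ : _ = set0) ?measure0 ?mule0//.
    by rewrite -subset0 => t /= [/Wbd]; rewrite in_itv/= andbT => /andP[_ ?] ?; lra.
  rewrite -natr1 mulrDl mul1r => topT.
  have [WT|noW] := pselect (exists2 t, W t & T <= t); last first.
    rewrite [X in leb X](_ : _ = set0) ?measure0 ?mule0//.
    by rewrite -subset0 => t /= [Wt]; rewrite in_itv/= andbT => tT; apply: noW; exists t.
  have [t [Wt Tt tmin]] := Wmin T WT.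
  have [e [te eK]] := WK t Wt.
  have {}IH := IH e ltac:(lra).
  apply: (@le_trans _ _ (rho%:E * (leb [set` `[t, e[] + leb (W `&` [set` `[e, +oo[])))%E).
    rewrite lee_pmul2l//.
    apply: (@le_trans _ _ (leb ([set` `[t, e[] `|` (W `&` [set` `[e, +oo[])))); last first.
      by apply: measureU2; [exact: measurable_itv|exact: measurable_ray].
    apply: le_measure; rewrite ?inE; first exact: measurable_ray.
    - by apply: measurableU; [exact: measurable_itv|exact: measurable_ray].
    - move=> t' /= [Wt']; rewrite !in_itv/= !andbT => Tt'.
      have := tmin _ Wt' Tt' => tt'.
      by have [|et'] := ltP t' e; [left|right]; rewrite ?tt'.
  rewrite muleDr ?fin_num_adde_defr//; last first.
    by rewrite lebesgue_measure_itv/= lte_fin; case: ifP.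
  apply: (@le_trans _ _ (leb (K `&` [set` `[t, e[]) + leb (K `&` [set` `[e, +oo[]))%E).
    apply: leeD => //; apply: le_trans eK.
    by rewrite lebesgue_measure_itv/= lte_fin ifT ?EFinM//; lra.
  rewrite -measureU; last 3 first.
  - by apply: measurableI => //; exact: measurable_itv.
  - exact: measurable_ray.
  - by rewrite -subset0 => x /= [[_]]; rewrite !in_itv/= => /andP[_ xe] [_]; rewrite leNgt xe.
  apply: le_measure; rewrite ?inE; last 2 first.
  - exact: measurable_ray.
  - move=> x [[Kx]|[Kx]]; rewrite /= !in_itv/= ?andbT => xt; split => //=.
      by case/andP: xt => ? _; rewrite ?andbT; lra.
    by rewrite ?andbT; lra.
  - by apply: measurableU; [apply: measurableI => //; exact: measurable_itv|exact: measurable_ray].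
have [k /andP[tk _]] := @natr_ceil_exists _ (Num.max 0 ((top - bot) / eta))
  ltac:(by rewrite le_max lexx).
have {}tk : (top - bot) / eta <= k%:R by apply: le_trans tk; rewrite le_max lexx orbT.
apply: (@le_trans _ _ (rho%:E * leb (W `&` [set` `[bot, +oo[]))%E).
  rewrite [in leRHS](_ : _ `&` _ = W)//; apply/seteqP; split => [t []//|t Wt].
  by split => //=; rewrite in_itv/= andbT; case/andP: (Wbd _ Wt).
apply: (le_trans (H k bot _)); first by rewrite -ler_pdivrMr.
by apply: le_measure => [||t []//]; rewrite inE//; exact: measurable_ray.
Qed.

End one_dimensional_covering.

Section slices.
Context {R : realType} {n : nat}.
Local Notation mu := (@lebesgue_xt R n).

Lemma slicewise_measure_le (S U : set ('rV[R]_n * measurableTypeR R)) (rho : R) :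
  measurable S -> measurable U -> 0 <= rho ->
  (forall x, (rho%:E * lebesgue_measure (xsection S x) <= lebesgue_measure (xsection U x))%E) ->
  (rho%:E * mu S <= mu U)%E.
Proof.
move=> mS mU rho0 SU; rewrite /lebesgue_xt /= /product_measure1.
rewrite -ge0_integralZl//; last exact: measurable_fun_xsection.
apply: ge0_le_integral => //=.
- by move=> x _; rewrite mule_ge0.
- by apply: measurable_funeM; exact: measurable_fun_xsection.
- exact: measurable_fun_xsection.
Qed.

End slices.

(** * Nested grids *)

Lemma measure_setI_bigsetU_le d (T : measurableType d) (R : realType)
    (mu : {measure set T -> \bar R}) (I : choiceType) (r : seq I) (G : I -> set T)
    (X : set T) (tau : R) : uniq r -> 0 <= tau -> measurable X ->
  (forall i, measurable (G i)) ->
  (forall i j, i \in r -> j \in r -> i != j -> G i `&` G j = set0) ->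
  (forall i, i \in r -> (mu (X `&` G i) <= tau%:E * mu (G i))%E) ->
  (mu (X `&` \big[setU/set0]_(i <- r) G i) <= tau%:E * mu (\big[setU/set0]_(i <- r) G i))%E.
Proof.
move=> + tau0 mX mG; elim: r => [|i r IH] /=.
  by move=> _ _ _; rewrite big_nil setI0 measure0 mule0.
move=> /andP[ir ur] dG XG; rewrite big_cons.
have mU : measurable (\big[setU/set0]_(i <- r) G i) by exact: bigsetU_measurable.
have IHr : (mu (X `&` \big[setU/set0]_(i <- r) G i)
    <= tau%:E * mu (\big[setU/set0]_(i <- r) G i))%E.
  apply: IH => // [j k jr kr|j jr]; last by apply: XG; rewrite in_cons jr orbT.
  by apply: dG; rewrite in_cons ?jr ?kr orbT.
rewrite setIUr; apply: (@le_trans _ _ (mu (X `&` G i) +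
    mu (X `&` \big[setU/set0]_(i <- r) G i))%E).
  by apply: measureU2; exact: measurableI.
rewrite measureU//; last first.
  rewrite -subset0 => x [Gix]; rewrite -bigcup_seq => -[j /= jr Gjx].
  have ij : i != j by apply: contraNneq ir => ->.
  have : (G i `&` G j) x by [].
  by rewrite dG// in_cons ?eqxx ?jr ?orbT.
rewrite ge0_muleDr ?measure_ge0//; apply: leeD => //.
by apply: XG; rewrite in_cons eqxx.
Qed.

Section truncation.
Context {R : realType}.

Lemma trunc_eq (x : R) (k : nat) : k%:R <= x < k%:R + 1 -> Num.trunc x = k.
Proof. by rewrite natr1; exact: truncn_def. Qed.

Lemma trunc_bounds (x : R) : 0 <= x -> (Num.trunc x)%:R <= x < (Num.trunc x)%:R + 1.
Proof. by move=> x0; rewrite natr1; exact: truncn_itv. Qed.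

Lemma trunc_lt (x : R) (k : nat) : 0 <= x -> x < k%:R -> (Num.trunc x < k)%N.
Proof.
move=> x0 xk; have /andP[tx _] := trunc_bounds x0.
by rewrite -(ltr_nat R); exact: le_lt_trans xk.
Qed.

Lemma trunc_divn (x : R) (m : nat) : 0 <= x -> (0 < m)%N ->
  Num.trunc (x / m%:R) = (Num.trunc x %/ m)%N.
Proof.
move=> x0 m0; have mR : 0 < m%:R :> R by rewrite ltr0n.
have /andP[x1 x2] := trunc_bounds x0.
apply: trunc_eq; rewrite ler_pdivlMr// ltr_pdivrMr//; apply/andP; split.
  by apply: le_trans x1; rewrite -natrM ler_nat leq_trunc_div.
apply: lt_le_trans x2 _; rewrite !natr1 -natrM ler_nat.
exact: ltn_ceil.
Qed.

End truncation.

Section grid.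
Context {R : realType} {n : nat}.
Local Notation point := ('rV[R]_n * R)%type.
Local Notation mu := (@lebesgue_xt R n).
Variables (d : nat) (a : 'rV[R]_n) (s L H : R) (K r : nat -> nat).
Hypotheses (L_gt0 : 0 < L) (H_gt0 : 0 < H).
Hypotheses (K0 : K 0 = 1%N) (KS : forall i, K i.+1 = (K i * r i)%N).
Hypothesis r_gt0 : forall i, (0 < r i)%N.

Definition grid_l (i : nat) : R := L / (2 ^ (d * i))%:R.
(** [K i] counts the time slices of generation [i]. It is a product of varying factors [r i] because
    the number of time pieces in the lattice depends on the truncation parameter, which changes with
    the generation. *)
Definition grid_h (i : nat) : R := H / (K i)%:R.
Definition grid_j (i : nat) (z : point) (q : 'I_n) : nat :=
  Num.trunc ((z.1 ord0 q - a ord0 q) / grid_l i).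
Definition grid_k (i : nat) (z : point) : nat := Num.trunc ((z.2 - s) / grid_h i).
Definition grid_box (i : nat) (j : 'I_n -> nat) (k : nat) : set point :=
  box (\row_q (a ord0 q + (j q)%:R * grid_l i)) (s + k%:R * grid_h i)
    (grid_l i) (grid_h i).
(** Naming a cell by one of its points keeps indices out of the selection argument; [grid_cell_eq]
    says that the name does not depend on the point. *)
Definition grid_cell (i : nat) (z : point) : set point :=
  grid_box i (grid_j i z) (grid_k i z).

Lemma grid_K_gt0 i : (0 < K i)%N.
Proof. by elim: i => [|i IH]; rewrite ?K0// KS muln_gt0 IH r_gt0. Qed.

Lemma grid_l_gt0 i : 0 < grid_l i.
Proof. by rewrite divr_gt0// ltr0n expn_gt0. Qed.

Lemma grid_h_gt0 i : 0 < grid_h i.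
Proof. by rewrite divr_gt0// ltr0n grid_K_gt0. Qed.

Lemma grid_lS i : grid_l i = (2 ^ d)%:R * grid_l i.+1.
Proof.
rewrite /grid_l mulnS expnD natrM; field.
by rewrite !pnatr_eq0 -!lt0n !expn_gt0.
Qed.

Lemma grid_hS i : grid_h i = (r i)%:R * grid_h i.+1.
Proof.
rewrite /grid_h KS natrM; field.
by rewrite !pnatr_eq0 -!lt0n r_gt0 grid_K_gt0.
Qed.

Lemma grid_boxP i j k z : grid_box i j k z <->
  (forall q, (j q)%:R <= (z.1 ord0 q - a ord0 q) / grid_l i < (j q)%:R + 1) /\
  k%:R <= (z.2 - s) / grid_h i < k%:R + 1.
Proof.
have l0 := grid_l_gt0 i; have h0 := grid_h_gt0 i.
rewrite /grid_box /box; split.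
  move=> [zx]; rewrite /= in_itv/= => zt; split => [q|].
    have := zx q; rewrite mxE ler_pdivlMr// ltr_pdivrMr// mulrDl mul1r.
    by move=> /andP[? ?]; apply/andP; split; lra.
  rewrite ler_pdivlMr// ltr_pdivrMr// mulrDl mul1r.
  by move: zt => /andP[? ?]; apply/andP; split; lra.
move=> [zx zt]; split => [q|] /=; last rewrite in_itv/=.
  have := zx q; rewrite mxE ler_pdivlMr// ltr_pdivrMr// mulrDl mul1r.
  by move=> /andP[? ?]; apply/andP; split; lra.
move: zt; rewrite ler_pdivlMr// ltr_pdivrMr// mulrDl mul1r.
by move=> /andP[? ?]; apply/andP; split; lra.
Qed.

Lemma grid_box_index i j k z : grid_box i j k z ->
  (forall q, grid_j i z q = j q) /\ grid_k i z = k.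
Proof. by move=> /grid_boxP[zx zt]; split => [q|]; apply: trunc_eq; [exact: zx|]. Qed.

Lemma grid_boxE i j j' k : (forall q, j q = j' q) -> grid_box i j k = grid_box i j' k.
Proof. by move=> jj'; congr grid_box; exact/funext. Qed.

Lemma grid_box_cell i j k z : grid_box i j k z -> grid_box i j k = grid_cell i z.
Proof.
by move=> /grid_box_index[zj zk]; rewrite /grid_cell zk; apply: grid_boxE => q.
Qed.

Let coord_ge0 z q i : box a s L H z -> 0 <= (z.1 ord0 q - a ord0 q) / grid_l i.
Proof.
move=> [/(_ q)/andP[zx _] _].
by rewrite divr_ge0 ?(ltW (grid_l_gt0 i))// subr_ge0.
Qed.

Let time_ge0 z i : box a s L H z -> 0 <= (z.2 - s) / grid_h i.
Proof.
move=> [_]; rewrite /= in_itv/= => /andP[zt _].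
by rewrite divr_ge0 ?(ltW (grid_h_gt0 i))// subr_ge0.
Qed.

Lemma grid_cell_mem i z : box a s L H z -> grid_cell i z z.
Proof.
move=> Bz; apply/grid_boxP; split => [q|]; apply: trunc_bounds.
  exact: coord_ge0.
exact: time_ge0.
Qed.

Lemma grid_j_lt i z q : box a s L H z -> (grid_j i z q < 2 ^ (d * i))%N.
Proof.
move=> Bz; apply: trunc_lt; first exact: coord_ge0.
rewrite ltr_pdivrMr ?grid_l_gt0// /grid_l mulrCA mulfV ?mulr1.
  by case: Bz => /(_ q)/andP[_ ?] _; rewrite ltrBlDl.
by rewrite pnatr_eq0 -lt0n expn_gt0.
Qed.

Lemma grid_k_lt i z : box a s L H z -> (grid_k i z < K i)%N.
Proof.
move=> Bz; apply: trunc_lt; first exact: time_ge0.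
rewrite ltr_pdivrMr ?grid_h_gt0// /grid_h mulrCA mulfV ?mulr1.
  by case: Bz => _; rewrite /= in_itv/= => /andP[_ ?]; rewrite ltrBlDl.
by rewrite pnatr_eq0 -lt0n grid_K_gt0.
Qed.

Lemma grid_box_sub i j k : (forall q, (j q < 2 ^ (d * i))%N) -> (k < K i)%N ->
  grid_box i j k `<=` box a s L H.
Proof.
move=> jlt klt z [zx]; rewrite /= in_itv/= => /andP[zt1 zt2].
have l0 := grid_l_gt0 i; have h0 := grid_h_gt0 i.
have LE : L = (2 ^ (d * i))%:R * grid_l i.
  by rewrite /grid_l mulrCA mulfV ?mulr1// pnatr_eq0 -lt0n expn_gt0.
have HE : H = (K i)%:R * grid_h i.
  by rewrite /grid_h mulrCA mulfV ?mulr1// pnatr_eq0 -lt0n grid_K_gt0.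
split => [q|] /=; last rewrite in_itv/=.
  have := zx q; rewrite mxE => /andP[z1 z2].
  have : 0 <= (j q)%:R * grid_l i by rewrite mulr_ge0 ?(ltW l0).
  have : (j q).+1%:R * grid_l i <= L.
    by rewrite [leRHS]LE ler_wpM2r ?(ltW l0)// ler_nat; exact: jlt.
  by rewrite -natr1 mulrDl mul1r => ? ?; apply/andP; split; lra.
have : 0 <= k%:R * grid_h i by rewrite mulr_ge0 ?(ltW h0).
have : k.+1%:R * grid_h i <= H.
  by rewrite [leRHS]HE ler_wpM2r ?(ltW h0)// ler_nat.
by rewrite -natr1 mulrDl mul1r => ? ?; apply/andP; split; lra.
Qed.

Lemma grid_cell_sub i z : box a s L H z -> grid_cell i z `<=` box a s L H.
Proof.
by move=> Bz; apply: grid_box_sub => [q|]; [exact: grid_j_lt|exact: grid_k_lt].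
Qed.

Lemma grid_cell_eq i z w : grid_cell i z w -> grid_cell i w = grid_cell i z.
Proof. by move=> /grid_box_cell. Qed.

(** The index at generation [i] is the quotient of the index at generation i + 1 ([trunc_divn]), so
    points with equal fine indices have equal coarse indices. *)
Lemma grid_cellS i z : box a s L H z -> grid_cell i.+1 z `<=` grid_cell i z.
Proof.
move=> Bz w zw.
have Bw : box a s L H w by exact: grid_cell_sub zw.
have [wj wk] := grid_box_index zw.
have jS v q : box a s L H v -> grid_j i v q = (grid_j i.+1 v q %/ 2 ^ d)%N.
  move=> Bv; rewrite /grid_j grid_lS -trunc_divn ?expn_gt0//; last exact: coord_ge0.
  by congr Num.trunc; rewrite invfM mulrA [in LHS]mulrAC.
have kS v : box a s L H v -> grid_k i v = (grid_k i.+1 v %/ r i)%N.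
  move=> Bv; rewrite /grid_k grid_hS -trunc_divn//; last exact: time_ge0.
  by congr Num.trunc; rewrite invfM mulrA [in LHS]mulrAC.
have -> : grid_cell i z = grid_cell i w.
  rewrite /grid_cell kS// kS// wk; apply: grid_boxE => q.
  by rewrite jS// jS// wj.
exact: grid_cell_mem.
Qed.

Lemma grid_cell_le i j z : (i <= j)%N -> box a s L H z -> grid_cell j z `<=` grid_cell i z.
Proof.
move=> ij Bz; rewrite -(subnK ij); elim: (j - i)%N => [//|k IH].
by rewrite addSn; apply: subset_trans IH; exact: grid_cellS.
Qed.

Lemma mu_grid_cell i z : mu (grid_cell i z) = (grid_l i ^+ n * grid_h i)%:E.
Proof. by rewrite /grid_cell /grid_box mu_box ?(ltW (grid_l_gt0 i)) ?(ltW (grid_h_gt0 i)). Qed.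

Definition grid_index i : finType := ({ffun 'I_n -> 'I_(2 ^ (d * i))} * 'I_(K i))%type.

Definition index_box i (u : grid_index i) : set point :=
  grid_box i (fun q => nat_of_ord (u.1 q)) u.2.

Lemma index_box_disjoint i (u v : grid_index i) : u != v -> index_box u `&` index_box v = set0.
Proof.
move=> uv; rewrite -subset0 => z [/grid_box_index[uj uk] /grid_box_index[vj vk]].
move/eqP: uv; apply; case: u v uj uk vj vk => [uj uk] [vj vk] /= uj' uk' vj' vk'.
congr pair; last by apply: val_inj; rewrite /= -uk' vk'.
by apply/ffunP => q; apply: val_inj; rewrite /= -uj' vj'.
Qed.

Lemma grid_cell_index i z : box a s L H z -> exists u : grid_index i, index_box u = grid_cell i z.
Proof.
move=> Bz.
exists ([ffun q => Ordinal (grid_j_lt i q Bz)], Ordinal (grid_k_lt i Bz)).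
by apply: grid_boxE => q; rewrite ffunE.
Qed.

Lemma measurable_index_box i (u : grid_index i) :
  measurable (index_box u : set ('rV[R]_n * measurableTypeR R)).
Proof. exact: measurable_box. Qed.

Lemma mu_index_box i (u : grid_index i) : mu (index_box u) = (grid_l i ^+ n * grid_h i)%:E.
Proof. by rewrite /index_box /grid_box mu_box ?(ltW (grid_l_gt0 i)) ?(ltW (grid_h_gt0 i)). Qed.

Lemma union_of_cells i (S : set point) : S `<=` box a s L H ->
  (forall z, S z -> grid_cell i z `<=` S) ->
  S = \big[setU/set0]_(u <- [seq u <- enum (grid_index i) | `[< index_box u `<=` S >]]) index_box u.
Proof.
move=> SB Scell; rewrite -bigcup_seq; apply/seteqP; split => [z Sz|z [u /=]]; last first.
  by rewrite mem_filter => /andP[/asboolP uS _]; exact: uS.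
have [u uz] := grid_cell_index i (SB _ Sz).
exists u; last by rewrite uz; apply: grid_cell_mem; exact: SB.
by rewrite /= mem_filter mem_enum andbT; apply/asboolP; rewrite uz; exact: Scell.
Qed.

(** There are finitely many cells per generation. This makes the selected sets measurable although
    they are defined by quantifying over points and cells. *)
Lemma measurable_union_of_cells i (S : set point) : S `<=` box a s L H ->
  (forall z, S z -> grid_cell i z `<=` S) ->
  measurable (S : set ('rV[R]_n * measurableTypeR R)).
Proof.
move=> SB Scell; rewrite (union_of_cells SB Scell).
by apply: bigsetU_measurable => u _; exact: measurable_index_box.
Qed.

Lemma union_of_cells_ratio i (S X : set point) (tau : R) : 0 <= tau ->
  measurable (X : set ('rV[R]_n * measurableTypeR R)) ->
  S `<=` box a s L H -> (forall z, S z -> grid_cell i z `<=` S) ->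
  (forall z, S z -> (mu (X `&` grid_cell i z) <= tau%:E * mu (grid_cell i z))%E) ->
  (mu (X `&` S) <= tau%:E * mu S)%E.
Proof.
move=> tau0 mX SB Scell SX; rewrite (union_of_cells SB Scell).
apply: measure_setI_bigsetU_le => //.
- by rewrite filter_uniq// enum_uniq.
- by move=> u; exact: measurable_index_box.
- by move=> u v _ _; exact: index_box_disjoint.
- move=> u; rewrite mem_filter => /andP[/asboolP uS _].
  have [z uz] : exists z, index_box u z.
    exists (\row_q (a ord0 q + (u.1 q)%:R * grid_l i), s + u.2%:R * grid_h i).
    have l0 := grid_l_gt0 i; have h0 := grid_h_gt0 i.
    split => [q|]; rewrite /= ?in_itv/= lexx/=.
      by rewrite ltrDl.
    by rewrite ltrDl.
  have -> : index_box u = grid_cell i z by exact: grid_box_cell.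
  exact/SX/uS.
Qed.

End grid.

(** * Geometric decay of sublevel sets *)

Section contraction.
Context {R : realType} {n : nat}.
Local Notation point := ('rV[R]_n * R)%type.
Local Notation mu := (@lebesgue_xt R n).
Variables (p theta c e e' M sigma A : R) (D : point -> R).
Variables (d : nat) (a : 'rV[R]_n) (s L H : R) (K r : nat -> nat).
Hypotheses (L_gt0 : 0 < L) (H_gt0 : 0 < H).
Hypotheses (K0 : K 0 = 1%N) (KS : forall i, K i.+1 = (K i * r i)%N).
Hypotheses (r_ge2 : forall i, (2 <= r i)%N) (r_le : forall i, (r i)%:R <= A).
Hypothesis d_gt0 : (0 < d)%N.

Local Notation gl := (grid_l d L).
Local Notation gh := (grid_h H K).
Local Notation gj := (grid_j d a L).
Local Notation gk := (grid_k s H K).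
Local Notation cell := (grid_cell d a s L H K).
Local Notation B0 := (box a s L H).

Hypothesis h_bounds : forall i, 2^-1 * gl i `^ p <= gh i <= gl i `^ p.

Hypotheses (hp : 1 < p) (htheta : 1 < theta) (hc : 0 < c < 1) (he : 0 < e <= 1)
  (he' : 0 < e' <= 1) (hsigma : 0 < sigma <= 4^-1).
Hypotheses (D_ge0 : forall z, 0 <= D z)
  (mD : forall t, measurable (sublevel D t : set ('rV[R]_n * measurableTypeR R)))
  (D_lip : forall z w, D z <= D w + distp p z w).
Hypotheses (dD : density_property p 2^-1 1 theta c e D) (chainD : chain_property p M sigma e' D).

(* The choice of [m] makes [W / m = 1 + c / 2], so that the covering loss [W / m] does
   not cancel the gain [1 - c]. *)
Let m : R := 2 * (2 + theta) / c.
Let W : R := 2 + theta + m.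
Hypotheses (M_N : (2 ^ d)%:R <= M) (M_W : (W + 1) * A <= M).

(** [e'] pays for the chain from a future point to the translate of a cell, [e] for the density
    estimate applied there. *)
Let lam : R := e * e'.

Variable y0 : point.
Hypotheses
  (y0x : forall q, a ord0 q - M * L <= y0.1 ord0 q <= a ord0 q + M * L)
  (y0t : s + (theta + 4) * L `^ p <= y0.2 <= s + M * L `^ p).

Let r_gt0 i : (0 < r i)%N. Proof. by apply: leq_trans (r_ge2 i). Qed.
Let gl_gt0 i : 0 < gl i. Proof. exact: grid_l_gt0. Qed.
Let gh_gt0 i : 0 < gh i. Proof. exact: grid_h_gt0. Qed.
Let m_gt0 : 0 < m.
Proof.
by have := htheta; case/andP: hc => c0 _ th; rewrite /m divr_gt0// mulr_gt0//; lra.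
Qed.
Let A_ge2 : 2 <= A.
Proof. by apply: le_trans (r_le 0); rewrite ler_nat. Qed.
Let W_gt4 : 3 < W. Proof. by have := (m_gt0, htheta) => -[]; rewrite /W; lra. Qed.
Let M_ge8 : 8 <= M.
Proof.
have := (W_gt4, A_ge2) => -[W4 A2]; apply: le_trans M_W.
by rewrite (_ : 8 = 4 * 2); [apply: ler_pM; lra|ring].
Qed.
Let lam_gt0 : 0 < lam. Proof. by case/andP: he he' => ? _ /andP[? _]; rewrite mulr_gt0. Qed.
Let lam_le : lam <= e'.
Proof. by case/andP: he he' => ? e1 /andP[? _]; rewrite ler_piMl// ltW. Qed.
Let lam_le1 : lam <= 1.
Proof. by apply: le_trans lam_le _; case/andP: he'. Qed.

Let ghS i : gh i = (r i)%:R * gh i.+1. Proof. exact: grid_hS. Qed.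
Let glS i : gl i = (2 ^ d)%:R * gl i.+1. Proof. exact: grid_lS. Qed.

Let ghS_half i : 2 * gh i.+1 <= gh i.
Proof. by rewrite [leRHS]ghS ler_wpM2r ?(ltW (gh_gt0 _))// ler_nat. Qed.

Let gh_leA i : gh i <= A * gh i.+1.
Proof. by rewrite [leLHS]ghS ler_wpM2r ?(ltW (gh_gt0 _)). Qed.

Let gh_pow i : gh i <= H * 2^-1 ^+ i.
Proof.
elim: i => [|i IH]; first by rewrite expr0 mulr1 /grid_h K0 divr1.
have := ghS_half i; rewrite exprS; lra.
Qed.

Let gh_le i j : (i <= j)%N -> gh j <= gh i.
Proof.
move=> ij; rewrite -(subnK ij); elim: (j - i)%N => [//|k IH].
by apply: le_trans IH; rewrite addSn; have := ghS_half (k + i); have := gh_gt0 (k + i).+1; lra.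
Qed.

Let gl_pow i : gl i <= L * 2^-1 ^+ i.
Proof.
rewrite /grid_l ler_wpM2l ?(ltW L_gt0)// exprVn lef_pV2 ?posrE ?exprn_gt0// ?ltr0n ?expn_gt0//.
by rewrite -natrX ler_nat leq_pexp2l// leq_pmull.
Qed.

(* The lower corner of the cell of generation [i] that contains [z]. *)
Let cx i (z : point) : 'rV[R]_n := \row_q (a ord0 q + (gj i z q)%:R * gl i).
Let ct i (z : point) : R := s + (gk i z)%:R * gh i.

Let cellE i (z : point) : cell i z = box (cx i z) (ct i z) (gl i) (gh i). Proof. by []. Qed.

Let cell_mem i z : B0 z -> cell i z z.
Proof. exact: (grid_cell_mem d L_gt0 H_gt0 K0 KS r_gt0). Qed.

Let cell_coord i (z w : point) : cell i z w ->
  (forall q, cx i z ord0 q <= w.1 ord0 q < cx i z ord0 q + gl i) /\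
  ct i z <= w.2 < ct i z + gh i.
Proof. by rewrite cellE => -[? /=]; rewrite in_itv/=. Qed.

Let cellS i z : B0 z -> cell i.+1 z `<=` cell i z.
Proof. exact: (grid_cellS L_gt0 H_gt0 K0 KS r_gt0). Qed.

Let corner_cellS i (z : point) : B0 z ->
  (forall q, cx i z ord0 q <= cx i.+1 z ord0 q < cx i z ord0 q + gl i) /\
  ct i z <= ct i.+1 z /\ ct i.+1 z + gh i.+1 <= ct i z + gh i.
Proof.
move=> Bz.
have gl1 := gl_gt0 i.+1; have gh1 := gh_gt0 i.+1.
have corner : cell i.+1 z (cx i.+1 z, ct i.+1 z).
  by split => [q|]; rewrite /= ?in_itv/= lexx ltrDl.
have [cx1 /andP[ct1 _]] := cell_coord (cellS Bz corner).
split; first exact: cx1.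
split; first exact: ct1.
rewrite leNgt; apply/negP => lt1.
(* If the child stuck out at the top, the point above its lower corner at time [t] would lie in the
   child but not in the parent. *)
pose t := Num.max (ct i.+1 z) (ct i z + gh i).
have cti : ct i z + gh i <= t by rewrite le_max lexx orbT.
have tlt : t < ct i.+1 z + gh i.+1 by rewrite gt_max lt1 ltrDl gh1.
have : cell i.+1 z (cx i.+1 z, t).
  by split => [q|]; rewrite /= ?in_itv/= ?lexx ?ltrDl// tlt le_max lexx.
by move/(cellS Bz)/cell_coord => [_ /andP[_]]; rewrite ltNge cti.
Qed.

Let lp_gt0 i : 0 < gl i `^ p. Proof. by rewrite powR_gt0. Qed.

Let bad (X : set point) (i : nat) (z : point) : Prop :=
  (((1 - c) * (gl i ^+ n * gh i))%:E < mu (X `&` cell i z))%E.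

(** The contrapositive of the density estimate. If lam * D y were at least [eta], a chain would lead
    from [y] to a point of the forward translate of the cell with value at least e' * D y, and then
    [X] could fill at most 1 - c of the cell. *)
Let bad_future (X : set point) (eta : R) i (z y : point) :
  measurable (X : set ('rV[R]_n * measurableTypeR R)) ->
  X `<=` sublevel D eta -> bad X i z ->
  (forall q, cx i z ord0 q - M * gl i <= y.1 ord0 q <= cx i z ord0 q + M * gl i) ->
  ct i z + (theta + 1) * gh i + sigma * gl i `^ p <= y.2 <= ct i z + M * gl i `^ p ->
  lam * D y < eta.
Proof.
move=> mX Xeta bX yx /andP[yt1 yt2].
have [gl0 gh0 lp0] := And3 (gl_gt0 i) (gh_gt0 i) (lp_gt0 i).
have th := htheta; have /andP[s0 s4] := hsigma.
have /andP[hb1 hb2] := h_bounds i.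
have tgh0 : 0 < theta * gh i by rewrite mulr_gt0//; lra.
have slp : sigma * gl i `^ p <= 4^-1 * gl i `^ p by rewrite ler_wpM2r// ltW.
(* The target is the middle half of the translate, since [density_property] needs strict
   inequalities in time. Its height gh / 2 >= gl^p / 4 is where [sigma <= 4^-1] enters. *)
have [|||w [[wx wt] wD]] := chainD (b := cx i z)
  (S := ct i z + theta * gh i + gh i / 4) (H := gh i / 2) (y := y) gl0.
- lra.
- exact: yx.
- by apply/andP; split; lra.
rewrite /= in_itv/= in wt; case/andP: wt => wt1 wt2.
rewrite ltNge; apply/negP => etaD.
move: bX; rewrite /bad ltNge => /negP; apply.
apply: le_trans (dD (a := cx i z) (s := ct i z) (l := gl i) (h := gh i) (y := w) gl0 _ wx _).
- apply: le_measure; rewrite ?inE.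
  + by apply: measurableI => //; exact: measurable_box.
  + by apply: measurableI; [exact: measurable_box|exact: mD].
  + move=> v [Xv cv]; split => //; rewrite /sublevel /=.
    apply: lt_le_trans (Xeta _ Xv) _; apply: le_trans etaD _.
    by rewrite /lam -mulrA ler_wpM2l//; case/andP: he => /ltW.
- by rewrite mul1r; apply/andP.
- by apply/andP; split; lra.
Qed.

(** Descends through the ancestors of [z]: every generation costs one chain, hence one factor e'.
    The lag theta + 4 of [y0] leaves room for the first target, which ends (theta + 3) * gh 0 after
    time s. *)
Let chain_ancestors i (z : point) : B0 z -> exists w : point,
  box (cx i z) (ct i z + (theta + 2) * gh i) (gl i) (gh i) w /\ e' ^+ i.+1 * D y0 <= D w.
Proof.
move=> Bz; have th := htheta; have /andP[s0 s4] := hsigma; have M8 := M_ge8.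
have /andP[e0 e1] := he'.
elim: i => [|i [v [[vx vt] vD]]].
  have [gl0 gh0 lp0] := And3 (gl_gt0 0) (gh_gt0 0) (lp_gt0 0).
  have /andP[hb1 hb2] := h_bounds 0.
  have slp : sigma * gl 0 `^ p <= 4^-1 * gl 0 `^ p by rewrite ler_wpM2r// ltW.
  have [cx0 ct0] : cx 0 z = a /\ ct 0 z = s.
    have j0 q : gj 0 z q = 0%N.
      by have := grid_j_lt d L_gt0 0 q Bz; rewrite muln0 expn0; case: (gj 0 z q).
    have k0 : gk 0 z = 0%N.
      by have := grid_k_lt H_gt0 K0 KS r_gt0 0 Bz; rewrite K0; case: (gk 0 z).
    split; last by rewrite /ct k0 mul0r addr0.
    by apply/rowP => q; rewrite /cx mxE j0 mul0r addr0.
  have gl0E : gl 0 = L by rewrite /grid_l muln0 expn0 divr1.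
  have thgh : (theta + 2) * gh 0 <= (theta + 2) * gl 0 `^ p by rewrite ler_wpM2l//; lra.
  have thgh0 : 0 < (theta + 2) * gh 0 by rewrite mulr_gt0//; lra.
  rewrite cx0 ct0 expr1 in thgh thgh0 *.
  have /andP[y1 y2] := y0t.
  apply: chainD => //; rewrite ?gl0E//; rewrite gl0E in lp0 hb1 hb2 slp thgh *.
    lra.
  by apply/andP; split; lra.
have [gl0 gh0 lp0] := And3 (gl_gt0 i.+1) (gh_gt0 i.+1) (lp_gt0 i.+1).
have /andP[hb1 hb2] := h_bounds i.+1.
have slp : sigma * gl i.+1 `^ p <= 4^-1 * gl i.+1 `^ p by rewrite ler_wpM2r// ltW.
have [cS [ctS1 ctS2]] := corner_cellS i Bz.
rewrite /= in_itv/= in vt; have /andP[vt1 vt2] := vt.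
have half := ghS_half i.
(* As the height at least halves, the target above the child ends before the box above the parent
   begins, with time to spare for a chain. *)
have th1 : (theta + 1) * (2 * gh i.+1) <= (theta + 1) * gh i by rewrite ler_wpM2l//; lra.
have th3 : (theta + 3) * gh i <= M * gl i.+1 `^ p.
  apply: (@le_trans _ _ ((theta + 3) * (A * gl i.+1 `^ p))).
    rewrite ler_wpM2l//; first lra.
    apply: le_trans (gh_leA i) _; rewrite ler_wpM2l//; by have := A_ge2; lra.
  rewrite mulrA ler_wpM2r ?(ltW lp0)//; apply: le_trans M_W.
  by rewrite ler_wpM2r ?/W; have [A2 mpos] := (A_ge2, m_gt0); lra.
have thgh0 : 0 < theta * gh i.+1 by rewrite mulr_gt0//; lra.
have thgh1 : gh i.+1 < theta * gh i.+1 by rewrite ltr_pMl.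
have MN : gl i <= M * gl i.+1 by rewrite [leLHS]glS ler_wpM2r ?(ltW gl0).
have [|||w [wB wD]] := chainD (b := cx i.+1 z) (S := ct i.+1 z + (theta + 2) * gh i.+1)
  (H := gh i.+1) (y := v) gl0.
- lra.
- move=> q; have /andP[c1 c2] := cS q; have /andP[v1 v2] := vx q.
  by apply/andP; split; lra.
- by apply/andP; split; lra.
exists w; split => //; apply: le_trans wD.
by rewrite exprS -mulrA ler_wpM2l// ltW.
Qed.

(** A cell of generation i < k has a point [w] in its future with D w >= e'^(i + 1) * D y0 >= lam^k
    * D y0, which [bad_future] forbids. So bad cells have height at most H / 2^k. *)
Let bad_generation (X : set point) (k i : nat) (z : point) :
  measurable (X : set ('rV[R]_n * measurableTypeR R)) ->
  X `<=` sublevel D (lam ^+ k.+1 * D y0) -> B0 z -> bad X i z -> (k <= i)%N.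
Proof.
move=> mX Xk Bz bX; rewrite leqNgt; apply/negP => ik.
have [w [[wx wt] wD]] := chain_ancestors i Bz.
have [gl0 gh0 lp0] := And3 (gl_gt0 i) (gh_gt0 i) (lp_gt0 i).
have /andP[hb1 hb2] := h_bounds i.
have th := htheta; have /andP[s0 s4] := hsigma; have M8 := M_ge8.
have slp : sigma * gl i `^ p <= 4^-1 * gl i `^ p by rewrite ler_wpM2r// ltW.
have glM : gl i <= M * gl i by rewrite ler_peMl ?(ltW gl0)//; lra.
have th3 : (theta + 3) * gh i <= M * gl i `^ p.
  apply: ler_pM; rewrite ?(ltW gh0)//; first lra.
  apply: le_trans M_W; have := (A_ge2, m_gt0) => -[A2 m0].
  apply: (@le_trans _ _ (W + 1)); first by rewrite /W; lra.
  by rewrite ler_peMr ?/W; lra.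
rewrite /= in_itv/= in wt; have /andP[wt1 wt2] := wt.
have : lam * D w < lam ^+ k.+1 * D y0.
  apply: (bad_future mX Xk bX).
    by move=> q; have /andP[w1 w2] := wx q; apply/andP; split; lra.
  by apply/andP; split; lra.
apply/negP; rewrite -leNgt exprS -mulrA ler_wpM2l ?(ltW lam_gt0)//.
apply: le_trans wD; rewrite ler_wpM2r//.
apply: (@le_trans _ _ (lam ^+ i.+1)); last by rewrite lerXn2r// nnegrE ltW//; case/andP: he'.
by apply: ler_wiXn2l => //; rewrite ltW.
Qed.

(* The futures used to pass from layer [k.+1] to layer [k] overshoot in time by at
   most [2 * W * H / 2 ^ k], because by [bad_generation] the cells involved are small;
   hence the summable excess over [H / 2]. *)
Let tau (k : nat) : R := H / 2 + 4 * W * H * 2^-1 ^+ k.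

Let layer (k : nat) : set point := box a s L (tau k) `&` sublevel D (lam ^+ k * D y0).

Let measurable_layer k : measurable (layer k : set ('rV[R]_n * measurableTypeR R)).
Proof. by apply: measurableI; [exact: measurable_box|exact: mD]. Qed.

(** * One step of the decay, from layer k to layer k + 1 *)

Section one_step.
Variable k : nat.
Hypotheses (k_gt0 : (0 < k)%N) (tau_le : tau k <= H).

Let X := layer k.+1.
Let mX : measurable (X : set ('rV[R]_n * measurableTypeR R)) := measurable_layer k.+1.
Let X_sub : X `<=` sublevel D (lam ^+ k.+1 * D y0).
Proof. by move=> z []. Qed.

Let half_gt0 i : 0 < 2^-1 ^+ i :> R. Proof. by rewrite exprn_gt0// invr_gt0. Qed.

Let WH_gt0 : 0 < W * H.
Proof. by have := W_gt4 => W4; rewrite mulr_gt0//; lra. Qed.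

Let tauS : tau k.+1 + 2 * W * H * 2^-1 ^+ k = tau k.
Proof. by rewrite /tau exprS; field. Qed.

Let box_tau (i : nat) : tau i <= H -> box a s L (tau i) `<=` B0.
Proof.
move=> ti z [zx]; rewrite /= in_itv/= => /andP[zt1 zt2]; split => //=.
by rewrite in_itv/= zt1 (lt_le_trans zt2)// lerD2l.
Qed.

Let tauS_le : tau k.+1 <= H.
Proof.
apply: le_trans tau_le; rewrite -tauS lerDl.
by rewrite -(mulrA 2 W H) mulr_ge0 ?(ltW (half_gt0 k))// mulr_ge0// ltW.
Qed.

Let has_bad_child (i : nat) (z : point) : Prop := exists z', cell i z z' /\ bad X i.+1 z'.

(* Calderon-Zygmund selection. A selected cell is the first one on its branch that has
   a bad child: it is not bad itself, while the bad child forces [D] to be small on a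
   future of the selected cell, through [bad_future]. *)
Let selected (i : nat) : set point :=
  [set z | [/\ B0 z, has_bad_child i z & forall j, (j < i)%N -> ~ has_bad_child j z]].

Let cell_eq i z w : cell i z w -> cell i w = cell i z.
Proof. exact: (grid_cell_eq L_gt0 H_gt0 K0 KS r_gt0). Qed.

Let cell_sub i z : B0 z -> cell i z `<=` B0.
Proof. exact: (grid_cell_sub L_gt0 H_gt0 K0 KS r_gt0). Qed.

Let cell_le i j z : (i <= j)%N -> B0 z -> cell j z `<=` cell i z.
Proof. exact: (grid_cell_le L_gt0 H_gt0 K0 KS r_gt0). Qed.

Let mu_cell i z : mu (cell i z) = (gl i ^+ n * gh i)%:E.
Proof. exact: (mu_grid_cell _ _ _ L_gt0 H_gt0 K0 KS r_gt0). Qed.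

Let selected_cell i z : selected i z -> cell i z `<=` selected i.
Proof.
move=> [Bz hz nz] w zw; have Bw : B0 w by exact: cell_sub zw.
have hE j : (j <= i)%N -> has_bad_child j w = has_bad_child j z.
  by move=> ji; rewrite /has_bad_child (@cell_eq j z w)//; exact: cell_le zw.
split => //; first by rewrite hE.
by move=> j ji; rewrite hE ?(ltnW ji)//; exact: nz.
Qed.

Let not_bad i z : selected i z -> (mu (X `&` cell i z) <= (1 - c)%:E * mu (cell i z))%E.
Proof.
move=> [Bz _ nz]; rewrite mu_cell -EFinM leNgt; apply/negP => bz.
have ki : (k <= i)%N by exact: (bad_generation mX X_sub Bz bz).
(* A bad cell has generation at least k > 0, hence a parent, and that parent would have a bad child
   at an earlier generation. *)
case: i ki bz nz => [|i] ki bz nz; first by move: ki; rewrite leqNgt k_gt0.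
apply: (nz i) => //; exists z; split => //; exact: cell_mem.
Qed.

Let selected_sub i : selected i `<=` B0. Proof. by move=> z []. Qed.

Let selected_lt (N : nat) : set point := [set z | exists2 i, (i < N)%N & selected i z].

Let selected_lt_sub N : selected_lt N `<=` B0.
Proof. by move=> z [i _ /selected_sub]. Qed.

Let selected_lt_cell N z : selected_lt N z -> cell N z `<=` selected_lt N.
Proof.
move=> [i iN zi] w zw; exists i => //; apply: (selected_cell zi).
by apply: (cell_le (ltnW iN) (selected_sub zi)).
Qed.

Let measurable_selected i : measurable (selected i : set ('rV[R]_n * measurableTypeR R)).
Proof.
exact: (measurable_union_of_cells L_gt0 H_gt0 K0 KS r_gt0 (@selected_sub i) (@selected_cell i)).
Qed.

Let measurable_selected_lt N : measurable (selected_lt N : set ('rV[R]_n * measurableTypeR R)).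
Proof.
exact: (measurable_union_of_cells L_gt0 H_gt0 K0 KS r_gt0 (@selected_lt_sub N) (@selected_lt_cell N)).
Qed.

Let mu_selected_lt N : (mu (X `&` selected_lt N) <= (1 - c)%:E * mu (selected_lt N))%E.
Proof.
have c1 : 0 <= 1 - c by case/andP: hc => _ /ltW; rewrite subr_ge0.
elim: N => [|N IH].
  rewrite (_ : selected_lt 0 = set0) ?setI0 ?measure0 ?mule0//.
  by rewrite -subset0 => z [].
have SE : selected_lt N.+1 = selected_lt N `|` selected N.
  apply/seteqP; split => [z [i]|z [[i iN zi]|zN]].
  - by rewrite ltnS leq_eqVlt => /predU1P[-> ?|iN zi]; [right|left; exists i].
  - by exists i => //; exact: ltnW.
  - by exists N.
rewrite SE setIUr.
apply: (@le_trans _ _ (mu (X `&` selected_lt N) + mu (X `&` selected N))%E).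
  by apply: measureU2; exact: measurableI.
rewrite measureU//; last first.
  by rewrite -subset0 => z [[i iN [_ hz _]] [_ _ /(_ _ iN)]].
rewrite ge0_muleDr ?measure_ge0//; apply: leeD; first exact: IH.
apply: (union_of_cells_ratio L_gt0 H_gt0 K0 KS r_gt0 c1 mX (@selected_sub N) (@selected_cell N)).
exact: not_bad.
Qed.

Let bad_meets i z : bad X i z -> exists w, X w /\ cell i z w.
Proof.
move=> bz; apply: contrapT => nw; move: bz; rewrite /bad.
rewrite (_ : X `&` cell i z = set0).
  rewrite measure0 lte_fin ltNge => /negP; apply.
  apply: mulr_ge0; first by rewrite subr_ge0; case/andP: hc => _ /ltW.
  by rewrite mulr_ge0 ?exprn_ge0// ltW.
by rewrite -subset0 => w [Xw zw]; apply: nw; exists w.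
Qed.

(** The bad child gives the level lam^k through [bad_future]; the start at (theta + 2) * gh i is
    late enough because the child has at most half the height. The child also meets [X], hence a
    time before s + tau k.+1, and the overshoot W * gh i is at most 2 * W * H / 2^k, so the future
    ends before s + tau k. *)
Let selected_future i z (y : point) : selected i z ->
  (forall q, cx i z ord0 q <= y.1 ord0 q < cx i z ord0 q + gl i) ->
  ct i z + (theta + 2) * gh i <= y.2 < ct i z + W * gh i ->
  layer k y.
Proof.
move=> zi yx /andP[yt1 yt2]; have [Bz [z' [zz' bz']] _] := zi.
have Bz' : B0 z' by exact: cell_sub zz'.
have cE : cell i z' = cell i z by exact: cell_eq.
have [gl0 gh0 lp0] := And3 (gl_gt0 i.+1) (gh_gt0 i.+1) (lp_gt0 i.+1).
have gli := gl_gt0 i; have ghi := gh_gt0 i.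
have [w [Xw zw]] := bad_meets bz'.
have [wx /andP[wt1 wt2]] := cell_coord (cellS Bz' zw).
have corner v : cell i z v -> gj i v =1 gj i z /\ gk i v = gk i z.
  by move=> /(grid_box_index L_gt0 H_gt0 K0 KS r_gt0).
have [cxE ctE] : cx i z' = cx i z /\ ct i z' = ct i z.
  have [jE kE] := corner _ zz'.
  by split; [apply/rowP => q; rewrite !mxE jE|rewrite /ct kE].
rewrite ctE in wt1 wt2.
have ki : (k <= i.+1)%N by exact: (bad_generation mX X_sub Bz' bz').
have ghk : gh i <= 2 * H * 2^-1 ^+ k.
  apply: (@le_trans _ _ (2 * (H * 2^-1 ^+ i.+1))).
    by apply: le_trans (gh_pow i) _; rewrite exprS; lra.
  rewrite -mulrA ler_wpM2l// ler_wpM2l ?(ltW H_gt0)//.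
  by apply: ler_wiXn2l => //; lra.
have th := htheta; have W4 := W_gt4; have /andP[s0 s4] := hsigma.
have /andP[hb1 hb2] := h_bounds i.+1.
have [cS [ctS1 ctS2]] := corner_cellS i Bz'; rewrite cxE ctE in cS ctS1 ctS2.
have thgh : 0 < theta * gh i by rewrite mulr_gt0//; lra.
split.
  have [Yx _] : B0 (y.1, z.2).
    apply: (cell_sub Bz (i := i)); split => [q|]; first exact: yx.
    by have [] := cell_mem i Bz.
  split; first exact: Yx.
  have ct_ge : s <= ct i z by rewrite lerDl mulr_ge0// ltW.
  rewrite /= in_itv/=; apply/andP; split; first lra.
  have wtau : w.2 < s + tau k.+1 by case: Xw => -[_]; rewrite /= in_itv/= => /andP[].
  have : W * gh i <= 2 * W * H * 2^-1 ^+ k.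
    rewrite [leRHS](_ : _ = W * (2 * H * 2^-1 ^+ k)); last ring.
    by rewrite ler_wpM2l//; lra.
  by have := tauS; lra.
rewrite /sublevel /= -(ltr_pM2l lam_gt0) mulrA -exprS.
have slp : sigma * gl i.+1 `^ p <= 4^-1 * gl i.+1 `^ p by rewrite ler_wpM2r// ltW.
apply: (bad_future mX X_sub bz').
  have MN : gl i <= M * gl i.+1 by rewrite [leLHS]glS ler_wpM2r ?(ltW gl0).
  move=> q; have /andP[y1 y2] := yx q; have /andP[c1 c2] := cS q.
  by apply/andP; split; lra.
have half := ghS_half i.
have thgh1 : theta * (2 * gh i.+1) <= theta * gh i by rewrite ler_wpM2l//; lra.
have thgh0 : 0 < theta * gh i.+1 by rewrite mulr_gt0//; lra.
have WM : W * gh i <= M * gl i.+1 `^ p.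
  apply: (@le_trans _ _ (W * (A * gl i.+1 `^ p))).
    rewrite ler_wpM2l//; first lra.
    apply: le_trans (gh_leA i) _; rewrite ler_wpM2l//; by have := A_ge2; lra.
  rewrite mulrA ler_wpM2r ?(ltW lp0)//; apply: le_trans M_W.
  by rewrite ler_wpM2r//; have A2 := A_ge2; lra.
by apply/andP; split; lra.
Qed.

(** On a vertical line, the interval from a selected time to the end of its future has length at
    most W * gh, and its last part, of length m * gh, lies in layer [k]. Futures of different cells
    may overlap; the greedy covering turns the local ratio m / W into a global one. *)
Let mu_selected_lt_layer N : ((m / W)%:E * mu (selected_lt N) <= mu (layer k))%E.
Proof.
have m0 := m_gt0; have W4 := W_gt4; have th := htheta.
have rho0 : 0 < m / W by rewrite divr_gt0//; lra.
apply: slicewise_measure_le; [exact: measurable_selected_lt|exact: measurable_layer|exact: ltW|].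
move=> x; have ghN := gh_gt0 N.
apply: (@greedy_covering _ _ _ s (s + H) (m * gh N)) => //.
- by apply: measurable_xsection; exact: measurable_selected_lt.
- by apply: measurable_xsection; exact: measurable_layer.
- by rewrite mulr_gt0.
- by move=> t; rewrite /xsection /= inE => /selected_lt_sub[_]; rewrite /= in_itv.
- move=> T [t0 Wt0 Tt0].
  (* A leftmost selected time after [T] exists because cells contain their lower faces: it is [T] or
     the lower end of the first time slice that contains such a time. *)
  pose P q := `[< exists t, [/\ xsection (selected_lt N) x t, T <= t & gk N (x, t) = q] >].
  have exP : exists q, P q by exists (gk N (x, t0)); apply/asboolP; exists t0.
  case: (ex_minnP exP) => q /asboolP[t [Wt Tt tq]] qmin.
  have St : selected_lt N (x, t) by move: Wt; rewrite /xsection /= inE.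
  have Bt := selected_lt_sub St.
  have [tx tt] := cell_coord (cell_mem N Bt).
  have {}tq : ct N (x, t) = s + q%:R * gh N by rewrite /ct tq.
  rewrite tq /= in tt; have /andP[tt1 tt2] := tt.
  exists (Num.max T (s + q%:R * gh N)); split.
  + rewrite /xsection /= inE; apply: (selected_lt_cell St); split; first exact: tx.
    rewrite /= in_itv/= -/(ct N (x, t)) tq le_max lexx orbT/= gt_max; apply/andP; split; first lra.
    by rewrite ltrDl.
  + by rewrite le_max lexx.
  + move=> t' Wt' Tt'; rewrite ge_max Tt'/=.
    have St' : selected_lt N (x, t') by move: Wt'; rewrite /xsection /= inE.
    have [_ /andP[/= t'1 _]] := cell_coord (cell_mem N (selected_lt_sub St')).
    apply: le_trans t'1; rewrite /ct lerD2l ler_wpM2r ?(ltW ghN)// ler_nat.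
    by apply: qmin; apply/asboolP; exists t'.
- move=> t; rewrite {1}/xsection /= inE => -[i iN zi].
  have Bz := selected_sub zi; have ghi := gh_gt0 i.
  have [zx /andP[/= zt1 zt2]] := cell_coord (cell_mem i Bz).
  have mgh : m * gh N <= m * gh i by rewrite ler_wpM2l ?(ltW m0)//; exact/gh_le/ltnW.
  have thgh : 0 < theta * gh i by rewrite mulr_gt0//; lra.
  have WE : W * gh i = 2 * gh i + theta * gh i + m * gh i by rewrite /W; ring.
  exists (ct i (x, t) + W * gh i); split; first lra.
  apply: (@le_trans _ _ (lebesgue_measure
      ([set` `[ct i (x, t) + (theta + 2) * gh i, ct i (x, t) + W * gh i[] : set R))).
    rewrite lebesgue_measure_itv /= lte_fin ifT; last first.
      have mgh0 : 0 < m * gh i by exact: mulr_gt0.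
      lra.
    rewrite -EFinB lee_fin.
    apply: (@le_trans _ _ (m / W * (W * gh i))).
      by rewrite ler_wpM2l ?(ltW rho0)//; lra.
    by rewrite mulrA divfK ?gt_eqF//; lra.
  apply: le_measure; rewrite ?inE.
  + exact: measurable_itv.
  + apply: measurableI; last exact: measurable_itv.
    by apply: measurable_xsection; exact: measurable_layer.
  + move=> t'; rewrite /= in_itv/= => /andP[t1 t2]; split; last first.
      by rewrite /= in_itv/= t2 andbT; lra.
    rewrite /xsection /= inE; apply: (selected_future zi); first exact: zx.
    by rewrite /= t1 t2.
Qed.

Let geometric_small (C eps : R) : 0 < eps -> exists i, C * 2^-1 ^+ i < eps.
Proof.
move=> eps0; have [i /andP[iC _]] := @natr_ceil_exists _ (`|C| / eps) ltac:(by rewrite divr_ge0// ltW).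
exists i; apply: (@le_lt_trans _ _ (`|C| * 2^-1 ^+ i)).
  by rewrite ler_wpM2r ?ler_norm// ltW.
rewrite exprVn ltr_pdivrMr ?exprn_gt0//.
rewrite ler_pdivrMr// mulrC in iC; apply: le_lt_trans iC _.
by rewrite ltr_pM2l// -natrX ltr_nat ltn_expl.
Qed.

(** The upper bounds on time and on [D] that define [X] are strict and [D] is Lipschitz, so a small
    enough cell around [z] lies in [X] and is bad. Its parent then has a bad child, and the first
    ancestor with this property is selected. *)
Let layer_covered z : X z -> exists i, selected i z.
Proof.
move=> Xz; have [Bz Dz] := Xz.
have Bz0 : B0 z by exact: (box_tau tauS_le).
have {}Dz : D z < lam ^+ k.+1 * D y0 by [].
have zt : z.2 < s + tau k.+1 by case: Bz => _; rewrite /= in_itv/= => /andP[].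
have d1 : 0 < lam ^+ k.+1 * D y0 - D z by rewrite subr_gt0.
have d2 : 0 < s + tau k.+1 - z.2 by rewrite subr_gt0.
have [i1 hi1] := geometric_small L d1.
have [i2 hi2] := geometric_small H d2.
pose i := maxn i1 i2.
have gli : gl i < lam ^+ k.+1 * D y0 - D z.
  apply: le_lt_trans hi1; apply: le_trans (gl_pow i) _.
  rewrite ler_wpM2l ?(ltW L_gt0)//.
  by apply: ler_wiXn2l; rewrite ?leq_maxl//; lra.
have ghi : gh i < s + tau k.+1 - z.2.
  apply: le_lt_trans hi2; apply: le_trans (gh_pow i) _.
  rewrite ler_wpM2l ?(ltW H_gt0)//.
  by apply: ler_wiXn2l; rewrite ?leq_maxr//; lra.
have [zx /andP[zt1 zt2]] := cell_coord (cell_mem i Bz0).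
have gl0 := gl_gt0 i.
have cX : cell i z `<=` X.
  move=> w zw; have [wx /andP[wt1 wt2]] := cell_coord zw.
  have [Bw1] := cell_sub Bz0 zw; rewrite /= in_itv/= => /andP[Bw2 Bw3].
  split.
    by split => //=; rewrite in_itv/= Bw2/=; lra.
  rewrite /sublevel /=; apply: le_lt_trans (D_lip w z) _.
  rewrite -ltrBrDl; apply: le_lt_trans gli.
  have /andP[_ hb] := h_bounds i.
  exact: (box_distp hp gl0 hb zw (cell_mem i Bz0)).
have bz : bad X i z.
  rewrite /bad (_ : X `&` cell i z = cell i z); last exact/setIidPr.
  rewrite mu_cell lte_fin -subr_gt0 (_ : _ - _ = c * (gl i ^+ n * gh i)); last ring.
  have /andP[c0 _] := hc.
  by apply: mulr_gt0 => //; apply: mulr_gt0 => //; exact: exprn_gt0.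
have ki : (k <= i)%N by exact: (bad_generation mX X_sub Bz0 bz).
case: i ki bz {gli ghi zx zt1 zt2 gl0 cX} => [|i] ki bz.
  by move: ki; rewrite leqNgt k_gt0.
pose P j := `[< has_bad_child j z >].
have exP : exists j, P j by exists i; apply/asboolP; exists z; split => //; exact: cell_mem.
case: (ex_minnP exP) => j /asboolP hj jmin.
exists j; split => // l lj hl; move: lj; rewrite ltnNge => /negP; apply.
by apply: jmin; apply/asboolP.
Qed.

(** The selected cells cover layer k + 1, which fills at most 1 - c of them, and their measure is at
    most W / m = 1 + c / 2 times that of layer [k]; then (1 - c) * (1 + c / 2) <= 1 - c / 2.
    Generations below [N] come first, then [N] tends to infinity. *)
Lemma layer_contraction : (mu (layer k.+1) <= (1 - c / 2)%:E * mu (layer k))%E.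
Proof.
have /andP[c0 c1] := hc; have m0 := m_gt0; have W4 := W_gt4; have th := htheta.
have rho0 : 0 < m / W by rewrite divr_gt0//; lra.
have bound N : (mu (X `&` selected_lt N) <= (1 - c / 2)%:E * mu (layer k))%E.
  apply: le_trans (mu_selected_lt N) _.
  have -> : 1 - c = (1 - c) * (W / m) * (m / W).
    by field; apply/andP; split; rewrite gt_eqF//; lra.
  rewrite EFinM -muleA; apply: (@le_trans _ _ (((1 - c) * (W / m))%:E * mu (layer k))%E).
    apply: lee_wpmul2l; last exact: mu_selected_lt_layer.
    by rewrite lee_fin mulr_ge0 ?divr_ge0//; lra.
  apply: lee_wpmul2r; first exact: measure_ge0.
  rewrite lee_fin.
  have -> : W / m = 1 + c / 2.
    by rewrite /W mulrDl divff ?gt_eqF// addrC /m; congr (_ + _); field; rewrite !gt_eqF//; lra.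
  nra.
have cover : X = \bigcup_N (X `&` selected_lt N).
  apply/seteqP; split => [z Xz|z [N _ []//]].
  by have [i zi] := layer_covered Xz; exists i.+1 => //; split => //; exists i.
have cvg : (mu \o (fun N => X `&` selected_lt N)) N @[N --> \oo] --> mu X.
  rewrite [in X in _ --> X]cover; apply: nondecreasing_cvg_mu.
  - by move=> N; apply: measurableI.
  - by rewrite -cover.
  - apply/nondecreasing_seqP => N; apply/subsetPset => z [Xz [i iN zi]]; split => //.
    by exists i => //; exact: ltnW.
rewrite -/X -(cvg_lim _ cvg)//; apply: lime_le; first by apply/cvg_ex; exists (mu X).
by apply: nearW => N /=; exact: bound.
Qed.

End one_step.

Lemma layers_decay (k0 k : nat) : (0 < k0)%N -> tau k0 <= H -> (k0 <= k)%N ->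
  (mu (layer k) <= ((1 - c / 2) ^+ (k - k0) * (L ^+ n * H))%:E)%E.
Proof.
move=> k0_gt0 tk0; have /andP[c0 c1] := hc; have W4 := W_gt4.
have tau_le j : (k0 <= j)%N -> tau j <= H.
  move=> kj; apply: le_trans tk0; rewrite lerD2l ler_wpM2l//.
    by rewrite !mulr_ge0// ?ltW//; lra.
  by apply: ler_wiXn2l => //; lra.
move=> kk0; rewrite -(subnK kk0); elim: (k - k0)%N => [|j IH].
  rewrite add0n subnn expr0 mul1r -(@mu_box _ n a s _ _ (ltW L_gt0) (ltW H_gt0)).
  apply: le_measure; rewrite ?inE; [exact: measurable_layer|exact: measurable_box|].
  move=> z [[zx]]; rewrite /= in_itv/= => /andP[zt1 zt2] _; split => //=.
  by rewrite in_itv/= zt1 (lt_le_trans zt2)// lerD2l.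
rewrite addSn; apply: le_trans (layer_contraction _ _) _.
- by rewrite addn_gt0 k0_gt0 orbT.
- by apply: tau_le; rewrite leq_addl.
rewrite subSn ?leq_addl// exprS -[in leRHS]mulrA EFinM.
by apply: lee_wpmul2l => //; rewrite lee_fin; lra.
Qed.

End contraction.

(** * The dyadic lattice as a nested grid *)

Section ntime.
Context {R : realType}.
Variables (p : R) (d : nat).
Local Notation a := (2 `^ (d%:R * p) : R).
Hypothesis a_ge9 : 9 <= a.

(** Solves (1 - g') * (L / 2^d)^p = (1 - g) * L^p / k for the truncation parameter g' of a child,
    where k is the number of time pieces. *)
Definition next_gamma (g : R) : R := 1 - (1 - g) * a / (ntime p d g)%:R.

(** The threshold on the truncation parameter amounts to (1 - g) * a >= (a + 1) / 2. When it holds,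
    rounding up to k < a + 1 keeps (1 - g) * a / k above 1/2. When it fails, rounding down to k > a
    - 1 keeps this ratio below 1, as a >= 9. *)
Lemma ntime_bounds (g : R) : 0 <= g <= 2^-1 ->
  [/\ (2 <= ntime p d g)%N, (ntime p d g)%:R <= 2 * a & 0 <= next_gamma g <= 2^-1].
Proof.
move=> /andP[g0 g1]; have a9 := a_ge9; rewrite /next_gamma /ntime.
have a1E : 2 `^ (d%:R * p + 1) = 2 * a.
  by rewrite powRD ?powRr1 1?mulrC// (_ : (2 : R) != 0)// implybT.
rewrite a1E; case: ifPn => [gle|].
  have [c1 c2] : a <= (`|Num.ceil a|%N)%:R /\ (`|Num.ceil a|%N)%:R < a + 1 :> R.
    have c0 : (0 <= Num.ceil a)%R by rewrite ceil_ge0; lra.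
    rewrite natr_absz (ger0_norm c0); split; first exact: Num.Theory.ceil_ge.
    by have := ceilB1_lt a; rewrite intrD; lra.
  move: (`|_|%N) c1 c2 => k c1 c2.
  have k0 : 0 < k%:R :> R by lra.
  split.
  - by rewrite -(ler_nat R); lra.
  - by lra.
  - have gle' : (a + 1) <= (1 - g) * (2 * a).
      by rewrite -ler_pdivrMr; lra.
    rewrite subr_ge0 ler_pdivrMr// mul1r lerBlDr -lerBlDl ler_pdivlMr//.
    apply/andP; split; last by lra.
    by apply: le_trans c1; rewrite ler_piMl//; lra.
rewrite -ltNge => gle.
have [c1 c2] : (`|Num.floor a|%N)%:R <= a /\ a < (`|Num.floor a|%N)%:R + 1 :> R.
  have c0 : (0 <= Num.floor a)%R by rewrite floor_ge0; lra.
  rewrite natr_absz (ger0_norm c0); split; first exact: Num.Theory.floor_le.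
  by have := floorD1_gt a; rewrite intrD.
move: (`|_|%N) c1 c2 => k c1 c2.
have k0 : 0 < k%:R :> R by lra.
split.
- by rewrite -(ler_nat R); lra.
- by lra.
- have gle' : (1 - g) * (2 * a) < a + 1.
    by rewrite -ltr_pdivlMr; lra.
  rewrite subr_ge0 ler_pdivrMr// mul1r lerBlDr -lerBlDl ler_pdivlMr//.
  apply/andP; split; first by lra.
  by apply: (@le_trans _ _ (2^-1 * a)); [lra|rewrite ler_wpM2r//; lra].
Qed.

End ntime.

Section prect_grid.
Context {R : realType} {n : nat}.
Variables (p : R) (d : nat) (P : @prect R n).
Local Notation point := ('rV[R]_n * R)%type.
Local Notation mu := (@lebesgue_xt R n).
Hypotheses (a_ge9 : 9 <= 2 `^ (d%:R * p) :> R) (prectP : is_prect P).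

Let L_gt0 : 0 < pr_L P. Proof. by case: prectP. Qed.

(* All the cells of generation [i] have the same truncation parameter, so the lattice
   is a nested sequence of grids. *)
Definition gen_gamma (i : nat) : R := iter i (next_gamma p d) (pr_gamma P).

Definition gen_ntime (i : nat) : nat := ntime p d (gen_gamma i).

Definition gen_count (i : nat) : nat := \prod_(j < i) gen_ntime j.

Definition low_corner : 'rV[R]_n := \row_q (pr_x P ord0 q - pr_L P / 2).

Definition low_time : R := pr_t P - pr_L P `^ p.

Lemma gen_gamma_bounds i : 0 <= gen_gamma i <= 2^-1.
Proof.
elim: i => [|i IH]; first by case: prectP.
by rewrite /gen_gamma iterS; have [_ _] := ntime_bounds a_ge9 IH.
Qed.

Lemma gen_count0 : gen_count 0 = 1%N. Proof. by rewrite /gen_count big_ord0. Qed.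

Lemma gen_countS i : gen_count i.+1 = (gen_count i * gen_ntime i)%N.
Proof. by rewrite /gen_count big_ord_recr. Qed.

Lemma gen_ntime_ge2 i : (2 <= gen_ntime i)%N.
Proof. by have [] := ntime_bounds a_ge9 (gen_gamma_bounds i). Qed.

Lemma gen_ntime_gt0 i : (0 < gen_ntime i)%N.
Proof. exact: leq_trans (gen_ntime_ge2 i). Qed.

Lemma gen_ntime_le i : (gen_ntime i)%:R <= 2 * 2 `^ (d%:R * p) :> R.
Proof. by have [] := ntime_bounds a_ge9 (gen_gamma_bounds i). Qed.

Lemma l_t_gt0 : 0 < l_t p P.
Proof.
rewrite /l_t mulr_gt0 ?powR_gt0//; case: prectP => _ /andP[? ?]; lra.
Qed.

Local Notation gl := (grid_l d (pr_L P)).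
Local Notation gh := (grid_h (l_t p P) gen_count).
Local Notation gbox := (grid_box d low_corner low_time (pr_L P) (l_t p P) gen_count).
Local Notation cell := (grid_cell d low_corner low_time (pr_L P) (l_t p P) gen_count).
Local Notation gj := (grid_j d low_corner (pr_L P)).
Local Notation gk := (grid_k low_time (l_t p P) gen_count).

Lemma rect_box : rect p P = box low_corner low_time (pr_L P) (l_t p P).
Proof.
have time : pr_t P - pr_gamma P * pr_L P `^ p = low_time + l_t p P.
  by rewrite /low_time /l_t; ring.
rewrite /rect /cube /box time -/low_time; congr (_ `*` _).
apply/seteqP; split => z zx q; have := zx q; rewrite mxE => /andP[? ?]; apply/andP; split; lra.
Qed.

Lemma grid_heightE i : gh i = (1 - gen_gamma i) * gl i `^ p.
Proof.
elim: i => [|i IH]; first by rewrite /grid_h gen_count0 divr1 /grid_l muln0 expn0 divr1.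
have r0 : (gen_ntime i)%:R != 0 :> R by rewrite pnatr_eq0 -lt0n gen_ntime_gt0.
have hS : gh i = (gen_ntime i)%:R * gh i.+1.
  by apply: grid_hS; [exact: gen_count0|exact: gen_countS|exact: gen_ntime_gt0].
have lS : gl i `^ p = 2 `^ (d%:R * p) * gl i.+1 `^ p.
  rewrite (grid_lS d (pr_L P)) powRM ?(ltW (grid_l_gt0 _ L_gt0 _))// natrX -powR_mulrn//.
  by rewrite powRrM.
apply: (mulfI r0); rewrite -hS IH lS /gen_gamma iterS /next_gamma -/(gen_gamma i) -/(gen_ntime i).
by field.
Qed.

Lemma grid_height_bounds i : 2^-1 * gl i `^ p <= gh i <= gl i `^ p.
Proof.
have lp0 : 0 <= gl i `^ p by rewrite powR_ge0.
rewrite grid_heightE; have /andP[g0 g1] := gen_gamma_bounds i.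
by rewrite ler_wpM2r ?ler_piMl//; lra.
Qed.

Definition grid_prect (i : nat) (j : 'I_n -> nat) (k : nat) : prect :=
  PRect (\row_q (low_corner ord0 q + (j q)%:R * gl i + gl i / 2))
    (low_time + k%:R * gh i + gl i `^ p) (gl i) (gen_gamma i).

Lemma rect_grid_prect i j k : rect p (grid_prect i j k) = gbox i j k.
Proof.
rewrite /rect /cube /grid_box /box /=; congr (_ `*` _).
  by apply/seteqP; split => z zx q; have := zx q; rewrite !mxE => /andP[? ?]; apply/andP; split; lra.
rewrite addrK (_ : _ - gen_gamma i * _ = low_time + k%:R * gh i + gh i)//.
by rewrite [in RHS]grid_heightE [in LHS]grid_heightE; ring.
Qed.

Lemma grid_prect0 : grid_prect 0 (fun=> 0%N) 0 = P.
Proof.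
have l0 : gl 0 = pr_L P by rewrite /grid_l muln0 expn0 divr1.
rewrite /grid_prect l0 /low_corner /low_time /gen_gamma /=.
case: P => x t l g /=; congr PRect; last by rewrite mul0r addr0 subrK.
by apply/rowP => q; rewrite !mxE mul0r addr0; lra.
Qed.

Lemma l_t_grid_prect i j k : l_t p (grid_prect i j k) = gh i.
Proof. by rewrite /l_t /= grid_heightE. Qed.

Lemma prect_ext (Q Q' : @prect R n) : 0 < pr_L Q' -> pr_L Q = pr_L Q' -> l_t p Q = l_t p Q' ->
  (forall q, pr_x Q ord0 q = pr_x Q' ord0 q) ->
  pr_t Q - pr_L Q `^ p = pr_t Q' - pr_L Q' `^ p -> Q = Q'.
Proof.
case: Q Q' => x t l g [x' t' l' g'] /= l0 ll; rewrite /l_t /= ll => lt xx tt.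
congr PRect; first exact/rowP.
  by move/(congr1 (fun u => u + l' `^ p)): tt; rewrite !subrK.
have lp0 : l' `^ p != 0 by rewrite gt_eqF// powR_gt0.
by move/(mulIf lp0): lt; lra.
Qed.

Lemma natrM_gl i : (2 ^ d)%:R * gl i.+1 = gl i.
Proof. by rewrite -(grid_lS d (pr_L P)). Qed.

Lemma natrM_gh i : (gen_ntime i)%:R * gh i.+1 = gh i.
Proof.
by apply/esym/grid_hS; [exact: gen_count0|exact: gen_countS|exact: gen_ntime_gt0].
Qed.

Lemma gl_div i : gl i / 2 ^+ d = gl i.+1.
Proof. by rewrite -natrM_gl natrX mulrC mulKf// expf_neq0. Qed.

Lemma gh_div i : gh i / (gen_ntime i)%:R = gh i.+1.
Proof. by rewrite -natrM_gh mulrC mulKf// pnatr_eq0 -lt0n gen_ntime_gt0. Qed.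

Lemma dyadic_grid_prect i j k : (forall q, (j q < 2 ^ (d * i))%N) -> (k < gen_count i)%N ->
  dyadic p d i P (grid_prect i j k).
Proof.
elim: i j k => [|i IH] j k jlt klt.
  rewrite /= -[in RHS]grid_prect0; have -> : k = 0%N by move: klt; rewrite gen_count0; case: k.
  congr grid_prect; apply/funext => q; have := jlt q; rewrite muln0 expn0.
  by case: (j q).
have r0 := gen_ntime_gt0 i.
exists (grid_prect i (fun q => (j q %/ 2 ^ d)%N) (k %/ gen_ntime i)%N).
  apply: IH => [q|].
    by rewrite ltn_divLR ?expn_gt0// -expnD addnC -mulnS.
  by rewrite ltn_divLR// -gen_countS.
have jm q : (j q %% 2 ^ d < 2 ^ d)%N by rewrite ltn_mod expn_gt0.
have km : (k %% gen_ntime i < gen_ntime i)%N by rewrite ltn_mod.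
exists (fun q => Ordinal (jm q)), (Ordinal km); split.
- by rewrite /l_x /= gl_div.
- by rewrite !l_t_grid_prect -/(gen_ntime i) gh_div.
- move=> q; rewrite /l_x /= !mxE -(natrM_gl i) {1}(divn_eq (j q) (2 ^ d)) natrD natrM; ring.
- rewrite !l_t_grid_prect /= !addrK -(natrM_gh i) {1}(divn_eq k (gen_ntime i)) natrD natrM; ring.
Qed.

Lemma dyadic_gridP i Q : dyadic p d i P Q -> exists j k,
  [/\ forall q, (j q < 2 ^ (d * i))%N, (k < gen_count i)%N & Q = grid_prect i j k].
Proof.
elim: i Q => [|i IH] Q.
  move=> ->; exists (fun=> 0%N), 0%N; split; rewrite ?gen_count0 ?grid_prect0//.
  by move=> q; rewrite muln0 expn0.
move=> [_ /IH[j [k [jlt klt ->]]]] [j' [k' [Ql Qt Qx Qs]]].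
rewrite /l_x /= gl_div in Ql.
rewrite l_t_grid_prect -/(gen_ntime i) in k' Qt Qs *.
rewrite gh_div in Qt.
exists (fun q => (j q * 2 ^ d + j' q)%N), (k * gen_ntime i + k')%N; split.
- move=> q; apply: (@leq_trans ((j q).+1 * 2 ^ d)).
    by rewrite mulSn addnC ltn_add2r ltn_ord.
  by rewrite mulnS addnC expnD leq_mul2r jlt orbT.
- rewrite gen_countS; apply: (@leq_trans (k.+1 * gen_ntime i)).
    by rewrite mulSn addnC ltn_add2r ltn_ord.
  by rewrite leq_mul2r klt orbT.
- apply: prect_ext; rewrite ?l_t_grid_prect//=.
  + exact: grid_l_gt0.
  + move=> q; have := Qx q; rewrite /l_x Ql /= !mxE -(natrM_gl i) natrD natrM => H.
    by apply: (addIr (- (gl i.+1 / 2))); rewrite H; ring.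
  + by rewrite Qs Qt /= !addrK -(natrM_gh i) natrD natrM; ring.
Qed.

Lemma lattice_cell i z : rect p P z ->
  lattice p d P (grid_prect i (gj i z) (gk i z)) /\
  rect p (grid_prect i (gj i z) (gk i z)) = cell i z.
Proof.
rewrite rect_box => Bz; split; last by rewrite rect_grid_prect.
exists i => //; apply: dyadic_grid_prect => [q|].
  exact: grid_j_lt Bz.
by apply: grid_k_lt Bz; [exact: l_t_gt0|exact: gen_count0|exact: gen_countS|exact: gen_ntime_gt0].
Qed.

Lemma lattice_gridP Q : lattice p d P Q -> exists i j k,
  [/\ forall q, (j q < 2 ^ (d * i))%N, (k < gen_count i)%N & Q = grid_prect i j k].
Proof. by move=> [i _ /dyadic_gridP[j [k H]]]; exists i, j, k. Qed.

Lemma lattice_box Q : lattice p d P Q -> [/\ 0 < l_x Q, 2^-1 * l_x Q `^ p <= l_t p Q <= l_x Q `^ p &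
  exists b s, rect p Q = box b s (l_x Q) (l_t p Q)].
Proof.
move=> /lattice_gridP[i [j [k [_ _ ->]]]]; rewrite l_t_grid_prect /l_x /=; split.
- exact: grid_l_gt0.
- exact: grid_height_bounds.
- by do 2 eexists; rewrite rect_grid_prect.
Qed.

Lemma lattice_sub Q : lattice p d P Q -> rect p Q `<=` rect p P.
Proof.
move=> /lattice_gridP[i [j [k [jlt klt ->]]]]; rewrite rect_grid_prect rect_box.
exact: (grid_box_sub L_gt0 l_t_gt0 gen_count0 gen_countS gen_ntime_gt0 jlt klt).
Qed.

Lemma mu_lattice Q : lattice p d P Q -> mu (rect p Q) = (l_x Q ^+ n * l_t p Q)%:E.
Proof.
move=> /lattice_box[l0 /andP[h1 _] [b [s ->]]]; rewrite mu_box ?(ltW l0)//.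
by apply: le_trans h1; rewrite mulr_ge0 ?powR_ge0.
Qed.

(** A free cell of the least generation that has one is maximal, since no free lattice rectangle has
    an earlier generation. So the maximal free cells form a nonempty family, and [largest] is not
    its default value [set0]. *)
Lemma largest_ge (E : set point) i z : rect p P z -> Defs.free E (cell i z) ->
  exists Q, [/\ lattice p d P Q, Defs.free E (rect p Q), largest p d E P = rect p Q & gl i <= l_x Q].
Proof.
move=> Pz zfree.
pose F j := `[< exists z', rect p P z' /\ Defs.free E (cell j z') >].
have exF : exists j, F j by exists i; apply/asboolP; exists z.
case: (ex_minnP exF) => j /asboolP[w [Pw wfree]] jmin.
pose Q0 := grid_prect j (gj j w) (gk j w).
have [latQ0 rectQ0] := lattice_cell j Pw.
have ji : (j <= i)%N by apply: jmin; apply/asboolP; exists z.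
have gen_le Q : lattice p d P Q -> Defs.free E (rect p Q) -> exists j' w',
   [/\ (j <= j')%N, rect p P w', rect p Q = cell j' w' & l_x Q = gl j'].
  move=> /lattice_gridP[j' [jj [kk [jjlt kklt ->]]]]; rewrite rect_grid_prect => Qfree.
  have l0 := grid_l_gt0 d L_gt0 j'.
  have h0 : 0 < gh j'.
    by apply: grid_h_gt0; [exact: l_t_gt0|exact: gen_count0|exact: gen_countS|exact: gen_ntime_gt0].
  pose w' : point := (\row_q (low_corner ord0 q + (jj q)%:R * gl j'), low_time + kk%:R * gh j').
  have w'Q : gbox j' jj kk w' by split => [q|]; rewrite /= ?in_itv/= lexx ltrDl.
  have cE : gbox j' jj kk = cell j' w'.
    exact: (grid_box_cell L_gt0 l_t_gt0 gen_count0 gen_countS gen_ntime_gt0 w'Q).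
  have Pw' : rect p P w'.
    rewrite rect_box.
    exact: (grid_box_sub L_gt0 l_t_gt0 gen_count0 gen_countS gen_ntime_gt0 jjlt kklt w'Q).
  exists j', w'; split => //; apply: jmin; apply/asboolP; exists w'; split => //.
  by rewrite -cE.
have gl_le j' : (j <= j')%N -> gl j' <= gl j.
  move=> jj'; rewrite /grid_l ler_wpM2l ?(ltW L_gt0)// lef_pV2 ?posrE ?ltr0n ?expn_gt0//.
  by rewrite ler_nat leq_pexp2l// leq_mul2l jj' orbT.
have maxQ0 : maxfree p d E P Q0.
  split => //; first by rewrite rectQ0.
  move=> Q' latQ' freeQ' Q0Q'; apply/seteqP; split => //.
  have [j' [w' [jj' Pw' Q'E _]]] := gen_le _ latQ' freeQ'.
  rewrite Q'E rectQ0 in Q0Q' *; rewrite rect_box in Pw Pw'.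
  have ww : cell j w w.
    exact: (grid_cell_mem d L_gt0 l_t_gt0 gen_count0 gen_countS gen_ntime_gt0 j Pw).
  have w'E : cell j' w = cell j' w'.
    exact: (grid_cell_eq L_gt0 l_t_gt0 gen_count0 gen_countS gen_ntime_gt0 (Q0Q' _ ww)).
  rewrite -w'E; exact: (grid_cell_le L_gt0 l_t_gt0 gen_count0 gen_countS gen_ntime_gt0 jj' Pw).
pose S := [set rect p Q | Q in
    [set Q | maxfree p d E P Q /\ forall Q', maxfree p d E P Q' -> l_x Q' <= l_x Q]].
have [Q [[latQ freeQ _] maxQ] QE] : S (largest p d E P).
  have SQ0 : S (rect p Q0); last exact: (xgetPex set0 (ex_intro _ _ SQ0)).
  exists Q0 => //; split => // Q' [latQ' freeQ' _].
  by have [j' [_ [jj' _ _ ->]]] := gen_le _ latQ' freeQ'; exact: gl_le.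
exists Q; split => //.
apply: le_trans (maxQ _ maxQ0); rewrite /l_x /=.
rewrite /grid_l ler_wpM2l ?(ltW L_gt0)// lef_pV2 ?posrE ?ltr0n ?expn_gt0//.
by rewrite ler_nat leq_pexp2l// leq_mul2l ji orbT.
Qed.

End prect_grid.

(** * Density of far points in weakly porous sets *)

Section porous_density.
Context {R : realType} {n : nat}.
Variables (p : R) (d : nat).
Local Notation point := ('rV[R]_n * R)%type.
Local Notation mu := (@lebesgue_xt R n).
Hypotheses (hp : 1 < p) (a_ge9 : 9 <= 2 `^ (d%:R * p) :> R) (d_gt0 : (0 < d)%N).

Lemma powR_le_lin (x : R) : 0 <= x <= 1 -> x `^ p <= x.
Proof.
move=> /andP[x0 x1]; have p0 := hp; move: x0; rewrite le_eqVlt => /predU1P[<-|x0].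
  by rewrite powR0//; lra.
by apply: ge1r_powR; [rewrite x0|exact: ltW].
Qed.

(** The time margin xi * h is at least xi * l^p / 2, hence at least (xi / 2 * l)^p because p > 1 and
    xi <= 1. So the parabolic ball of radius xi / 2 * l around [z] stays in the free box. *)
Lemma distp_set_inner (E : set point) (b : 'rV[R]_n) (s l h xi : R) (z : point) :
  E !=set0 -> 0 < xi <= 1 -> 0 < l -> 2^-1 * l `^ p <= h -> Defs.free E (box b s l h) ->
  (forall q, b ord0 q + xi * l <= z.1 ord0 q < b ord0 q + l - xi * l) ->
  s + xi * h <= z.2 < s + h - xi * h ->
  xi / 2 * l <= distp_set p E z.
Proof.
move=> E0 /andP[xi0 xi1] l0 hl Efree zx /andP[zt1 zt2].
have r0 : 0 < xi / 2 * l by rewrite mulr_gt0// divr_gt0.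
rewrite leNgt; apply/negP => /(distp_set_ltP E0)[w Ew /ltW/(distp_leP hp)].
move=> /(_ (ltW r0))[wx wt].
suff : (box b s l h `&` E) w by rewrite Efree.
split => //.
have xil : 0 < xi * l by rewrite mulr_gt0.
have lp0 : 0 < l `^ p by rewrite powR_gt0.
have rp : (xi / 2 * l) `^ p <= xi * h.
  rewrite powRM ?(ltW l0)//; last by rewrite ltW// divr_gt0.
  apply: (@le_trans _ _ (xi / 2 * l `^ p)).
    by rewrite ler_wpM2r ?(ltW lp0)// powR_le_lin//; apply/andP; split; lra.
  by rewrite -mulrA ler_wpM2l ?(ltW xi0).
split => [q|] /=; last first.
  rewrite in_itv/=; move: wt; rewrite ler_norml => /andP[w1 w2]; apply/andP; split; first lra.
  have : 0 < (xi / 2 * l) `^ p by rewrite powR_gt0.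
  lra.
have := wx q; have /andP[z1 z2] := zx q; rewrite ler_norml => /andP[w1 w2].
by apply/andP; split; lra.
Qed.

(** The first generation with side below [rho]: its predecessor has side at least [rho]. Generation
    0 has no predecessor and accounts for the term l / 2. *)
Lemma small_generation (l rho : R) : 0 < l -> 0 < rho -> exists i,
  grid_l d l i < rho /\ Num.min (l / 2) (rho / (2 ^ d)%:R) <= grid_l d l i.
Proof.
move=> l0 rho0.
have [k /andP[kl _]] := @natr_ceil_exists _ (l / rho) ltac:(by rewrite divr_ge0// ltW).
have ex : exists i, grid_l d l i < rho.
  exists k; rewrite /grid_l ltr_pdivrMr ?ltr0n ?expn_gt0//.
  rewrite ler_pdivrMr// in kl; apply: le_lt_trans kl _.
  rewrite mulrC ltr_pM2l// ltr_nat; apply: (@leq_trans (2 ^ k)); first exact: ltn_expl.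
  by rewrite leq_pexp2l// leq_pmull.
case: (ex_minnP ex) => i il imin; exists i; split => //.
case: i il imin => [|i] il imin.
  rewrite ge_min; apply/orP; left.
  by rewrite /grid_l muln0 expn0 divr1; lra.
rewrite ge_min; apply/orP; right.
rewrite ler_pdivrMr ?ltr0n ?expn_gt0// mulrC -grid_lS leNgt.
by apply/negP => /imin; rewrite ltnn.
Qed.

(** Shrinking a box by this relative margin at all of its faces, in n + 1 dimensions, keeps half of
    its measure by Bernoulli's inequality. *)
Definition porous_margin : R := (4 * n.+1%:R)^-1.

(** A product of three losses: distance to [E] against side of a free rectangle, its side against
    that of the largest free cell of the translate, and the latter against [D y]. *)
Definition porous_ratio (theta delta : R) : R :=
  porous_margin / 2 * (delta / 2) / (4 * (theta + 1) * (2 ^ d)%:R).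

Lemma porous_margin_gt0 : 0 < porous_margin.
Proof. by rewrite invr_gt0 mulr_gt0// ltr0n. Qed.

Lemma porous_margin_le : porous_margin <= 4^-1.
Proof.
by rewrite /porous_margin lef_pV2 ?posrE ?mulr_gt0 ?ltr0n// ler_peMr// ler1n.
Qed.

Lemma porous_ratio_bounds theta delta : 1 < theta -> 0 < delta < 1 ->
  0 < porous_ratio theta delta <= 4^-1.
Proof.
move=> th /andP[d0 d1]; have m0 := porous_margin_gt0; have m4 := porous_margin_le.
have N1 : 1 <= (2 ^ d)%:R :> R by rewrite ler1n expn_gt0.
have den : 1 <= 4 * (theta + 1) * (2 ^ d)%:R.
  by apply: (@le_trans _ _ (4 * (theta + 1))); [lra|rewrite ler_peMr//; lra].
have num : 0 < porous_margin / 2 * (delta / 2) by rewrite mulr_gt0// divr_gt0.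
rewrite /porous_ratio; apply/andP; split; first by rewrite divr_gt0//; lra.
rewrite ler_pdivrMr; last lra.
apply: (@le_trans _ _ (4^-1 * 1)); last by rewrite ler_wpM2l.
rewrite mulr1; apply: (@le_trans _ _ (4^-1 * 1)); last lra.
by apply: ler_pM; lra.
Qed.

Lemma far_point_distp (E : set point) (a : 'rV[R]_n) (s l h theta : R) (y z : point) :
  E !=set0 -> 1 < theta -> 0 < l -> 0 < h <= l `^ p ->
  (forall q, a ord0 q <= y.1 ord0 q < a ord0 q + l) ->
  s + theta * h < y.2 < s + (theta + 1) * h ->
  2 * (theta + 1) * l <= distp_set p E y -> box a s l h z ->
  2^-1 * distp_set p E y <= distp_set p E z.
Proof.
move=> E0 th l0 /andP[h0 hl] ya /andP[yt1 yt2] far.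
move=> [zx]; rewrite /= in_itv/= => /andP[zt1 zt2].
have th1 : 0 < theta + 1 by lra.
have tl0 : 0 < (theta + 1) * l by rewrite mulr_gt0.
have zy : distp p y z <= (theta + 1) * l.
  apply/(distp_leP hp); first exact: ltW.
  split => [q|].
    have /andP[? ?] := zx q; have /andP[? ?] := ya q.
    apply: (@le_trans _ _ l); first by rewrite ler_norml; apply/andP; split; lra.
    by rewrite ler_peMl ?(ltW l0)//; lra.
  apply: (@le_trans _ _ ((theta + 1) * h)).
    have thh : 0 < theta * h by rewrite mulr_gt0//; lra.
    by rewrite ler_norml; apply/andP; split; lra.
  rewrite powRM ?(ltW l0) ?(ltW th1)//.
  apply: ler_pM; rewrite ?(ltW th1) ?(ltW h0)//.
  by apply: le1r_powR; [lra|exact: ltW].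
have := distp_set_lipschitz hp y z E0; lra.
Qed.

Definition inner_box (Q : @prect R n) : set point :=
  box (\row_q (low_corner Q ord0 q + porous_margin * l_x Q))
    (low_time p Q + porous_margin * l_t p Q)
    ((1 - 2 * porous_margin) * l_x Q) ((1 - 2 * porous_margin) * l_t p Q).

Section inner.
Variable Q : @prect R n.
Hypotheses (lQ : 0 < l_x Q) (hQ : 2^-1 * l_x Q `^ p <= l_t p Q).

Let hQ0 : 0 < l_t p Q.
Proof. by apply: lt_le_trans hQ; rewrite mulr_gt0 ?powR_gt0. Qed.

Let inner_boxP z : inner_box Q z ->
  (forall q, low_corner Q ord0 q + porous_margin * l_x Q <= z.1 ord0 q
     < low_corner Q ord0 q + l_x Q - porous_margin * l_x Q) /\
  low_time p Q + porous_margin * l_t p Q <= z.2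
     < low_time p Q + l_t p Q - porous_margin * l_t p Q.
Proof.
move=> [zx]; rewrite /= in_itv/= => /andP[zt1 zt2]; split => [q|]; last by apply/andP; split; lra.
by have := zx q; rewrite mxE => /andP[? ?]; apply/andP; split; lra.
Qed.

Lemma inner_box_sub : inner_box Q `<=` rect p Q.
Proof.
have m0 := porous_margin_gt0.
have xil : 0 < porous_margin * l_x Q by rewrite mulr_gt0.
have xih : 0 < porous_margin * l_t p Q by rewrite mulr_gt0.
move=> z /inner_boxP[zx /andP[zt1 zt2]]; rewrite rect_box.
split => [q|] /=; last by rewrite in_itv/=; apply/andP; split; lra.
have /andP[z1 z2] := zx q; rewrite /l_x in z1 z2 xil; apply/andP; split; lra.
Qed.

Lemma mu_inner_box : ((2^-1)%:E * mu (rect p Q) <= mu (inner_box Q))%E.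
Proof.
have m0 := porous_margin_gt0; have m4 := porous_margin_le.
have [lQ' hQ'] := (ltW lQ, ltW hQ0).
have m2 : 0 <= 1 - 2 * porous_margin by lra.
rewrite rect_box mu_box// /inner_box mu_box ?(mulr_ge0 m2 lQ') ?(mulr_ge0 m2 hQ')//.
rewrite -EFinM lee_fin exprMn.
have -> : (1 - 2 * porous_margin) ^+ n * l_x Q ^+ n * ((1 - 2 * porous_margin) * l_t p Q) =
   (1 - 2 * porous_margin) ^+ n.+1 * (l_x Q ^+ n * l_t p Q) by rewrite exprSr; ring.
have V0 : 0 <= l_x Q ^+ n * l_t p Q by apply: mulr_ge0 => //; exact: exprn_ge0.
apply: ler_wpM2r => //.
apply: le_trans (bernoulli_le n.+1 (x := 2 * porous_margin) _); last by apply/andP; split; lra.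
have -> : n.+1%:R * (2 * porous_margin) = 2^-1.
  have N0 : n.+1%:R != 0 :> R by rewrite pnatr_eq0.
  by rewrite /porous_margin; move: (n.+1%:R) N0 => N N0; field.
lra.
Qed.

Lemma distp_set_inner_box (E : set point) z : E !=set0 -> Defs.free E (rect p Q) ->
  inner_box Q z -> porous_margin / 2 * l_x Q <= distp_set p E z.
Proof.
have m0 := porous_margin_gt0; have m4 := porous_margin_le.
rewrite rect_box => E0 Qfree /inner_boxP[zx zt].
by apply: (distp_set_inner E0 _ lQ hQ Qfree zx zt); apply/andP; split; lra.
Qed.

End inner.

(** The time factor alone suffices: if l' < delta / 2 * l, then l'^p < (delta / 2)^p * l^p <= delta
    * (l^p / 2) <= delta * h, while l'^n <= l^n. *)
Lemma side_le_of_measure (l l' h h' delta : R) : 0 < l -> 0 < l' -> 0 < delta < 1 ->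
  2^-1 * l `^ p <= h -> h' <= l' `^ p -> 0 <= h' ->
  delta * (l ^+ n * h) <= l' ^+ n * h' -> delta / 2 * l <= l'.
Proof.
move=> l0 l'0 /andP[d0 d1] hl h'l' h'0 hle; have hp' := hp.
rewrite leNgt; apply/negP => lt_l; move: hle; apply/negP; rewrite -ltNge.
have dl0 : 0 <= delta / 2 by rewrite divr_ge0 ?(ltW d0).
apply: (@le_lt_trans _ _ (l ^+ n * l' `^ p)).
  apply: ler_pM; rewrite ?exprn_ge0 ?(ltW l'0)//.
  apply: lerXn2r; rewrite ?nnegrE ?(ltW l0) ?(ltW l'0)//.
  by apply: ltW; apply: lt_le_trans lt_l _; rewrite ler_piMl ?(ltW l0)//; lra.
rewrite mulrCA ltr_pM2l ?exprn_gt0//.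
apply: (@lt_le_trans _ _ ((delta / 2 * l) `^ p)).
  by apply: powR_ltW; rewrite ?(ltW l'0)//; lra.
rewrite powRM ?(ltW l0)//.
apply: (@le_trans _ _ (delta / 2 * l `^ p)).
  by rewrite ler_wpM2r ?powR_ge0// powR_le_lin//; apply/andP; split; lra.
by rewrite -mulrA ler_wpM2l ?(ltW d0).
Qed.

Lemma distp_set_le_cell (E : set point) (P : @prect R n) (i : nat) (y w : point) :
  is_prect P -> rect p P y ->
  grid_cell d (low_corner P) (low_time p P) (pr_L P) (l_t p P) (gen_count p d P) i y w ->
  E w -> distp_set p E y <= grid_l d (pr_L P) i.
Proof.
move=> prectP; rewrite rect_box => By cw Ew; have [l0 _] := prectP.
have cy := grid_cell_mem d l0 (l_t_gt0 p prectP) (gen_count0 p d P) (gen_countS p d P)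
  (gen_ntime_gt0 a_ge9 prectP) i By.
have /andP[_ hb2] := grid_height_bounds a_ge9 prectP i.
apply: le_trans (distp_set_le _ _ Ew) _.
by apply: (box_distp hp _ hb2 cy cw); exact: grid_l_gt0.
Qed.

(** A cell around [y] of side below [D y] is free, because its parabolic diameter is at most its
    side. The upper bound on [D y] serves the case where the whole rectangle is such a cell. *)
Lemma largest_ge_distp (E : set point) (theta : R) (P : @prect R n) (y : point) :
  1 < theta -> is_prect P -> rect p P y ->
  0 < distp_set p E y < 2 * (theta + 1) * pr_L P ->
  exists Q, [/\ lattice p d P Q, largest p d E P = rect p Q &
    distp_set p E y / (4 * (theta + 1) * (2 ^ d)%:R) <= l_x Q].
Proof.
move=> th prectP Py /andP[Dy0 near].
have l0 : 0 < pr_L P by case: prectP.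
have [i [il1 il2]] := small_generation l0 Dy0.
set li := grid_l d (pr_L P) i in il1 il2.
have li0 : 0 < li by exact: grid_l_gt0.
have N1 : 1 <= (2 ^ d)%:R :> R by rewrite ler1n expn_gt0.
have th1 : 0 < 4 * (theta + 1) by lra.
have N0 : 0 < (2 ^ d)%:R :> R by lra.
have Nth : 0 < 4 * (theta + 1) * (2 ^ d)%:R by rewrite mulr_gt0.
have rho_le : distp_set p E y / (4 * (theta + 1) * (2 ^ d)%:R) <= li.
  apply: le_trans il2; rewrite le_min; apply/andP; split.
    rewrite ler_pdivrMr//; apply: (@le_trans _ _ (pr_L P / 2 * (4 * (theta + 1) * 1))); first lra.
    by rewrite ler_wpM2l ?divr_ge0 ?(ltW l0)// ler_wpM2l// ltW.
  rewrite ler_wpM2l ?(ltW Dy0)// lef_pV2 ?posrE// ler_peMl ?(ltW N0)//; lra.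
have cell_free : Defs.free E (grid_cell d (low_corner P) (low_time p P) (pr_L P)
     (l_t p P) (gen_count p d P) i y).
  rewrite /Defs.free -subset0 => w [cw Ew].
  by have := distp_set_le_cell prectP Py cw Ew; rewrite leNgt il1.
have [Q [latQ freeQ largeQ liQ]] := largest_ge a_ge9 prectP Py cell_free.
by exists Q; split => //; exact: le_trans liQ.
Qed.

Lemma density_of_good_set (D : point -> R) (a : 'rV[R]_n) (s l h t c : R) (G : set point) :
  0 < l -> 0 < h -> measurable (sublevel D t : set ('rV[R]_n * measurableTypeR R)) ->
  measurable (G : set ('rV[R]_n * measurableTypeR R)) -> G `<=` box a s l h ->
  (forall z, G z -> t <= D z) -> ((c * (l ^+ n * h))%:E <= mu G)%E ->
  (mu (box a s l h `&` sublevel D t) <= ((1 - c) * (l ^+ n * h))%:E)%E.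
Proof.
move=> l0 h0 mS mG GB GD GV.
have mB : measurable (box a s l h : set ('rV[R]_n * measurableTypeR R)) by exact: measurable_box.
have HH : (mu (box a s l h `&` sublevel D t) + mu G <= (l ^+ n * h)%:E)%E.
  rewrite -measureU//; last 2 first.
  - exact: measurableI.
  - by rewrite -subset0 => z [[_ zS] /GD]; rewrite leNgt zS.
  rewrite -(@mu_box _ n a s _ _ (ltW l0) (ltW h0)).
  apply: le_measure; rewrite ?inE//.
    by apply: measurableU => //; exact: measurableI.
  by move=> z [[]|/GB].
have {}HH := le_trans (leeD2l _ GV) HH.
rewrite -leeBrDr// -EFinB in HH; apply: le_trans HH _.
by rewrite lee_fin; lra.
Qed.

Lemma porous_density (E : set point) (theta c delta : R) : E !=set0 -> 1 < theta ->
  porous_with p d theta c delta E ->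
  density_property p 2^-1 1 theta (c / 2) (porous_ratio theta delta) (distp_set p E).
Proof.
move=> E0 th [/andP[c0 c1] hd wp] a s l h y l0 /andP[h1 h2] ya yt.
have /andP[e0 e4] := porous_ratio_bounds th hd.
have lp0 : 0 < l `^ p by rewrite powR_gt0.
have h0 : 0 < h by apply: lt_le_trans h1; rewrite mulr_gt0.
have V0 : 0 <= l ^+ n * h by rewrite mulr_ge0 ?exprn_ge0// ltW.
rewrite mul1r in h2.
have mS t : measurable (sublevel (distp_set p E) t : set ('rV[R]_n * measurableTypeR R)).
  exact: measurable_distp_lt.
have Dy0 : 0 <= distp_set p E y by exact: distp_set_ge0.
(* If [D y] is large compared with the box, the whole box is far from [E]. Otherwise the side of the
   largest free cell of the translate is at least a fixed multiple of [D y]. *)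
have [far|near] := leP (2 * (theta + 1) * l) (distp_set p E y).
  apply: (@density_of_good_set _ _ _ _ _ _ _ (box a s l h)) => //.
  - exact: measurable_box.
  - move=> z zB; have h0l : 0 < h <= l `^ p by rewrite h0.
    apply: le_trans (far_point_distp E0 th l0 h0l ya yt far zB).
    by rewrite ler_wpM2r//; apply: le_trans e4 _; lra.
  - rewrite mu_box ?(ltW l0) ?(ltW h0)// lee_fin ler_piMl//; lra.
(* The truncation parameter 1 - h / l^p makes the height equal to [h]; it lies in [0, 1/2] because
   l^p / 2 <= h <= l^p. *)
pose P0 := PRect (\row_q (a ord0 q + l / 2)) (s + l `^ p) l (1 - h / l `^ p).
have prectP0 : is_prect P0.
  split => //=; have hl : h / l `^ p <= 1 by rewrite ler_pdivrMr// mul1r.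
  have hl' : 2^-1 <= h / l `^ p by rewrite ler_pdivlMr.
  by apply/andP; split; lra.
have ltP0 : l_t p P0 = h by rewrite /l_t /= subKr divfK// gt_eqF.
have lcP0 : low_corner P0 = a by apply/rowP => q; rewrite mxE /= mxE addrK.
have ltmP0 : low_time p P0 = s by rewrite /low_time /= addrK.
have rectP0 : rect p P0 = box a s l h by rewrite rect_box ltP0 lcP0 ltmP0.
pose P1 := Defs.shift p theta P0.
have prectP1 : is_prect P1 by [].
have P1y : rect p P1 y.
  have ltmP1 : low_time p P1 = s + theta * h by rewrite /low_time /= ltP0; ring.
  rewrite rect_box (_ : low_corner P1 = a)// ltmP1 (_ : l_t p P1 = h)//.
  split => //=; rewrite in_itv/=; case/andP: yt => ? ?; apply/andP; split; lra.
have [N [Pk [latP trivP freeP largeP sumP]]] := wp P0 prectP0.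
have sideP k : 0 < l_x (Pk k) /\ 2^-1 * l_x (Pk k) `^ p <= l_t p (Pk k) <= l_x (Pk k) `^ p.
  by have [] := lattice_box a_ge9 prectP0 (latP k).
have mI k : measurable (inner_box (Pk k) : set ('rV[R]_n * measurableTypeR R)).
  exact: measurable_box.
have IP k : inner_box (Pk k) `<=` rect p (Pk k).
  by have [? /andP[? _]] := sideP k; exact: inner_box_sub.
(* The good set consists of shrunken copies of the porous rectangles, which keep half of their
   measure; hence the proportion c / 2. *)
apply: (@density_of_good_set _ _ _ _ _ _ _ (\big[setU/set0]_(k < N) inner_box (Pk k))) => //.
- by apply: bigsetU_measurable.
- rewrite -bigcup_seq => z [k _ /IP]; rewrite -rectP0.
  exact: (lattice_sub a_ge9 prectP0 (latP k)).
- rewrite -bigcup_seq => z [k _ Ikz].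
  have [lk /andP[hk1 hk2]] := sideP k.
  apply: le_trans (distp_set_inner_box lk hk1 E0 (freeP k) Ikz).
  move: Dy0; rewrite le_eqVlt => /predU1P[<-|Dy0].
    by rewrite mulr0 mulr_ge0 ?(ltW lk)// divr_ge0// ltW// porous_margin_gt0.
  have near' : 0 < distp_set p E y < 2 * (theta + 1) * pr_L P1 by rewrite Dy0.
  have [Q [latQ largeQ DQ]] := largest_ge_distp th prectP1 P1y near'.
  have [lQ0 /andP[hQ1 hQ2] _] := lattice_box a_ge9 prectP1 latQ.
  have := largeP k; rewrite -/P1 largeQ (mu_lattice a_ge9 prectP1 latQ).
  rewrite (mu_lattice a_ge9 prectP0 (latP k)) -EFinM lee_fin => hPQ.
  have hk0 : 0 <= l_t p (Pk k) by apply: le_trans hk1; rewrite mulr_ge0 ?powR_ge0.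
  have lQ_le := side_le_of_measure lQ0 lk hd hQ1 hk2 hk0 hPQ.
  have /andP[d0 _] := hd.
  rewrite /porous_ratio -[leLHS]mulrA -[leLHS]mulrA ler_wpM2l ?divr_ge0 ?(ltW porous_margin_gt0)//.
  apply: le_trans lQ_le; rewrite ler_wpM2l ?divr_ge0 ?(ltW d0)//.
  by rewrite mulrC.
- have trivI : trivIset setT (fun k => inner_box (Pk k)).
    apply/trivIsetP => i j _ _ ij; have /trivIsetP/(_ i j Logic.I Logic.I ij) Pij := trivP.
    by rewrite -subset0 => z [/IP zi /IP zj]; rewrite -Pij.
  rewrite (measure_bigsetU_ord _ xpredT mI trivI).
  apply: (@le_trans _ _ (2^-1%:E * \sum_(k < N) mu (rect p (Pk k)))%E).
    rewrite mulrAC [X in X%:E]mulrC EFinM lee_pmul2l ?lte_fin ?invr_gt0//.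
    by move: sumP; rewrite rectP0 mu_box ?(ltW l0) ?(ltW h0).
  rewrite ge0_sume_distrr; last by move=> k _; exact: measure_ge0.
  apply: lee_sum => k _.
  by have [lk /andP[hk1 _]] := sideP k; exact: mu_inner_box.
Qed.

End porous_density.

(** * Decay for weakly porous sets *)

Lemma two_expn_ge {R : realType} (x : R) : exists k : nat, x <= 2 ^+ k.
Proof.
have [k /andP[kx _]] := @natr_ceil_exists _ `|x| (normr_ge0 x).
exists k; apply: le_trans (ler_norm x) _; apply: le_trans kx _.
by rewrite -natrX ler_nat ltnW// ltn_expl.
Qed.

Section decay.
Context {R : realType} {n : nat}.
Local Notation point := ('rV[R]_n * R)%type.
Local Notation mu := (@lebesgue_xt R n).

(** The height L^p / 2 is what the overshoots leave: the layers are cut at heights decreasing to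
    half that of the grid. *)
Definition decay_property (p lag M C v lam : R) (D : point -> R) : Prop :=
  forall (a : 'rV[R]_n) (s L : R) (y : point), 0 < L -> 0 < D y ->
  (forall q, a ord0 q - M * L <= y.1 ord0 q <= a ord0 q + M * L) ->
  s + lag * L `^ p <= y.2 <= s + M * L `^ p ->
  forall k : nat, (mu (box a s L (L `^ p / 2) `&` sublevel D (lam ^+ k * D y))
    <= (C * v ^+ k * (L ^+ n * L `^ p))%:E)%E.

(** [k0] makes the overshoot of layer k0 + 1 at most half the height, so the contraction can start
    there. Up to that layer the trivial bound is used, and the factor (1 - c / 2)^-(k0 + 1) absorbs
    it. *)
Lemma density_decay (p theta c e e' M A : R) (d k0 : nat) (D : point -> R) :
  1 < p -> 9 <= 2 `^ (d%:R * p) :> R -> (0 < d)%N ->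
  1 < theta -> 0 < c < 1 -> 0 < e <= 1 -> 0 < e' <= 1 ->
  (forall z, 0 <= D z) ->
  (forall t, measurable (sublevel D t : set ('rV[R]_n * measurableTypeR R))) ->
  (forall z w, D z <= D w + distp p z w) ->
  density_property p 2^-1 1 theta c e D -> chain_property p M 4^-1 e' D ->
  (2 ^ d)%:R <= M -> 2 * 2 `^ (d%:R * p) <= A ->
  (2 + theta + 2 * (2 + theta) / c + 1) * A <= M ->
  8 * (2 + theta + 2 * (2 + theta) / c) <= 2 ^+ k0 ->
  decay_property p (theta + 4) M ((1 - c / 2) ^- k0.+1) (1 - c / 2) (e * e') D.
Proof.
move=> hp a9 d0 th hc he he' D0 mD D_lip dD chD MN hA MW Wk0 a s L y0 L0 Dy0 y0x y0t k.
pose P := PRect (\row_q (a ord0 q + L / 2)) (s + L `^ p) L 0.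
have prectP : is_prect P by split => //=; rewrite lexx invr_ge0 ler0n.
have ltP : l_t p P = L `^ p by rewrite /l_t /= subr0 mul1r.
have Lp0 : 0 < L `^ p by rewrite powR_gt0.
have rA i : (gen_ntime p d P i)%:R <= A by apply: le_trans hA; exact: (gen_ntime_le a9 prectP).
have hb i : 2^-1 * grid_l d L i `^ p <= grid_h (L `^ p) (gen_count p d P) i <= grid_l d L i `^ p.
  by have := grid_height_bounds a9 prectP i; rewrite ltP.
have s4 : 0 < (4^-1 : R) <= 4^-1 by apply/andP; split; [rewrite invr_gt0 ltr0n|exact: lexx].
have decay := layers_decay L0 Lp0 (gen_count0 p d P) (gen_countS p d P) (gen_ntime_ge2 a9 prectP)
  rA d0 hb hp th hc he he' s4 D0 mD D_lip dD chD MN MW y0x y0t.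
have [v0 v1] : 0 < 1 - c / 2 /\ 1 - c / 2 <= 1.
  by case/andP: hc => c0 c1; split; lra.
have W0 : 0 <= 2 + theta + 2 * (2 + theta) / c.
  case/andP: hc => c0 c1; rewrite addr_ge0 ?divr_ge0 ?mulr_ge0 ?addr_ge0 ?(ltW c0)//; lra.
move: (1 - c / 2) v0 v1 decay => v v0 v1.
move: (2 + theta + 2 * (2 + theta) / c) Wk0 W0 => W Wk0 W0 decay.
have tk0 : L `^ p / 2 + 4 * W * L `^ p * 2^-1 ^+ k0.+1 <= L `^ p.
  have Wk : 4 * W * 2^-1 ^+ k0.+1 <= 2^-1.
    by rewrite exprVn ler_pdivrMr ?exprn_gt0// exprS; lra.
  have : 4 * W * 2^-1 ^+ k0.+1 * L `^ p <= 2^-1 * L `^ p by rewrite ler_wpM2r// ltW.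
  lra.
have LV : 0 <= L ^+ n * L `^ p by rewrite mulr_ge0 ?exprn_ge0// ltW.
have mBS : measurable (box a s L (L `^ p / 2) `&` sublevel D ((e * e') ^+ k * D y0)
   : set ('rV[R]_n * measurableTypeR R)).
  by apply: measurableI; [exact: measurable_box|exact: mD].
have vE : v ^- k0.+1 * v ^+ k = v ^+ k / v ^+ k0.+1 by rewrite mulrC.
rewrite vE; have [kk|kk] := leqP k k0.+1.
  apply: (@le_trans _ _ (L ^+ n * L `^ p)%:E); last first.
    rewrite lee_fin ler_peMl// ler_pdivlMr ?exprn_gt0// mul1r.
    by apply: ler_wiXn2l; rewrite ?(ltW v0).
  rewrite -(@mu_box _ n a s _ _ (ltW L0) (ltW Lp0)).
  apply: le_measure; rewrite ?inE//; first exact: measurable_box.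
  move=> z [[zx]]; rewrite /= in_itv/= => /andP[z1 z2] _; split => //=.
  by rewrite in_itv/= z1 (lt_le_trans z2)// lerD2l ler_pdivrMr// ler_peMr ?(ltW Lp0)// ler1n.
have {}decay := decay k0.+1 k isT tk0 (ltnW kk).
apply: le_trans (le_trans decay _); last first.
  by rewrite lee_fin -expfB// gt_eqF.
apply: le_measure; rewrite ?inE//.
  by apply: measurableI; [exact: measurable_box|exact: mD].
move=> z [[zx]]; rewrite /= in_itv/= => /andP[z1 z2] zD; split => //; split => //=.
rewrite in_itv/= z1/=; apply: lt_le_trans z2 _.
by rewrite lerD2l lerDl !mulr_ge0 ?(ltW Lp0)// exprn_ge0// invr_ge0 ler0n.
Qed.

Lemma decay_property_weaken (p lag M M' C v lam : R) (D : point -> R) : M <= M' ->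
  decay_property p lag M' C v lam D -> decay_property p lag M C v lam D.
Proof.
move=> MM' dD a s L y L0 Dy yx yt k.
have ML : M * L <= M' * L by rewrite ler_wpM2r// ltW.
have MLp : M * L `^ p <= M' * L `^ p by rewrite ler_wpM2r// powR_ge0.
apply: dD => // [q|].
  by have /andP[? ?] := yx q; apply/andP; split; lra.
by have /andP[? ?] := yt; apply/andP; split; lra.
Qed.

Lemma porous_chain (p theta c delta M : R) (d : nat) : (0 < n)%N -> 1 < p ->
  (0 < d)%N -> 9 <= 2 `^ (d%:R * p) :> R -> 1 < theta -> 0 < c < 1 -> 0 < delta < 1 -> 0 < M ->
  exists e' : R, 0 < e' <= 1 /\ forall E : set point, E !=set0 ->
    porous_with p d theta c delta E -> chain_property p M 4^-1 e' (distp_set p E).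
Proof.
move=> n0 hp d0 a9 th hc hd M0.
have /andP[c0 c1] := hc.
have nR : 1 <= n%:R :> R by rewrite ler1n.
have [e0 e1] : 0 < @porous_ratio R n d theta delta /\ @porous_ratio R n d theta delta <= 1.
  by have /andP[e0 e4] := @porous_ratio_bounds R n d theta delta th hd; split => //; lra.
have he : 0 < @porous_ratio R n d theta delta <= 1 by rewrite e0.
have hc2 : 0 < c / 2 < 1 by apply/andP; split; lra.
have hnu : 0 < c / 2 / (8 * n%:R) <= 4^-1.
  apply/andP; split; first by rewrite !divr_gt0// mulr_gt0//; lra.
  by rewrite ler_pdivrMr; lra.
have [|e' [e'01 chain]] := @chain_lemma R n p 1 theta (c / 2 / (8 * n%:R)) _ M 4^-1
  hp ltr01 th hnu he M0; first by rewrite invr_gt0.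
exists e'; split => // E E0 porousE; apply: chain.
  by move=> z; exact: distp_set_ge0.
apply: (density_step n0 hc2 ltr01 _ _ (porous_density hp a9 d0 E0 th porousE)).
  by rewrite lexx andbT; lra.
by move=> r; exact: measurable_distp_lt.
Qed.

Lemma porous_decay (p theta c delta M0 : R) (d : nat) : (0 < n)%N -> 1 < p ->
  (0 < d)%N -> 9 <= 2 `^ (d%:R * p) :> R -> 1 < theta -> 0 < c < 1 -> 0 < delta < 1 ->
  exists C v lam, [/\ 0 < C, 0 < v < 1, 0 < lam < 1 &
    forall E : set point, E !=set0 -> porous_with p d theta c delta E ->
    decay_property p (theta + 4) M0 C v lam (distp_set p E)].
Proof.
move=> n0 hp d0 a9 th hc hd.
have /andP[e0 e4] := @porous_ratio_bounds R n d theta delta th hd.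
have he : 0 < @porous_ratio R n d theta delta <= 1 by rewrite e0; lra.
have hc2 : 0 < c / 2 < 1 by case/andP: hc => c0 c1; apply/andP; split; lra.
pose A : R := 2 * 2 `^ (d%:R * p).
pose W : R := 2 + theta + 2 * (2 + theta) / (c / 2).
(* [M0] is what the later use asks for; the other two terms let chains reach across a parent cell
   and across the future of a selected cell. *)
pose M := Num.max M0 (Num.max (2 ^ d)%:R ((W + 1) * A)).
have MM0 : M0 <= M by rewrite le_max lexx.
have MN : (2 ^ d)%:R <= M by rewrite !le_max lexx orbT.
have MW : (W + 1) * A <= M by rewrite !le_max lexx !orbT.
have M_gt0 : 0 < M by apply: lt_le_trans MN; rewrite ltr0n expn_gt0.
have [e' [e'01 chain]] := porous_chain n0 hp d0 a9 th hc hd M_gt0.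
have [k0 Wk0] := two_expn_ge (8 * W).
have v0 : 0 < 1 - c / 2 / 2 < 1 by case/andP: hc2 => c0 c1; apply/andP; split; lra.
exists ((1 - c / 2 / 2) ^- k0.+1), (1 - c / 2 / 2), (@porous_ratio R n d theta delta * e').
split => //.
- by rewrite invr_gt0 exprn_gt0//; case/andP: v0.
- case/andP: e'01 => e'0 e'1; rewrite mulr_gt0//=.
  apply: (@le_lt_trans _ _ (@porous_ratio R n d theta delta)); last lra.
  by rewrite ler_piMr// ltW.
move=> E E0 porousE; apply: (decay_property_weaken MM0).
apply: (@density_decay p theta (c / 2) _ e' M A d k0) => //.
- by move=> z; exact: distp_set_ge0.
- by move=> t; exact: measurable_distp_lt.
- by move=> z w; exact: distp_set_lipschitz.
- exact: porous_density porousE.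
- exact: chain.
Qed.

Lemma cover_ratio (a : 'rV[R]_n) (s L H tau : R) (j N : nat) (X : set point) :
  0 < L -> 0 < H -> (0 < N)%N -> 0 <= tau ->
  measurable (X : set ('rV[R]_n * measurableTypeR R)) ->
  (forall (b : 'rV[R]_n) (s' : R), (forall q, a ord0 q <= b ord0 q < a ord0 q + L) -> s <= s' < s + H ->
    (mu (X `&` box b s' (L / (2 ^ j)%:R) (H / N%:R)) <=
      (tau * ((L / (2 ^ j)%:R) ^+ n * (H / N%:R)))%:E)%E) ->
  (mu (X `&` box a s L H) <= (tau * (L ^+ n * H))%:E)%E.
Proof.
move=> L0 H0 N0 tau0 mX small.
(* Only generations 0 and 1 of this grid are used: the whole box, and its subdivision into 2^j
   pieces per spatial edge and [N] in time. *)
pose K i := if i is 0 then 1%N else N.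
pose r i := if i is 0 then N else 1%N.
have K0 : K 0 = 1%N by [].
have KS i : K i.+1 = (K i * r i)%N by case: i => [|i] /=; rewrite ?mul1n ?muln1.
have r0 i : (0 < r i)%N by case: i.
have l1 : grid_l j L 1 = L / (2 ^ j)%:R by rewrite /grid_l muln1.
have h1 : grid_h H K 1 = H / N%:R by [].
rewrite EFinM -(@mu_box _ n a s) ?(ltW L0) ?(ltW H0)//.
apply: (@union_of_cells_ratio _ n j a s L H K r L0 H0 K0 KS r0 1) => //.
- by move=> z Bz; exact: (grid_cell_sub L0 H0 K0 KS r0).
- move=> z Bz; rewrite (mu_grid_cell _ _ _ L0 H0 K0 KS r0) -EFinM l1 h1.
  pose cx : 'rV[R]_n := \row_q (a ord0 q + (grid_j j a L 1 z q)%:R * grid_l j L 1).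
  pose ct : R := s + (grid_k s H K 1 z)%:R * grid_h H K 1.
  have [cxB ctB] : box a s L H (cx, ct).
    apply: (grid_cell_sub (d := j) L0 H0 K0 KS r0 (i := 1) Bz).
    have l0 := grid_l_gt0 j L0 1; have h0 := grid_h_gt0 H0 K0 KS r0 1.
    by split => [q|]; rewrite /= ?in_itv/= lexx ltrDl.
  rewrite /grid_cell /grid_box -/cx -/ct l1 h1; apply: small => [q|]; first exact: cxB.
  by move: ctB; rewrite /= in_itv.
Qed.

End decay.

(** * Integrals of negative powers of the distance *)

Section powers.
Context {R : realType}.

Lemma powR_exprn (x a : R) (k : nat) : 0 <= x -> (x ^+ k) `^ a = (x `^ a) ^+ k.
Proof. by move=> x0; rewrite -powR_mulrn// powRAC powR_mulrn// powR_ge0. Qed.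

Lemma powRN_anti (a x y : R) : 0 <= a -> 0 < x -> x <= y -> y `^ (- a) <= x `^ (- a).
Proof.
move=> a0 x0 xy; rewrite !powRN lef_pV2 ?posrE ?powR_gt0 ?(lt_le_trans x0)//.
by apply: powR_leW => //; exact: ltW.
Qed.

Lemma expr_lt_exists (lam eps : R) : 0 < lam < 1 -> 0 < eps -> exists k : nat, lam ^+ k < eps.
Proof.
move=> /andP[l0 l1] e0; have : `|lam| < 1 by rewrite ger0_norm// ltW.
move=> /cvg_expr/cvgr_dist_lt/(_ eps e0)[N _ /(_ N (leqnn _))] /=.
by rewrite sub0r normrN ger0_norm ?exprn_ge0 ?(ltW l0)// => H; exists N.
Qed.

Lemma powR_solve (lam u : R) : 0 < lam < 1 -> 0 < u < 1 -> exists2 a : R, 0 < a & lam `^ a = u.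
Proof.
move=> hl hu; have /andP[l0 _] := hl; have /andP[u0 _] := hu.
have lnl : ln lam < 0 by exact: ln_lt0.
have lnu : ln u < 0 by exact: ln_lt0.
exists (ln u / ln lam); first by rewrite nmulr_rgt0// invr_lt0.
by rewrite /powR gt_eqF// divfK ?lt_eqF// lnK.
Qed.

End powers.

Section weight.
Context {R : realType} {n : nat}.
Local Notation point := ('rV[R]_n * R)%type.
Local Notation mpoint := ('rV[R]_n * measurableTypeR R)%type.
Local Notation mu := (@lebesgue_xt R n).
Variables (p : R) (E : set point).
Hypotheses (hp : 1 < p) (E0 : E !=set0).
Local Notation D := (distp_set p E).
Local Notation w := (dist_weight p E).

Lemma measurable_distp_set : measurable_fun [set: mpoint] (D : mpoint -> R).
Proof.
move=> mT; apply: (measurability _ (RGenInftyO.measurableE R)) => //.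
move=> _ [_ [r ->] <-]; rewrite setTI preimage_itvNyo.
exact: measurable_distp_lt.
Qed.

Lemma measurable_dist_weight (a : R) : measurable_fun [set: mpoint] (w a : mpoint -> \bar R).
Proof.
apply: measurable_fun_ifT.
- apply: (measurable_fun_bool true); rewrite setTI.
  rewrite (_ : _ @^-1` _ = (D : mpoint -> R) @^-1` [set 0]).
    by rewrite -[X in measurable X]setTI; apply: measurable_distp_set.
  by apply/seteqP; split => z /= /eqP.
- exact: measurable_cst.
- apply/measurable_EFinP.
  apply: (measurableT_comp (f := fun x : R => x `^ (- a)) (g := D : mpoint -> R)).
    exact: measurable_powR.
  exact: measurable_distp_set.
Qed.

Lemma dist_weight_ge0 (a : R) z : (0 <= w a z)%E.
Proof. by rewrite /dist_weight; case: ifP => // _; rewrite lee_fin powR_ge0. Qed.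

Lemma dist_weight_ge (a r : R) z : 0 < a -> 0 < r -> D z < r -> ((r `^ (- a))%:E <= w a z)%E.
Proof.
move=> a0 r0 zr; rewrite /dist_weight; case: eqP => [//|/eqP Dz]; first by rewrite leey.
have D0 : 0 < D z by rewrite lt_neqAle eq_sym Dz distp_set_ge0.
by rewrite lee_fin; apply: powRN_anti => //; exact: ltW.
Qed.

Lemma dist_weight_le (a r : R) z : 0 < a -> 0 < r -> r <= D z -> (w a z <= (r `^ (- a))%:E)%E.
Proof.
move=> a0 r0 rz; rewrite /dist_weight gt_eqF; last exact: lt_le_trans rz.
by rewrite lee_fin; apply: powRN_anti => //; exact: ltW.
Qed.

(** * Layer-cake bound for the weight *)

Section layer_cake.
Variables (a lam u rho : R).
Hypotheses (a_gt0 : 0 < a) (lam01 : 0 < lam < 1) (u_eq : lam `^ a = u) (rho_gt0 : 0 < rho).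

Let c0 := rho `^ (- a).
Let c0_gt0 : 0 < c0. Proof. exact: powR_gt0. Qed.
Let lam_gt0 : 0 < lam. Proof. by case/andP: lam01. Qed.
Let u_gt0 : 0 < u. Proof. by rewrite -u_eq powR_gt0. Qed.
Let u_le1 : u <= 1.
Proof.
case/andP: lam01 => l0 l1; have := powR_leW (ltW a_gt0) (ltW l0) (ltW l1).
by rewrite powR1 u_eq.
Qed.

(** Where lam^(k + 1) * rho <= D < lam^k * rho, the weight is at most c0 * u^-(k + 1). The indicator
    is that of the whole sublevel set, which is what the decay controls. *)
Let f (k : nat) (z : point) : R := c0 * u ^- k.+1 * \1_(sublevel D (lam ^+ k * rho)) z.

Let f_ge0 k z : 0 <= f k z.
Proof. by rewrite /f !mulr_ge0 ?(ltW c0_gt0) ?invr_ge0 ?exprn_ge0 ?(ltW u_gt0). Qed.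

Let f_le_series (k : nat) z : ((f k z)%:E <= \sum_(i <oo) (f i z)%:E)%E.
Proof.
have pos i : (0 <= i)%N -> true -> (0 <= (f i z)%:E)%E by move=> _ _; rewrite lee_fin f_ge0.
apply: le_trans (nneseries_lim_ge k.+1 pos).
by rewrite big_mkord big_ord_recr/= leeDr// sume_ge0// => i _; rewrite lee_fin f_ge0.
Qed.

Lemma dist_weight_le_series z : (w a z <= c0%:E + \sum_(k <oo) (f k z)%:E)%E.
Proof.
have pos i : (0 <= i)%N -> true -> (0 <= (f i z)%:E)%E by move=> _ _; rewrite lee_fin f_ge0.
have sum_ge0 : (0 <= \sum_(k <oo) (f k z)%:E)%E by apply: nneseries_ge0.
have [far|near] := leP rho (D z).
  by apply: le_trans (dist_weight_le a_gt0 rho_gt0 far) _; rewrite leeDl.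
have D0 := distp_set_ge0 p E z.
have [Dz|Dz] := eqVneq (D z) 0.
  (* The weight is +oo here, but every term of the series is at least c0, so the series is +oo
     too. *)
  suff -> : (\sum_(k <oo) (f k z)%:E = +oo)%E by rewrite addey// leey.
  apply/eqyP => r r0.
  have [N /andP[Nr _]] := @natr_ceil_exists _ (r / c0) ltac:(by rewrite divr_ge0// ltW).
  apply: le_trans (nneseries_lim_ge N pos); rewrite sumEFin lee_fin.
  apply: (@le_trans _ _ (\sum_(0 <= i < N) c0)).
    by rewrite sumr_const_nat subn0 -mulr_natl -ler_pdivrMr.
  apply: ler_sum => i _; rewrite /f.
  have -> : \1_(sublevel D (lam ^+ i * rho)) z = 1 :> R.
    by rewrite indicE mem_set// /sublevel/= Dz mulr_gt0// exprn_gt0.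
  by rewrite mulr1 ler_peMr ?(ltW c0_gt0)// invf_ge1 ?exprn_gt0// exprn_ile1// ltW//.
have {}D0 : 0 < D z by rewrite lt_neqAle eq_sym Dz.
have ex : exists k, lam ^+ k * rho <= D z.
  have [k kD] := expr_lt_exists lam01 (divr_gt0 D0 rho_gt0).
  by exists k; rewrite -ler_pdivlMr// ltW.
case: (ex_minnP ex) => -[|k] kD kmin; first by move: kD; rewrite expr0 mul1r leNgt near.
have Dk : D z < lam ^+ k * rho by rewrite ltNge; apply/negP => /kmin; rewrite ltnn.
apply: (@le_trans _ _ (f k z)%:E); last first.
  by apply: le_trans (f_le_series k z) _; rewrite leeDr// lee_fin ltW.
have lr0 : 0 < lam ^+ k.+1 * rho by rewrite mulr_gt0// exprn_gt0.
apply: le_trans (dist_weight_le a_gt0 lr0 kD) _.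
rewrite lee_fin /f indicE mem_set// mulr1.
by rewrite powRM ?exprn_ge0 ?(ltW lam_gt0) ?(ltW rho_gt0)// powRN powR_exprn ?(ltW lam_gt0)// u_eq mulrC.
Qed.

(** Decay at rate u^2 against the growth u^-(k + 1) of the weight leaves a geometric series of ratio
    [u]. *)
Lemma integral_dist_weight_le (B : set point) (V C : R) :
  measurable (B : set mpoint) -> 0 <= V -> (mu B <= V%:E)%E -> u < 1 -> 0 <= C ->
  (forall k, (mu (B `&` sublevel D (lam ^+ k * rho)) <= (C * (u ^+ 2) ^+ k * V)%:E)%E) ->
  (\int[mu]_(z in B) w a z <= (c0 * (1 + C / (u * (1 - u))) * V)%:E)%E.
Proof.
move=> mB V0 BV u1 C0 BC.
have mS k : measurable (sublevel D (lam ^+ k * rho) : set mpoint) by exact: measurable_distp_lt.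
have mf k : measurable_fun (B : set mpoint) (fun z : mpoint => (f k z)%:E).
  apply/measurable_EFinP; apply: measurable_funM; first exact: measurable_cst.
  exact: measurable_indic.
have f0 k z : (0 <= (f k z)%:E)%E by rewrite lee_fin.
have S0 z : (0 <= \sum_(k <oo) (f k z)%:E)%E by apply: nneseries_ge0.
apply: (@le_trans _ _ (\int[mu]_(z in B) (c0%:E + \sum_(k <oo) (f k z)%:E))%E).
  apply: ge0_le_integral => //.
  - by move=> z _; exact: dist_weight_ge0.
  - by apply: measurable_funTS; exact: measurable_dist_weight.
  - apply: emeasurable_funD; first exact: measurable_cst.
    by apply: ge0_emeasurable_sum => // k z _ _; exact: f0.
  - by move=> z _; exact: dist_weight_le_series.
rewrite ge0_integralD//; last 2 first.
- by move=> z _; rewrite lee_fin ltW.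
- by apply: ge0_emeasurable_sum => // k z _ _; exact: f0.
rewrite integral_cst// integral_nneseries//.
have fk k : (\int[mu]_(z in B) (f k z)%:E <= (c0 * C * V / u * u ^+ k)%:E)%E.
  have ck0 : 0 <= c0 * u ^- k.+1 by rewrite mulr_ge0 ?(ltW c0_gt0)// invr_ge0 exprn_ge0// ltW.
  rewrite /f; under eq_integral do rewrite EFinM.
  rewrite ge0_integralZl_EFin//; last first.
    by apply/measurable_EFinP; exact: measurable_indic.
  rewrite integral_indic// setIC.
  apply: (@le_trans _ _ ((c0 * u ^- k.+1)%:E * (C * (u ^+ 2) ^+ k * V)%:E)%E).
    by apply: lee_wpmul2l; rewrite ?lee_fin.
  rewrite -EFinM lee_fin [X in X <= _](_ : _ = c0 * C * V / u * u ^+ k)//.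
  rewrite -exprM mulnC exprM [u ^+ k.+1]exprS; field.
  by rewrite (gt_eqF u_gt0) expf_neq0 ?gt_eqF.
apply: (@le_trans _ _ (c0%:E * V%:E + (c0 * C * V / u * (1 - u)^-1)%:E)%E).
  apply: leeD; first by apply: lee_wpmul2l; rewrite ?lee_fin// ltW.
  apply: lime_le.
    by apply: is_cvg_nneseries => k _ _; apply: integral_ge0 => z _; exact: f0.
  apply: nearW => N.
  apply: (@le_trans _ _ (\sum_(0 <= k < N) (c0 * C * V / u * u ^+ k)%:E)%E).
    by apply: lee_sum => k _; exact: fk.
  rewrite sumEFin lee_fin; apply: le_trans (geometric_le_lim N (a := c0 * C * V / u) _ u_gt0 _).
  - by [].
  - by rewrite !mulr_ge0 ?invr_ge0 ?(ltW c0_gt0) ?(ltW u_gt0).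
  - by rewrite ger0_norm// ltW.
rewrite -EFinM -EFinD lee_fin [X in X <= _](_ : _ = c0 * (1 + C / (u * (1 - u))) * V)//.
by field; rewrite subr_eq0 eq_sym (lt_eqF u1) gt_eqF.
Qed.

End layer_cake.
End weight.

(** * From decay to the Muckenhoupt condition *)

Lemma powR_natM_div {R : realType} (p L : R) (N : nat) : 0 <= L -> (0 < N)%N ->
  N%:R `^ p * (L / N%:R) `^ p = L `^ p.
Proof.
move=> L0 N0; rewrite -powRM ?divr_ge0// mulrCA mulfV ?mulr1//.
by rewrite pnatr_eq0 -lt0n.
Qed.

Section halves.
Context {R : realType} {n : nat}.
Local Notation point := ('rV[R]_n * R)%type.
Local Notation mpoint := ('rV[R]_n * measurableTypeR R)%type.
Local Notation mu := (@lebesgue_xt R n).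
Variables (p gamma : R).
Hypotheses (hp : 1 < p) (hg : 0 < gamma < 1).

Definition cube_corner (x : 'rV[R]_n) (L : R) : 'rV[R]_n := \row_q (x ord0 q - L / 2).

Lemma cube_cornerE x L : cube x L =
  [set y : 'rV[R]_n | forall q, cube_corner x L ord0 q <= y ord0 q < cube_corner x L ord0 q + L].
Proof.
apply/seteqP; split => y yx q; have /andP[? ?] := yx q.
  by rewrite mxE; apply/andP; split; lra.
by move: (yx q); rewrite mxE => /andP[? ?]; apply/andP; split; lra.
Qed.

Lemma measurable_Rminus x t L : measurable (Rminus p gamma x t L : set mpoint).
Proof. by rewrite /Rminus cube_cornerE; exact: measurable_slab. Qed.

Lemma mu_Rminus x t L : 0 < L -> mu (Rminus p gamma x t L) = (L ^+ n * ((1 - gamma) * L `^ p))%:E.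
Proof.
move=> L0; rewrite /Rminus cube_cornerE mu_slab ?(ltW L0)// lebesgue_measure_itv /= lte_fin.
have Lp0 : 0 < L `^ p by rewrite powR_gt0.
have gL : 0 < (1 - gamma) * L `^ p by rewrite mulr_gt0// subr_gt0; case/andP: hg.
rewrite ifT; last lra.
by rewrite -EFinB -EFinM; congr EFin; ring.
Qed.

(** [Rminus] with its lower face added, a null set, so that grids can subdivide it as a half-open
    box. *)
Definition past_box (x : 'rV[R]_n) (t L : R) : set point :=
  box (cube_corner x L) (t - L `^ p) L ((1 - gamma) * L `^ p).

Lemma Rminus_sub_past_box x t L : Rminus p gamma x t L `<=` past_box x t L.
Proof.
move=> z []; rewrite cube_cornerE /= in_itv/= => zx /andP[z1 z2]; split => //=.
by rewrite in_itv/=; apply/andP; split; lra.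
Qed.

(** The gap 2 * gamma * L^p between the two halves may be shorter than the lag of the decay. The box
    is therefore cut into boxes of side l = L / 2^j, for which lag * l^p fits into the gap, and into
    enough time pieces for each to have height at most l^p / 2. *)
Lemma decay_past_box (lag C v lam : R) (j N : nat) (D : point -> R) :
  0 <= C -> 0 <= v ->
  (forall r, measurable (sublevel D r : set mpoint)) ->
  lag <= 2 * gamma * (2 ^ j)%:R `^ p -> 2 * (1 - gamma) * (2 ^ j)%:R `^ p <= N%:R ->
  decay_property p lag (2 * (2 ^ j)%:R `^ p) C v lam D ->
  forall x t L y, 0 < L -> Rplus p gamma x t L y -> 0 < D y -> forall k,
  (mu (sublevel D (lam ^+ k * D y) `&` past_box x t L) <=
   (C * (N%:R / ((1 - gamma) * (2 ^ j)%:R `^ p)) * v ^+ k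
     * (L ^+ n * ((1 - gamma) * L `^ p)))%:E)%E.
Proof.
move=> C0 v0 mD lagj jN dD x t L y L0 [yx yt] Dy k.
have [g0 g1] := andP hg; rewrite cube_cornerE in yx; rewrite /= in_itv/= in yt.
have J1 : 1 <= (2 ^ j)%:R :> R by rewrite ler1n expn_gt0.
have J0 : 0 < (2 ^ j)%:R :> R by lra.
have l0 : 0 < L / (2 ^ j)%:R by rewrite divr_gt0.
have LE : L = (2 ^ j)%:R * (L / (2 ^ j)%:R) by rewrite mulrCA mulfV ?mulr1// gt_eqF.
have LpE := powR_natM_div p (ltW L0) (expn_gt0 2 j : (0 < 2 ^ j)%N).
have Jp : (2 ^ j)%:R <= (2 ^ j)%:R `^ p :> R by apply: le1r_powR => //; exact: ltW.
have Lp0 : 0 < L `^ p by rewrite powR_gt0.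
have lp0 : 0 < (L / (2 ^ j)%:R) `^ p by rewrite powR_gt0.
have g10 : 0 < 1 - gamma by lra.
have N0 : 0 < N%:R :> R by apply: lt_le_trans jN; rewrite !mulr_gt0 ?powR_gt0.
have h0 : 0 < (1 - gamma) * L `^ p by rewrite mulr_gt0.
apply: (@cover_ratio _ n _ _ _ _ _ j N) => //; first by rewrite -(ltr_nat R).
  apply: mulr_ge0; last exact: exprn_ge0.
  apply: mulr_ge0 => //; apply: divr_ge0; first exact: ler0n.
  by rewrite mulr_ge0 ?powR_ge0// ltW.
move=> b s' bx /andP[s1 s2].
move: l0 LE LpE lp0 dD; set l := L / (2 ^ j)%:R => l0 LE LpE lp0 dD.
move: Jp lagj jN LpE dD; set J := (2 ^ j)%:R `^ p => Jp lagj jN LpE dD.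
have Jpos : 0 < J by lra.
have hl : (1 - gamma) * L `^ p / N%:R <= l `^ p / 2.
  rewrite ler_pdivrMr// -LpE.
  have : 2 * (1 - gamma) * J * l `^ p <= N%:R * l `^ p by rewrite ler_wpM2r// ltW.
  lra.
apply: (@le_trans _ _ (mu (box b s' l (l `^ p / 2) `&` sublevel D (lam ^+ k * D y)))).
  apply: le_measure; rewrite ?inE.
  - by apply: measurableI; [exact: mD|exact: measurable_box].
  - by apply: measurableI; [exact: measurable_box|exact: mD].
  - move=> z [zD [zx]]; rewrite /= in_itv/= => /andP[z1 z2]; split => //; split => //=.
    by rewrite in_itv/= z1 (lt_le_trans z2)// lerD2l.
apply: le_trans (dD b s' l y l0 Dy _ _ k) _.
- have Jl : (2 ^ j)%:R * l <= 2 * J * l by rewrite ler_wpM2r ?(ltW l0)//; lra.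
  move=> q; have /andP[? ?] := bx q; have /andP[? ?] := yx q.
  by rewrite -LE in Jl; apply/andP; split; lra.
- move/andP: yt => [y1 y2].
  have lagl : lag * l `^ p <= 2 * (gamma * L `^ p).
    rewrite -LpE [leRHS](_ : _ = 2 * gamma * J * l `^ p); last ring.
    by rewrite ler_wpM2r// ltW.
  by apply/andP; split; lra.
- rewrite lee_fin [X in X <= _](_ : _ = C * (N%:R / ((1 - gamma) * J)) * v ^+ k *
     (l ^+ n * ((1 - gamma) * L `^ p / N%:R)))//.
  by rewrite -LpE; field; rewrite !gt_eqF.
Qed.

Lemma compact_sub_past_box (K : set point) : compact K -> exists t L,
  0 < L /\ K `<=` past_box 0 t L.
Proof.
move=> /compact_bounded [B [_ BK]]; have [g0 g1] := andP hg.
pose M := `|B| + 1.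
have M1 : 1 <= M by rewrite lerDr.
have KM z : K z -> `|z.1| <= M /\ `|z.2| <= M.
  move=> Kz; have /= H : (`|z| <= M)%R.
    by apply: BK Kz; rewrite (le_lt_trans (ler_norm _))// ltrDl.
  by rewrite prod_normE ge_max in H; apply/andP.
have L1 : 2 * M + 2 <= (2 * M + 2) / (1 - gamma).
  by rewrite ler_pdivlMr; [rewrite ler_piMr|]; lra.
exists (((2 * M + 2) / (1 - gamma)) `^ p - M), ((2 * M + 2) / (1 - gamma)).
have L0 : 0 < (2 * M + 2) / (1 - gamma) by lra.
split => //.
have LLp : 2 * M + 2 <= (1 - gamma) * ((2 * M + 2) / (1 - gamma)) `^ p.
  apply: (@le_trans _ _ ((1 - gamma) * ((2 * M + 2) / (1 - gamma)))).
    by rewrite mulrCA mulfV ?mulr1// gt_eqF//; lra.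
  rewrite ler_wpM2l//; first lra.
  by apply: le1r_powR; [lra|exact: ltW].
move=> z /KM[z1 z2]; split => [q|] /=; last first.
  by rewrite in_itv/=; move: z2; rewrite ler_norml => /andP[? ?]; apply/andP; split; lra.
have := le_trans (rV_coord_le z.1 q) z1; rewrite ler_norml !mxE => /andP[? ?].
by apply/andP; split; lra.
Qed.

Lemma Rplus_box x t L : 0 < L -> exists (a : 'rV[R]_n) (s l : R),
  0 < l /\ box a s l (l `^ p) `<=` Rplus p gamma x t L.
Proof.
move=> L0; have [g0 g1] := andP hg.
have Lp0 : 0 < L `^ p by rewrite powR_gt0.
have r0 : 0 < (1 - gamma) / 4 by lra.
have r1 : (1 - gamma) / 4 <= 1 by lra.
have l0 : 0 < (1 - gamma) / 4 * L by rewrite mulr_gt0.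
have lL : (1 - gamma) / 4 * L <= L by rewrite ler_piMl// ltW.
have lp : ((1 - gamma) / 4 * L) `^ p <= (1 - gamma) / 4 * L `^ p.
  rewrite powRM ?(ltW L0) ?(ltW r0)// ler_wpM2r ?(ltW Lp0)//.
  by apply: ge1r_powR; [rewrite r0|exact: ltW].
have gLp : 0 < (1 - gamma) * L `^ p by rewrite mulr_gt0//; lra.
exists (cube_corner x L), (t + gamma * L `^ p + (1 - gamma) / 4 * L `^ p), ((1 - gamma) / 4 * L).
split => // z [zx]; rewrite /= in_itv/= => /andP[z1 z2]; split.
  by rewrite cube_cornerE => q; have /andP[? ?] := zx q; apply/andP; split; lra.
by rewrite /= in_itv/=; apply/andP; split; lra.
Qed.

(** For local integrability, a compact set is put into a past box, and a hole in the corresponding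
    forward half supplies a [y] with D y > 0. For the Muckenhoupt inequality, the bound holds at
    every [y] of the forward half, trivially where the weight is +oo, and so passes to the essential
    infimum. *)
Lemma A1plus_of_integral_bound (E : set point) (a K : R) : E !=set0 -> 0 < a -> 0 < K ->
  (forall (a : 'rV[R]_n) (s l : R), 0 < l -> exists z, box a s l (l `^ p) z /\ 0 < distp_set p E z) ->
  (forall x t L y, 0 < L -> Rplus p gamma x t L y -> 0 < distp_set p E y ->
    (\int[mu]_(z in past_box x t L) dist_weight p E a z <=
     (distp_set p E y `^ (- a) * K * (L ^+ n * ((1 - gamma) * L `^ p)))%:E)%E) ->
  A1plus p gamma K (dist_weight p E a).
Proof.
move=> E0 a0 K0 holes bound; have [g0 g1] := andP hg.
have w0 z : (0 <= dist_weight p E a z)%E by exact: dist_weight_ge0.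
have mw : measurable_fun [set: mpoint] (dist_weight p E a : mpoint -> \bar R).
  exact: measurable_dist_weight.
split => //.
  move=> X cX; apply/integrableP; split; first by apply: measurable_funTS.
  have mX : measurable (X : set mpoint).
    rewrite -[X]setCK; apply: measurableC; apply: open_measurable_xt; apply: closed_openC.
    by apply: compact_closed cX; exact: norm_hausdorff.
  have [t [L [L0 XB]]] := compact_sub_past_box cX.
  have [b [s [l [l0 bR]]]] := Rplus_box 0 t L0.
  have [y [/bR Ry Dy]] := holes b s l l0.
  under eq_integral do rewrite gee0_abs//.
  apply: (@le_lt_trans _ _ (\int[mu]_(z in past_box 0 t L) dist_weight p E a z)%E).
    apply: ge0_subset_integral => //; first exact: measurable_box.
    by apply: measurable_funTS.
  by apply: le_lt_trans (bound _ _ _ _ L0 Ry Dy) _; rewrite ltry.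
move=> x t L L0.
have V0 : 0 < L ^+ n * ((1 - gamma) * L `^ p).
  by rewrite !mulr_gt0 ?exprn_gt0 ?powR_gt0 ?subr_gt0.
rewrite mu_Rminus// inver gt_eqF//.
set V := L ^+ n * _ in V0 *.
set I := (\int[mu]_(z in _) _)%E.
have I0 : (0 <= I)%E by apply: integral_ge0 => z _.
have Iw y : Rplus p gamma x t L y -> (I <= (K * V)%:E * dist_weight p E a y)%E.
  move=> Ry; have [Dy|Dy] := eqVneq (distp_set p E y) 0.
    by rewrite /dist_weight Dy eqxx gt0_muley ?leey// lte_fin mulr_gt0.
  have {}Dy : 0 < distp_set p E y by rewrite lt_neqAle eq_sym Dy distp_set_ge0.
  apply: (@le_trans _ _ (\int[mu]_(z in past_box x t L) dist_weight p E a z)%E).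
    apply: ge0_subset_integral => //.
    - exact: measurable_Rminus.
    - exact: measurable_box.
    - by apply: measurable_funTS.
    - exact: Rminus_sub_past_box.
  apply: le_trans (bound _ _ _ _ L0 Ry Dy) _.
  rewrite /dist_weight gt_eqF// -EFinM lee_fin -/V.
  by rewrite [leLHS](_ : _ = K * V * distp_set p E y `^ (- a))//; ring.
have KV : K * V != 0 by rewrite gt_eqF// mulr_gt0.
have ess : (((K * V)^-1)%:E * I <= ess_inf_on (Rplus p gamma x t L) (dist_weight p E a))%E.
  apply/ess_infP; apply: nearW => z; rewrite /patch; case: ifP => [|_]; last by rewrite leey.
  rewrite inE => /Iw; rewrite -(@lee_pmul2l _ (K * V)^-1%:E)//; last first.
    by rewrite lte_fin invr_gt0 mulr_gt0.
  by rewrite muleA -EFinM mulVf// mul1e.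
rewrite -(@lee_pmul2l _ K%:E) ?lte_fin// in ess; apply: le_trans ess.
rewrite muleA -EFinM (_ : K * (K * V)^-1 = V^-1)//.
by field; rewrite !gt_eqF.
Qed.

(** [M] is quantified before the decay constants because these are only obtained once [M] is fixed.
    The exponent solves lam^a = sqrt v, so that half of the decay remains for the summation. *)
Lemma decay_A1plus (lag : R) : exists M, forall C v lam, 0 < C -> 0 < v < 1 -> 0 < lam < 1 ->
  exists beta K, [/\ 0 < beta, 0 < K & forall E : set point, E !=set0 ->
    (forall (a : 'rV[R]_n) (s l : R), 0 < l -> exists z, box a s l (l `^ p) z /\ 0 < distp_set p E z) ->
    decay_property p lag M C v lam (distp_set p E) ->
    A1plus_with p gamma beta K E].
Proof.
have [g0 g1] := andP hg.
have [j jlag] := two_expn_ge (lag / (2 * gamma)).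
have J1 : 1 <= (2 ^ j)%:R :> R by rewrite ler1n expn_gt0.
have Jp : (2 ^ j)%:R <= (2 ^ j)%:R `^ p :> R by apply: le1r_powR => //; exact: ltW.
have Jp0 : 0 < (2 ^ j)%:R `^ p :> R by lra.
have g2 : 0 < 2 * gamma by lra.
have lagj : lag <= 2 * gamma * (2 ^ j)%:R `^ p.
  rewrite mulrC -ler_pdivrMr//; apply: le_trans jlag _; by rewrite -natrX.
have [N /andP[jN _]] := @natr_ceil_exists _ (2 * (1 - gamma) * (2 ^ j)%:R `^ p)
  ltac:(by rewrite !mulr_ge0 ?powR_ge0 ?subr_ge0// ltW).
exists (2 * (2 ^ j)%:R `^ p) => C v lam C0 /andP[v0 v1] lam01.
pose u := Num.sqrt v.
have u0 : 0 < u by rewrite sqrtr_gt0.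
have u1 : u < 1 by rewrite -sqrtr1 ltr_sqrt.
have u2 : u ^+ 2 = v by rewrite sqr_sqrtr// ltW.
have [a a0 au] := powR_solve lam01 (introT andP (conj u0 u1)).
pose C1 := C * (N%:R / ((1 - gamma) * (2 ^ j)%:R `^ p)).
have C1_ge0 : 0 <= C1.
  apply: mulr_ge0; first exact: ltW.
  by apply: divr_ge0; [exact: ler0n|rewrite mulr_ge0 ?(ltW Jp0)// subr_ge0 ltW].
have K0 : 0 < 1 + C1 / (u * (1 - u)).
  by rewrite ltr_wpDr// divr_ge0// mulr_ge0 ?(ltW u0)// subr_ge0 ltW.
have np0 : 0 < n%:R + p by rewrite ltr_wpDl//; move: hp; lra.
exists (a / (n%:R + p)), (1 + C1 / (u * (1 - u))); split => //; first exact: divr_gt0.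
move=> E E0 holes dD; split => //; first exact: divr_gt0.
rewrite divfK ?gt_eqF//.
apply: A1plus_of_integral_bound => // x t L y L0 Ry Dy.
have h0 : 0 <= (1 - gamma) * L `^ p by rewrite mulr_ge0 ?powR_ge0// subr_ge0 ltW.
have V0 : 0 <= L ^+ n * ((1 - gamma) * L `^ p) by rewrite mulr_ge0// exprn_ge0// ltW.
apply: (integral_dist_weight_le hp E0 a0 lam01 au Dy _ V0 _ u1 C1_ge0).
- exact: measurable_box.
- by rewrite /past_box mu_box// ltW.
- move=> k; rewrite setIC u2.
  apply: (decay_past_box (ltW C0) (ltW v0) _ lagj jN dD L0 Ry Dy).
  by move=> r; exact: measurable_distp_lt.
Qed.

End halves.

(** * Consequences of the Muckenhoupt condition *)

Lemma finite_slack {R : realType} {n : nat} (x b : 'rV[R]_n) (eps : R) : 0 < eps ->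
  (forall q, x ord0 q < b ord0 q) ->
  exists eta : R, 0 < eta <= eps /\ forall q, x ord0 q + eta <= b ord0 q.
Proof.
move=> e0 xb; exists (\big[Num.min/eps]_q (b ord0 q - x ord0 q)); split.
  apply/andP; split; first by apply: lt_bigmin => // q _; rewrite subr_gt0.
  exact: bigmin_le_id.
by move=> q; rewrite addrC -lerBrDr; exact: bigmin_le_cond.
Qed.

Section muckenhoupt.
Context {R : realType} {n : nat}.
Local Notation point := ('rV[R]_n * R)%type.
Local Notation mpoint := ('rV[R]_n * measurableTypeR R)%type.
Local Notation mu := (@lebesgue_xt R n).
Variables (p gamma : R).
Hypotheses (hp : 1 < p) (hg : 0 < gamma < 1).

(** * Pointwise and weak-type consequences for one weight *)

Section weight.
Variables (E : set point) (a C : R).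
Hypotheses (E0 : E !=set0) (a0 : 0 < a) (C0 : 0 < C).
Hypothesis A1E : A1plus p gamma C (dist_weight p E a).
Local Notation D := (distp_set p E).
Local Notation w := (dist_weight p E a).

Let mw : measurable_fun [set: mpoint] (w : mpoint -> \bar R).
Proof. exact: measurable_dist_weight. Qed.

Let w0 z : (0 <= w z)%E. Proof. exact: dist_weight_ge0. Qed.

(** On a box where [D] vanishes the weight is +oo, against local integrability. *)
Lemma A1plus_hole (b : 'rV[R]_n) (s l h : R) : 0 < l -> 0 < h ->
  exists z, box b s l h z /\ 0 < D z.
Proof.
move=> l0 h0; apply: contrapT => nohole.
have Dz z : box b s l h z -> D z = 0.
  move=> Bz; apply/eqP; rewrite eq_le distp_set_ge0 andbT leNgt; apply/negP => Dz.
  by apply: nohole; exists z.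
pose X : set point :=
  [set x : 'rV[R]_n | forall q, [set` `[b ord0 q, b ord0 q + l]] (x ord0 q)] `*` `[s, s + h].
have cX : compact X.
  apply: compact_setX; last exact: segment_compact.
  apply: (@rV_compact _ _ (fun q => [set` `[b ord0 q, b ord0 q + l]])) => q.
  exact: segment_compact.
have [_ L1 _] := A1E; have /integrableP[_] := L1 X cX.
have mX : measurable (X : set mpoint).
  apply: measurableX; last exact: measurable_itv.
  apply: (@measurable_coord_box _ _ (fun q => [set` `[b ord0 q, b ord0 q + l]])) => q.
  exact: measurable_itv.
under eq_integral do rewrite gee0_abs//.
apply/negP; rewrite -leNgt.
apply: (@le_trans _ _ (\int[mu]_(z in box b s l h) w z)%E); last first.
  apply: ge0_subset_integral => //; first exact: measurable_box.
    by apply: measurable_funTS.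
  move=> z [zx]; rewrite /= in_itv/= => /andP[z1 z2]; split => [q|] /=.
    by rewrite in_itv/=; have /andP[-> /ltW] := zx q.
  by rewrite in_itv/= z1 ltW.
rewrite (eq_integral (cst +oo%E)); last first.
  by move=> z; rewrite inE => Bz; rewrite /dist_weight Dz// eqxx.
rewrite integral_cst; last exact: measurable_box.
by rewrite mu_box ?(ltW l0) ?(ltW h0)// gt0_mulye ?leey// lte_fin mulr_gt0// exprn_gt0.
Qed.

(** A single point does not influence an essential infimum, so [y] is replaced by a small box with
    lower corner [y] on which D >= D y / 2. The slack to the upper faces makes this box fit into the
    forward half. *)
Lemma ess_inf_on_le x t L y : 0 < L -> Rplus p gamma x t L y -> 0 < D y ->
  (ess_inf_on (Rplus p gamma x t L) w <= ((D y / 2) `^ (- a))%:E)%E.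
Proof.
move=> L0 [yx yt] Dy.
rewrite cube_cornerE in yx; rewrite /= in_itv/= in yt; have [y1 y2] := andP yt.
have Dy2 : 0 < D y / 2 by rewrite divr_gt0.
have [|eta [/andP[eta0 etaD] slack]] :=
  @finite_slack _ _ y.1 (\row_q (cube_corner x L ord0 q + L)) (D y / 2) Dy2.
  by move=> q; rewrite mxE; have /andP[] := yx q.
pose h := Num.min (eta `^ p) (t + L `^ p - y.2).
have h0 : 0 < h by rewrite lt_min powR_gt0// subr_gt0.
have h_eta : h <= eta `^ p by rewrite ge_min lexx.
have h_t : y.2 + h <= t + L `^ p.
  have : h <= t + L `^ p - y.2 by rewrite ge_min lexx orbT.
  lra.
have By : box y.1 y.2 eta h y.
  by split => [q|]; rewrite /= ?in_itv/= lexx ltrDl.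
rewrite leNgt; apply/negP => lt_ess.
have [A [mA A0 sA]] := ess_inf_le mu (patch (cst +oo%E) (Rplus p gamma x t L) w).
have BA : box y.1 y.2 eta h `<=` A.
  move=> z Bz; apply: sA; apply/negP; rewrite -ltNge; apply: le_lt_trans lt_ess.
  have Rz : Rplus p gamma x t L z.
    move: Bz => [zx]; rewrite /= in_itv/= => /andP[z1 z2]; split.
      rewrite cube_cornerE => q; have /andP[? ?] := zx q; have /andP[? ?] := yx q.
      by have := slack q; rewrite mxE => ?; apply/andP; split; lra.
    by rewrite /= in_itv/=; apply/andP; split; lra.
  rewrite /patch mem_set//; apply: dist_weight_le => //.
  have := box_distp hp eta0 h_eta By Bz; have := distp_set_lipschitz hp y z E0; lra.
have : (mu (box y.1 y.2 eta h) <= mu A)%E.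
  by apply: le_measure; rewrite ?inE//; exact: measurable_box.
rewrite mu_box ?(ltW eta0) ?(ltW h0)//; apply/negP; rewrite -ltNge A0 lte_fin.
by rewrite mulr_gt0// exprn_gt0.
Qed.

Lemma A1plus_sublevel_Rminus x t L y lam : 0 < L -> Rplus p gamma x t L y -> 0 < D y -> 0 < lam ->
  (mu (sublevel D (lam * D y) `&` Rminus p gamma x t L) <=
   (C * 2 `^ a * lam `^ a * (L ^+ n * ((1 - gamma) * L `^ p)))%:E)%E.
Proof.
move=> L0 Ry Dy lam0; have [g0 g1] := andP hg.
have [_ _ /(_ x t L L0)] := A1E.
rewrite mu_Rminus//; set V := L ^+ n * _.
have V0 : 0 < V by rewrite !mulr_gt0 ?exprn_gt0 ?powR_gt0 ?subr_gt0.
rewrite inver gt_eqF// => A1.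
have {}A1 : (\int[mu]_(z in Rminus p gamma x t L) w z <= (V * C * (D y / 2) `^ (- a))%:E)%E.
  have CX : (C%:E * ess_inf_on (Rplus p gamma x t L) w <= (C * (D y / 2) `^ (- a))%:E)%E.
    by rewrite EFinM; apply: lee_wpmul2l; [rewrite lee_fin ltW|exact: ess_inf_on_le].
  have := le_trans A1 CX; rewrite -(@lee_pmul2l _ V%:E)//.
  by rewrite muleA -EFinM mulfV ?gt_eqF// mul1e -EFinM mulrA.
have lD0 : 0 < lam * D y by rewrite mulr_gt0.
pose S := sublevel D (lam * D y) `&` Rminus p gamma x t L.
have mS : measurable (S : set mpoint).
  by apply: measurableI; [exact: measurable_distp_lt|exact: measurable_Rminus].
have lower : (((lam * D y) `^ (- a))%:E * mu S <= \int[mu]_(z in Rminus p gamma x t L) w z)%E.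
  apply: (@le_trans _ _ (\int[mu]_(z in S) w z)%E).
    rewrite -integral_cst//; apply: ge0_le_integral => //.
    - by move=> z _; rewrite lee_fin powR_ge0.
    - by apply: measurable_funTS.
    - by move=> z [Sz _]; exact: dist_weight_ge.
  apply: ge0_subset_integral => //; first exact: measurable_Rminus.
    by apply: measurable_funTS.
  by move=> z [].
have := le_trans lower A1; rewrite -(@lee_pmul2l _ ((lam * D y) `^ a)%:E)//; last first.
  by rewrite lte_fin powR_gt0.
rewrite muleA -EFinM powRN mulfV ?gt_eqF ?powR_gt0// mul1e => /le_trans; apply.
rewrite -EFinM lee_fin powRN !powRM ?(ltW lam0) ?(ltW Dy)// ?invr_ge0//.
have Da0 : 0 < D y `^ a by rewrite powR_gt0.
have ta0 : 0 < 2 `^ a :> R by rewrite powR_gt0.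
have -> : 2^-1 `^ a = (2 `^ a)^-1 :> R.
  apply: (@mulfI _ (2 `^ a)); first by rewrite gt_eqF.
  by rewrite mulfV ?gt_eqF// -powRM ?invr_ge0// mulfV// powR1.
rewrite [leLHS](_ : _ = C * 2 `^ a * lam `^ a * V)//.
by field; rewrite !gt_eqF.
Qed.

Lemma A1plus_sublevel x t L y lam : 0 < L -> Rplus p gamma x t L y -> 0 < D y -> 0 < lam ->
  (mu (sublevel D (lam * D y) `&` past_box p gamma x t L) <=
   (C * 2 `^ a * lam `^ a * (L ^+ n * ((1 - gamma) * L `^ p)))%:E)%E.
Proof.
move=> L0 Ry Dy lam0; set S := sublevel _ _.
have mS : measurable (S : set mpoint) by exact: measurable_distp_lt.
pose Z : set point := [set y : 'rV[R]_n | forall q, cube_corner x L ord0 q <= y ord0 q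
   < cube_corner x L ord0 q + L] `*` `[t - L `^ p, t - L `^ p].
have mZ : measurable (Z : set mpoint) by exact: measurable_slab.
have muZ : (mu Z <= 0)%E.
  by rewrite /Z mu_slab ?(ltW L0)// lebesgue_measure_itv/= lte_fin ltxx mule0.
have mSR : measurable (S `&` Rminus p gamma x t L : set mpoint).
  by apply: measurableI => //; exact: measurable_Rminus.
apply: (@le_trans _ _ (mu ((S `&` Rminus p gamma x t L) `|` Z))).
  apply: le_measure; rewrite ?inE.
  - by apply: measurableI => //; exact: measurable_box.
  - exact: measurableU.
  - move=> z [Sz [zx]]; rewrite /= in_itv/= => /andP[z1 z2].
    have [zt|zt] := eqVneq z.2 (t - L `^ p).
      by right; split => //=; rewrite in_itv/= zt lexx.
    left; split => //; rewrite /Rminus cube_cornerE; split => //=.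
    rewrite in_itv/= lt_neqAle eq_sym zt z1/=; lra.
apply: le_trans (measureU2 mu mSR mZ) _.
rewrite -[leRHS]adde0; apply: leeD; last exact: muZ.
exact: A1plus_sublevel_Rminus.
Qed.

(** Measured from the bottom of a box of height h = (1 - gamma) * l^p, the forward half begins at (1
    + gamma) * l^p, which is theta * h for theta = (1 + gamma) / (1 - gamma). *)
Lemma A1plus_density (e : R) : 0 < e -> C * 2 `^ a * e `^ a <= 2^-1 ->
  density_property p (1 - gamma) (1 - gamma) ((1 + gamma) / (1 - gamma)) 2^-1 e D.
Proof.
move=> e0 Ce b s l h y l0 /andP[h1 h2] yb yt; have [g0 g1] := andP hg.
have hE : h = (1 - gamma) * l `^ p by apply/eqP; rewrite eq_le h1 h2.
have g10 : 0 < 1 - gamma by lra.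
have lp0 : 0 < l `^ p by rewrite powR_gt0.
have V0 : 0 <= l ^+ n * h by rewrite hE !mulr_ge0 ?exprn_ge0 ?(ltW l0) ?(ltW g10) ?(ltW lp0).
have := distp_set_ge0 p E y; rewrite le_eqVlt => /predU1P[Dy|Dy].
  rewrite -Dy mulr0 (_ : _ `&` _ = set0).
    by rewrite measure0 lee_fin mulr_ge0//; lra.
  by rewrite -subset0 => z [_]; rewrite /sublevel /= ltNge distp_set_ge0.
pose x : 'rV[R]_n := \row_q (b ord0 q + l / 2).
have xb : cube_corner x l = b by apply/rowP => q; rewrite !mxE addrK.
have boxE : box b s l h = past_box p gamma x (s + l `^ p) l.
  by rewrite /past_box xb addrK hE.
rewrite boxE setIC.
have thE : (1 + gamma) / (1 - gamma) * h = (1 + gamma) * l `^ p.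
  by rewrite hE mulrA divfK ?gt_eqF.
have Ry : Rplus p gamma x (s + l `^ p) l y.
  split; first by rewrite cube_cornerE xb.
  have thE1 : ((1 + gamma) / (1 - gamma) + 1) * h = (1 + gamma) * l `^ p + h by rewrite -thE; ring.
  rewrite /= in_itv/=; move: yt; rewrite thE1 thE hE => /andP[y1 y2].
  by apply/andP; split; lra.
apply: le_trans (A1plus_sublevel l0 Ry Dy e0) _.
rewrite -hE lee_fin ler_wpM2r//; apply: le_trans Ce _; lra.
Qed.

End weight.

Lemma A1plus_chain (a C M sigma : R) : (0 < n)%N -> 0 < a -> 0 < C -> 0 < M -> 0 < sigma ->
  exists e' : R, 0 < e' <= 1 /\ forall E : set point, E !=set0 ->
    A1plus p gamma C (dist_weight p E a) -> chain_property p M sigma e' (distp_set p E).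
Proof.
move=> n0 a0 C0 M0 s0; have [g0 g1] := andP hg.
have Ca0 : 0 < 2 * (C * 2 `^ a) by rewrite !mulr_gt0// powR_gt0.
pose e := Num.min 1 ((2 * (C * 2 `^ a))^-1 `^ a^-1).
have e0 : 0 < e by rewrite lt_min ltr01 powR_gt0// invr_gt0.
have e1 : e <= 1 by rewrite ge_min lexx.
have Ce : C * 2 `^ a * e `^ a <= 2^-1.
  have : e `^ a <= (2 * (C * 2 `^ a))^-1.
    rewrite -[leRHS](@powRVK _ a) ?gt_eqF ?invr_ge0 ?(ltW Ca0)//.
    by apply: powR_leW; rewrite ?(ltW a0) ?(ltW e0)// ge_min lexx orbT.
  move=> ea; apply: (@le_trans _ _ (C * 2 `^ a * (2 * (C * 2 `^ a))^-1)).
    by rewrite ler_wpM2l// mulr_ge0 ?powR_ge0 ?(ltW C0).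
  rewrite [leLHS](_ : _ = 2^-1)//; field.
  by rewrite !gt_eqF ?powR_gt0.
have th : 1 < (1 + gamma) / (1 - gamma) by rewrite ltr_pdivlMr; lra.
have nR : 1 <= n%:R :> R by rewrite ler1n.
have hnu : 0 < (2^-1 : R) / (8 * n%:R) <= 4^-1.
  apply/andP; split; first by rewrite divr_gt0// ?invr_gt0// mulr_gt0//; lra.
  by rewrite ler_pdivrMr; lra.
have he : 0 < e <= 1 by rewrite e0.
have hk : 0 < 1 - gamma by lra.
have [e' [he' chain]] := @chain_lemma R n p (1 - gamma) _ _ e M sigma hp hk th hnu he M0 s0.
exists e'; split => // E E0 A1E; apply: chain.
  by move=> z; exact: distp_set_ge0.
apply: (density_step n0 _ hk _ _ (A1plus_density E0 a0 C0 A1E e0 Ce)).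
- by apply/andP; split; lra.
- by rewrite lexx.
- by move=> r; exact: measurable_distp_lt.
Qed.

(** The lag of [Rplus] is dictated by gamma, that of the translate by theta, and the two are
    unrelated. The rectangle is cut into boxes so small that the translate lies after the forward
    half of each of them; a chain from [y] reaches this half at the cost of e', and the sublevel
    estimate applies there with lam / e'. *)
Lemma A1plus_rect_sublevel (a C theta : R) : (0 < n)%N -> 0 < a -> 0 < C -> 1 < theta ->
  exists C1 : R, 0 < C1 /\ forall E : set point, E !=set0 ->
    A1plus p gamma C (dist_weight p E a) ->
    forall (P : @prect R n) (y : point) (lam : R), is_prect P ->
    rect p (Defs.shift p theta P) y -> 0 < distp_set p E y -> 0 < lam ->
    (mu (sublevel (distp_set p E) (lam * distp_set p E y) `&` rect p P) <=
      (C1 * lam `^ a * (pr_L P ^+ n * l_t p P))%:E)%E.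
Proof.
move=> n0 a0 C0 th; have [g0 g1] := andP hg.
have th1 : 0 < theta - 1 by lra.
have g10 : 0 < 1 - gamma by lra.
have [j jth] := two_expn_ge (8 / (theta - 1)).
have J1 : 1 <= (2 ^ j)%:R :> R by rewrite ler1n expn_gt0.
pose J : R := (2 ^ j)%:R `^ p.
have Jp : (2 ^ j)%:R <= J by apply: le1r_powR => //; exact: ltW.
have Jth : 8 <= J * (theta - 1).
  by rewrite -ler_pdivrMr//; apply: le_trans jth _; rewrite -natrX.
have [N /andP[JN _]] := @natr_ceil_exists _ (J / (1 - gamma)) ltac:(by rewrite divr_ge0 ?powR_ge0// ltW).
have N0 : 0 < N%:R :> R by apply: lt_le_trans JN; rewrite divr_gt0//; lra.
pose M := (theta + 1) * J.
have M0 : 0 < M by rewrite mulr_gt0//; lra.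
have s0 : 0 < (1 - gamma) / 2 by lra.
have [e' [/andP[e'0 e'1] chain]] := A1plus_chain n0 a0 C0 M0 s0.
have ta0 : 0 < 2 `^ a :> R by rewrite powR_gt0.
exists (C * 2 `^ a * e'^-1 `^ a * (2 * N%:R)); split.
  by rewrite !mulr_gt0 ?powR_gt0 ?invr_gt0.
move=> E E0 A1E P y lam prectP Py Dy lam0.
have chE := chain E E0 A1E.
have L0 : 0 < pr_L P by case: prectP.
have lt0 : 0 < l_t p P := l_t_gt0 p prectP.
have lt_bd : 2^-1 * pr_L P `^ p <= l_t p P <= pr_L P `^ p.
  case: prectP => _ /andP[pg0 pg1]; rewrite /l_t.
  by rewrite ler_wpM2r ?ler_piMl ?powR_ge0//; lra.
have [lt1 lt2] := andP lt_bd.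
rewrite rect_box.
move: Py; rewrite rect_box => -[yx]; rewrite /= in_itv/= => /andP[yt1 yt2].
have {}yx q : low_corner P ord0 q <= y.1 ord0 q < low_corner P ord0 q + pr_L P by exact: yx.
have ltmE : low_time p (Defs.shift p theta P) = low_time p P + theta * l_t p P.
  by rewrite /low_time /=; ring.
rewrite ltmE (_ : l_t p (Defs.shift p theta P) = l_t p P)// in yt1 yt2.
move: (low_corner P) (low_time p P) (pr_L P) (l_t p P) L0 lt0 lt1 lt2 yx yt1 yt2.
move=> b0 s L H L0 H0 H1 H2 yx yt1 yt2 {ltmE lt_bd prectP P}.
have l0 : 0 < L / (2 ^ j)%:R by rewrite divr_gt0//; lra.
have LE : L = (2 ^ j)%:R * (L / (2 ^ j)%:R) by rewrite mulrCA mulfV ?mulr1// gt_eqF//; lra.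
have LpE := powR_natM_div p (ltW L0) (expn_gt0 2 j : (0 < 2 ^ j)%N).
have mS r : measurable (sublevel (distp_set p E) r : set mpoint) by exact: measurable_distp_lt.
apply: (@cover_ratio _ n _ _ _ _ _ j N) => //; first by rewrite -(ltr_nat R).
  by rewrite !mulr_ge0 ?powR_ge0 ?(ltW C0) ?(ltW N0).
move=> b s' bx /andP[s1 s2].
move: l0 LE LpE; rewrite -/J; set l := L / (2 ^ j)%:R => l0 LE LpE.
have lp0 : 0 < l `^ p by rewrite powR_gt0.
have hl : H / N%:R <= (1 - gamma) * l `^ p.
  rewrite ler_pdivrMr//; apply: le_trans H2 _; rewrite -LpE.
  apply: (@le_trans _ _ ((1 - gamma) * N%:R * l `^ p)); last by rewrite mulrAC.
  by rewrite ler_wpM2r ?(ltW lp0)// mulrC -ler_pdivrMr.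
have thH0 : 0 < theta * H by rewrite mulr_gt0// (lt_trans ltr01 th).
have glp : 0 < gamma * l `^ p < l `^ p by rewrite mulr_gt0//= gtr_pMl.
have [glp0 glp1] := andP glp.
(* The target is the middle half of the forward half belonging to the small box. *)
have [|||z [[zx zt] zD]] := chE b (s' + (1 + gamma) * l `^ p + (1 - gamma) / 4 * l `^ p) l
   ((1 - gamma) / 2 * l `^ p) y l0.
- by [].
- move=> q; have /andP[b1 b2] := bx q; have /andP[y1 y2] := yx q.
  have JM : (2 ^ j)%:R * l <= M * l.
    rewrite ler_wpM2r ?(ltW l0)//; apply: le_trans Jp _.
    by rewrite /M ler_peMl ?powR_ge0// lerDr ltW// (lt_trans ltr01 th).
  by rewrite -LE in JM; apply/andP; split; lra.
- have Jth' : 8 * l `^ p <= (theta - 1) * L `^ p.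
    rewrite -LpE mulrA [X in _ <= X * _]mulrC; by rewrite ler_wpM2r// ltW.
  have Hth : (theta - 1) * (2^-1 * L `^ p) <= (theta - 1) * H by rewrite ler_wpM2l// ltW.
  have Hth2 : (theta + 1) * H <= M * l `^ p.
    by rewrite /M -mulrA LpE ler_wpM2l//; lra.
  by apply/andP; split; lra.
have Dz : 0 < distp_set p E z by apply: lt_le_trans zD; rewrite mulr_gt0.
have lam'0 : 0 < lam / e' by rewrite divr_gt0.
pose x : 'rV[R]_n := \row_q (b ord0 q + l / 2).
have xb : cube_corner x l = b by apply/rowP => q; rewrite !mxE addrK.
rewrite /= in_itv/= in zt; have [zt1 zt2] := andP zt.
have Rz : Rplus p gamma x (s' + l `^ p) l z.
  split; first by rewrite cube_cornerE xb.
  by rewrite /= in_itv/=; apply/andP; split; lra.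
apply: le_trans (le_trans (A1plus_sublevel E0 a0 C0 A1E l0 Rz Dz lam'0) _).
  apply: le_measure; rewrite ?inE.
  - by apply: measurableI => //; exact: measurable_box.
  - by apply: measurableI => //; exact: measurable_box.
  - move=> v [vS [vx]]; rewrite /= in_itv/= => /andP[v1 v2]; split.
      rewrite /sublevel /=; apply: lt_le_trans vS _.
      by rewrite -mulrA ler_wpM2l ?(ltW lam0)// mulrC ler_pdivlMr// mulrC.
    by rewrite /past_box xb addrK; split => //=; rewrite in_itv/= v1 (lt_le_trans v2)// lerD2l.
rewrite lee_fin powRM ?(ltW lam0) ?invr_ge0 ?(ltW e'0)//.
set K := C * 2 `^ a.
have K0 : 0 <= K by rewrite mulr_ge0 ?(ltW C0) ?(ltW ta0).
have lh : (1 - gamma) * l `^ p <= 2 * N%:R * (H / N%:R).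
  rewrite [leRHS](_ : _ = 2 * H); last by field; rewrite gt_eqF.
  have Jl : l `^ p <= L `^ p by rewrite -LpE ler_peMl ?(ltW lp0)//; exact: le_trans J1 Jp.
  by lra.
have F0 : 0 <= K * e'^-1 `^ a * lam `^ a * l ^+ n.
  exact: mulr_ge0 (mulr_ge0 (mulr_ge0 K0 (powR_ge0 _ _)) (powR_ge0 _ _)) (exprn_ge0 _ (ltW l0)).
rewrite [leLHS](_ : _ = K * e'^-1 `^ a * lam `^ a * l ^+ n * ((1 - gamma) * l `^ p)); last ring.
rewrite [leRHS](_ : _ = K * e'^-1 `^ a * lam `^ a * l ^+ n * (2 * N%:R * (H / N%:R))); last ring.
exact: ler_wpM2l.
Qed.

End muckenhoupt.

(** * From the Muckenhoupt condition to improvement *)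

Section improving.
Context {R : realType} {n : nat}.
Local Notation point := ('rV[R]_n * R)%type.
Local Notation mpoint := ('rV[R]_n * measurableTypeR R)%type.
Local Notation mu := (@lebesgue_xt R n).
Local Notation margin := (@porous_margin R n).
Variables (p : R) (d : nat).
Hypotheses (hp : 1 < p) (a_ge9 : 9 <= 2 `^ (d%:R * p) :> R) (d_gt0 : (0 < d)%N).

Section one_rectangle.
Variables (E : set point) (P : @prect R n).
Hypotheses (E0 : E !=set0) (prectP : is_prect P).
Local Notation D := (distp_set p E).
Local Notation gl := (grid_l d (pr_L P)).
Local Notation gh := (grid_h (l_t p P) (gen_count p d P)).
Local Notation cell := (grid_cell d (low_corner P) (low_time p P) (pr_L P) (l_t p P) (gen_count p d P)).
Local Notation ibox :=
  (@index_box _ _ d (low_corner P) (low_time p P) (pr_L P) (l_t p P) (gen_count p d P)).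

Let L_gt0 : 0 < pr_L P. Proof. by case: prectP. Qed.
Let T_gt0 : 0 < l_t p P. Proof. exact: l_t_gt0. Qed.
Let K0 := gen_count0 p d P.
Let KS := gen_countS p d P.
Let r_gt0 := gen_ntime_gt0 a_ge9 prectP.

Lemma free_far_point Q : lattice p d P Q -> Defs.free E (rect p Q) -> exists y,
  rect p P y /\ margin / 2 * l_x Q <= D y.
Proof.
move=> latQ freeQ; have [lQ0 /andP[hQ1 _] _] := lattice_box a_ge9 prectP latQ.
have hQ0 : 0 < l_t p Q by apply: lt_le_trans hQ1; rewrite mulr_gt0 ?powR_gt0.
have m4 := @porous_margin_le R n.
have m2 : 0 < 1 - 2 * margin by lra.
have [y Iy] : exists y, inner_box p Q y.
  exists (\row_q (low_corner Q ord0 q + margin * l_x Q), low_time p Q + margin * l_t p Q).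
  by split => [q|]; rewrite /= ?in_itv/= lexx ltrDl mulr_gt0.
exists y; split; last exact: (distp_set_inner_box hp).
by apply: (lattice_sub a_ge9 prectP latQ); exact: (inner_box_sub lQ0 hQ1).
Qed.

Lemma largest_far_point y0 : rect p P y0 -> 0 < D y0 -> exists Q y,
  [/\ lattice p d P Q, largest p d E P = rect p Q, rect p P y & margin / 2 * l_x Q <= D y].
Proof.
move=> Py0 Dy0; have [i [il _]] := small_generation d_gt0 L_gt0 Dy0.
have cell_free : Defs.free E (cell i y0).
  rewrite /Defs.free -subset0 => w [cw Ew].
  by have := distp_set_le_cell hp a_ge9 prectP Py0 cw Ew; rewrite leNgt il.
have [Q [latQ freeQ largeQ _]] := largest_ge a_ge9 prectP Py0 cell_free.
by have [y [Py Dy]] := free_far_point latQ freeQ; exists Q, y.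
Qed.

Lemma free_cells i (rho tau : R) : gl i < rho ->
  (mu (sublevel D rho `&` rect p P) <= (tau * (pr_L P ^+ n * l_t p P))%:E)%E ->
  exists (N : nat) (Pk : 'I_N -> prect),
  [/\ forall k, lattice p d P (Pk k), trivIset setT (fun k => rect p (Pk k)),
      forall k, Defs.free E (rect p (Pk k)),
      forall k, mu (rect p (Pk k)) = (gl i ^+ n * gh i)%:E &
      ((1 - tau)%:E * mu (rect p P) <= \sum_(k < N) mu (rect p (Pk k)))%E].
Proof.
move=> il mu_tau.
pose F := [set u : grid_index d (gen_count p d P) i | `[< Defs.free E (ibox u) >]]%SET.
pose Pk (k : 'I_#|F|) := grid_prect p d P i (fun q => nat_of_ord ((enum_val k).1 q)) (enum_val k).2.
have PkE k : rect p (Pk k) = ibox (enum_val k) by rewrite /Pk rect_grid_prect.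
have mPk k : measurable (rect p (Pk k) : set mpoint) by rewrite PkE; exact: measurable_index_box.
have trivP : trivIset setT (fun k => rect p (Pk k)).
  apply/trivIsetP => k k' _ _ kk'; rewrite !PkE; apply: index_box_disjoint => //.
  by apply: contra_neq kk' => /enum_val_inj.
exists #|F|, Pk; split => //.
- by move=> k; exists i => //; apply: dyadic_grid_prect => // q; exact: ltn_ord.
- by move=> k; have := enum_valP k; rewrite inE PkE => /asboolP.
- by move=> k; rewrite PkE (mu_index_box _ _ L_gt0 T_gt0 K0 KS r_gt0).
rewrite -(measure_bigsetU_ord _ xpredT mPk trivP).
set U := \big[setU/set0]_(k < _) _.
have mU : measurable (U : set mpoint) by apply: bigsetU_measurable.
have mS : measurable (sublevel D rho `&` rect p P : set mpoint).
  apply: measurableI; first exact: measurable_distp_lt.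
  by rewrite rect_box; exact: measurable_box.
have cover : rect p P `<=` U `|` (sublevel D rho `&` rect p P).
  move=> z Pz; have Bz := Pz; rewrite rect_box in Bz.
  have [u uz] := grid_cell_index d L_gt0 T_gt0 K0 KS r_gt0 i Bz.
  have [ufree|/set0P[w []]] := eqVneq (ibox u `&` E) set0.
    left; rewrite /U -bigcup_seq.
    have uF : u \in F by rewrite inE; apply/asboolP.
    exists (enum_rank_in uF u); first by rewrite /= mem_index_enum.
    by rewrite PkE enum_rankK_in// uz; exact: grid_cell_mem.
  rewrite uz => cw Ew; right; split => //.
  by rewrite /sublevel /=; apply: le_lt_trans il; exact: (distp_set_le_cell hp a_ge9 prectP Pz cw Ew).
have V0 : mu (rect p P) = (pr_L P ^+ n * l_t p P)%:E.
  by rewrite rect_box mu_box// ltW.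
have : (mu (rect p P) <= mu U + (tau * (pr_L P ^+ n * l_t p P))%:E)%E.
  apply: (@le_trans _ _ (mu (U `|` (sublevel D rho `&` rect p P)))).
    apply: le_measure; rewrite ?inE//; first by rewrite rect_box; exact: measurable_box.
    exact: measurableU.
  by apply: le_trans (measureU2 mu mU mS) _; rewrite leeD2l.
rewrite V0 -leeBlDr// -EFinB => /(le_trans _); apply.
by rewrite -EFinM lee_fin mulrBl mul1r.
Qed.

Lemma lattice_side_le Q : lattice p d P Q -> l_x Q <= pr_L P.
Proof.
move=> /(lattice_gridP a_ge9 prectP)[i [j [k [_ _ ->]]]].
rewrite /l_x /= /grid_l ler_pdivrMr ?ltr0n ?expn_gt0//.
by rewrite ler_peMr ?(ltW L_gt0)// ler1n expn_gt0.
Qed.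

End one_rectangle.

Variable gamma : R.
Hypothesis hg : 0 < gamma < 1.

(** Let r be the side of the largest free cell of the translate; it contains a point [y] with margin
    / 2 * r <= D y. Cells of the first generation with side below rho = lam * margin / 2 * r have
    side at least rho / 2^d = kappa * lam * r and height at least half its power p, whence the
    threshold (kappa * lam)^(n + p) / 2. *)
Lemma A1plus_weakly_porous (E : set point) (theta a C1 lam : R) : E !=set0 -> 1 < theta ->
  (forall (a : 'rV[R]_n) (s l h : R), 0 < l -> 0 < h ->
    exists z, box a s l h z /\ 0 < distp_set p E z) ->
  (forall (P : @prect R n) (y : point) (lam : R), is_prect P ->
    rect p (Defs.shift p theta P) y -> 0 < distp_set p E y -> 0 < lam ->
    (mu (sublevel (distp_set p E) (lam * distp_set p E y) `&` rect p P) <=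
      (C1 * lam `^ a * (pr_L P ^+ n * l_t p P))%:E)%E) ->
  0 < lam <= 1 ->
  weakly_porous p d (1 - C1 * lam `^ a)
    (2^-1 * (margin / 2 / (2 ^ d)%:R * lam) `^ (n%:R + p)) theta E.
Proof.
move=> E0 th holes sub /andP[lam0 lam1]; set kappa := margin / 2 / _ => P prectP.
have m0 := @porous_margin_gt0 R n; have m4 := @porous_margin_le R n.
have N2 : 2 <= (2 ^ d)%:R :> R by rewrite ler_nat -{1}(expn1 2) leq_pexp2l.
have N0 : 0 < (2 ^ d)%:R :> R by lra.
have k0 : 0 < kappa by rewrite !divr_gt0.
pose P1 := Defs.shift p theta P.
have prectP1 : is_prect P1 by [].
have [L0 T1] : 0 < pr_L P1 /\ 0 < l_t p P1 by split; [case: prectP1|exact: l_t_gt0].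
(* The hole ensures that the translate has a free cell at all. *)
have [y0 [By0 Dy0]] := holes (low_corner P1) (low_time p P1) _ _ L0 T1.
rewrite -rect_box in By0.
have [Q [y [latQ largeQ Py Dy]]] := largest_far_point E0 prectP1 By0 Dy0.
have [r0 /andP[_ hQ2] _] := lattice_box a_ge9 prectP1 latQ.
have rL : l_x Q <= pr_L P by exact: (lattice_side_le prectP1 latQ).
set r := l_x Q in r0 rL Dy.
have mr0 : 0 < margin / 2 * r by rewrite mulr_gt0// divr_gt0.
have Dy_gt0 : 0 < distp_set p E y by exact: lt_le_trans Dy.
pose rho := lam * (margin / 2 * r).
have rho0 : 0 < rho by rewrite mulr_gt0.
have rhoL : rho <= pr_L P.
  apply: le_trans rL; apply: (@le_trans _ _ (1 * (1 * r))); last by rewrite !mul1r.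
  by apply: ler_pM; rewrite ?(ltW lam0) ?(ltW mr0)//; apply: ler_wpM2r; [exact: ltW|lra].
have [i [il1 il2]] := small_generation d_gt0 (L0 : 0 < pr_L P) rho0.
have {}il2 : kappa * lam * r <= grid_l d (pr_L P) i.
  apply: le_trans il2; have -> : kappa * lam * r = rho / (2 ^ d)%:R.
    by rewrite /kappa /rho; field; rewrite gt_eqF.
  rewrite le_min lexx andbT ler_pdivrMr// mulrAC ler_pdivlMr//.
  by apply: ler_pM; rewrite // ltW.
have mu_tau : (mu (sublevel (distp_set p E) rho `&` rect p P) <=
    (C1 * lam `^ a * (pr_L P ^+ n * l_t p P))%:E)%E.
  apply: le_trans (sub P y lam prectP Py Dy_gt0 lam0).
  have mR : measurable (rect p P : set mpoint) by rewrite rect_box; exact: measurable_box.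
  apply: le_measure; rewrite ?inE.
  - by apply: measurableI => //; exact: measurable_distp_lt.
  - by apply: measurableI => //; exact: measurable_distp_lt.
  - move=> z [zr Pz]; split => //; rewrite /sublevel /=; apply: lt_le_trans zr _.
    by rewrite ler_wpM2l// ltW.
have [N [Pk [latP trivP freeP muP sumP]]] := free_cells E0 prectP il1 mu_tau.
exists N, Pk; split => // k.
rewrite -/P1 largeQ muP (mu_lattice a_ge9 prectP1 latQ) -/r -EFinM lee_fin.
have /andP[hi _] := grid_height_bounds a_ge9 prectP i.
have kl0 : 0 < kappa * lam by rewrite mulr_gt0.
have klr0 : 0 < kappa * lam * r by rewrite mulr_gt0.
apply: (@le_trans _ _ ((kappa * lam * r) ^+ n * (2^-1 * (kappa * lam * r) `^ p))); last first.
  apply: ler_pM.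
  - exact: exprn_ge0 (ltW klr0).
  - by apply: mulr_ge0; [|exact: powR_ge0].
  - by apply: lerXn2r; rewrite ?nnegrE ?(ltW klr0)// (le_trans (ltW klr0)).
  apply: le_trans hi; rewrite ler_wpM2l//; apply: powR_leW; rewrite ?(ltW klr0)//.
  by move: hp; lra.
move: (kappa * lam) kl0 klr0 il2 => v v0 vr0 _.
rewrite powRD; last by rewrite (gt_eqF v0) implybT.
rewrite powR_mulrn ?(ltW v0)// exprMn powRM ?(ltW v0) ?(ltW r0)//.
have v_ge0 : 0 <= 2^-1 * (v ^+ n * v `^ p * r ^+ n).
  by rewrite !mulr_ge0 ?exprn_ge0 ?powR_ge0 ?(ltW v0) ?(ltW r0)// invr_ge0.
rewrite [leLHS](_ : _ = 2^-1 * (v ^+ n * v `^ p * r ^+ n) * l_t p Q); last ring.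
rewrite [leRHS](_ : _ = 2^-1 * (v ^+ n * v `^ p * r ^+ n) * r `^ p); last ring.
exact: ler_wpM2l.
Qed.

(** Solving delta = c' * lam^(n + p) for lam turns lam^(beta * (n + p)) into (delta / c')^beta; so
    the improvement exponent is beta itself. *)
Lemma A1plus_improving (theta beta C : R) : (0 < n)%N -> 1 < theta -> 0 < beta -> 0 < C ->
  exists c0 delta0 alpha K, forall E : set point, E !=set0 ->
    A1plus_with p gamma beta C E -> improving_with p d theta c0 delta0 alpha K E.
Proof.
move=> n0 th b0 C0.
have np0 : 0 < n%:R + p by rewrite ltr_wpDl//; move: hp; lra.
have a0 : 0 < beta * (n%:R + p) by rewrite mulr_gt0.
have [C1 [C10 sub]] := @A1plus_rect_sublevel R n p gamma hp hg _ C theta n0 a0 C0 th.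
have m0 := @porous_margin_gt0 R n.
pose kappa := margin / 2 / (2 ^ d)%:R.
have k0 : 0 < kappa by rewrite !divr_gt0// ltr0n expn_gt0.
pose c' := 2^-1 * kappa `^ (n%:R + p).
have c'0 : 0 < c' by rewrite mulr_gt0 ?powR_gt0// invr_gt0.
pose K := C1 * c'^-1 `^ beta.
have K0 : 0 < K by rewrite mulr_gt0// powR_gt0// invr_gt0.
have K2 : 0 < (2 * K)^-1 by rewrite invr_gt0 mulr_gt0.
(* The three bounds ensure lam <= 1, delta0 < 1 and K * delta^beta <= 1/2, respectively. *)
pose delta0 := Num.min (Num.min c' 2^-1) ((2 * K)^-1 `^ beta^-1).
have d00 : 0 < delta0 by rewrite !lt_min c'0 invr_gt0 ltr0n powR_gt0.
have d0c : delta0 <= c' by rewrite !ge_min lexx.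
have d02 : delta0 <= 2^-1 by rewrite !ge_min lexx orbT.
have Kd delta : 0 < delta <= delta0 -> 0 < K * delta `^ beta <= 2^-1.
  move=> /andP[dl0 dl1]; rewrite mulr_gt0 ?powR_gt0//=.
  have : delta `^ beta <= (2 * K)^-1.
    rewrite -[leRHS](@powRVK _ beta) ?gt_eqF ?(ltW K2)//.
    apply: powR_leW; rewrite ?(ltW b0) ?(ltW dl0)//; apply: le_trans dl1 _.
    by rewrite !ge_min lexx !orbT.
  move=> /(ler_wpM2l (ltW K0)) /le_trans; apply.
  by rewrite [leLHS](_ : _ = 2^-1)//; field; rewrite gt_eqF.
exists (1 - K * delta0 `^ beta), delta0, beta, K => E E0 [_ _ A1E].
have wp delta : 0 < delta <= delta0 -> weakly_porous p d (1 - K * delta `^ beta) delta theta E.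
  move=> /andP[dl0 dl1].
  have dc0 : 0 < delta / c' by rewrite divr_gt0.
  pose lam := (delta / c') `^ (n%:R + p)^-1.
  have lamnp : lam `^ (n%:R + p) = delta / c' by rewrite powRVK ?gt_eqF// ltW.
  have lam0 : 0 < lam by rewrite powR_gt0.
  have lam1 : lam <= 1.
    have e1 : 1 `^ (n%:R + p)^-1 = 1 :> R by rewrite powR1.
    rewrite -[leRHS]e1; apply: powR_leW; rewrite ?invr_ge0 ?(ltW np0) ?(ltW dc0)//.
    by rewrite ler_pdivrMr// mul1r (le_trans dl1).
  have lam01 : 0 < lam <= 1 by rewrite lam0.
  have holes (b : 'rV[R]_n) (s l h : R) : 0 < l -> 0 < h ->
      exists z, box b s l h z /\ 0 < distp_set p E z.
    exact: (A1plus_hole hp E0 A1E).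
  have := A1plus_weakly_porous E0 th holes (sub E E0 A1E) lam01.
  rewrite -/kappa powRM ?(ltW k0) ?(ltW lam0)// lamnp mulrA -/c' mulrCA mulfV ?gt_eqF// mulr1.
  suff -> : C1 * lam `^ (beta * (n%:R + p)) = K * delta `^ beta by [].
  by rewrite [beta * _]mulrC powRrM lamnp powRM ?(ltW dl0) ?invr_ge0 ?(ltW c'0)// /K; ring.
have d0E : 0 < delta0 <= delta0 by rewrite d00 lexx.
split => //; last first.
  move=> delta hd; exists (1 - K * delta `^ beta); split; last exact: wp.
    by have /andP[? ?] := Kd delta hd; apply/andP; split; lra.
  by rewrite subKr.
split; last exact: wp.
- by have /andP[? ?] := Kd _ d0E; apply/andP; split; lra.
- by rewrite d00/=; lra.
Qed.

End improving.

(** As c > 0, the family of free rectangles is nonempty, and a free rectangle has a point at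
    positive distance from [E]. *)
Lemma porous_hole {R : realType} {n : nat} (p theta c delta : R) (d : nat) (E : set ('rV[R]_n * R))
    (a : 'rV[R]_n) (s l : R) :
  1 < p -> 9 <= 2 `^ (d%:R * p) :> R -> E !=set0 -> porous_with p d theta c delta E ->
  0 < l -> exists z, box a s l (l `^ p) z /\ 0 < distp_set p E z.
Proof.
move=> hp a9 E0 [/andP[c0 _] _ wp] l0.
pose P := PRect (\row_q (a ord0 q + l / 2)) (s + l `^ p) l 0.
have prectP : is_prect P by split => //=; rewrite lexx invr_ge0 ler0n.
have rectP : rect p P = box a s l (l `^ p).
  rewrite rect_box (_ : low_corner P = a); last by apply/rowP => q; rewrite mxE /= mxE addrK.
  by rewrite /low_time /l_t /= addrK subr0 mul1r.
have [[|N] [Pk [latP _ freeP _ sumP]]] := wp P prectP.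
  move: sumP; rewrite big_ord0 rectP mu_box ?(ltW l0) ?powR_ge0// -EFinM lee_fin.
  by rewrite leNgt !mulr_gt0 ?exprn_gt0 ?powR_gt0.
have [z [Pz Dz]] := free_far_point hp a9 E0 prectP (latP ord0) (freeP ord0).
exists z; rewrite -rectP; split => //; apply: lt_le_trans Dz.
have [lQ _ _] := lattice_box a9 prectP (latP ord0).
by rewrite mulr_gt0// divr_gt0// porous_margin_gt0.
Qed.

Lemma porous_A1plus {R : realType} {n : nat} (p theta gamma c delta : R) (d : nat) : (0 < n)%N ->
  1 < p -> (0 < d)%N -> 9 <= 2 `^ (d%:R * p) :> R -> 1 < theta -> 0 < gamma < 1 ->
  exists beta C, forall E : set ('rV[R]_n * R), E !=set0 ->
    porous_with p d theta c delta E -> A1plus_with p gamma beta C E.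
Proof.
move=> n0 hp d0 a9 th hg.
(* The constants are chosen before [E]. For [c] or [delta] outside (0, 1) no set satisfies the
   hypothesis, and any values will do. *)
have [hc|nc] := boolP (0 < c < 1); last first.
  by exists 0, 0 => E _ [hc]; rewrite hc in nc.
have [hd|nd] := boolP (0 < delta < 1); last first.
  by exists 0, 0 => E _ [_ hd]; rewrite hd in nd.
have [M A1] := @decay_A1plus R n p gamma hp hg (theta + 4).
have [C [v [lam [C0 v01 lam01 decay]]]] := @porous_decay R n p theta c delta M d n0 hp d0 a9 th hc hd.
have [beta [K [_ _ {}A1]]] := A1 C v lam C0 v01 lam01.
exists beta, K => E E0 porousE; apply: A1 => //; last exact: decay.
by move=> a s l; exact: (porous_hole _ _ hp a9 E0 porousE).
Qed.

Lemma powR_ge_of_ln {R : realType} (a b x : R) : 0 < a -> 1 < b -> ln a / ln b <= x -> a <= b `^ x.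
Proof.
move=> a0 b1; have b0 : 0 < b by lra.
rewrite ler_pdivrMr ?ln_gt0// -ln_powR ler_ln// posrE.
by rewrite powR_gt0.
Qed.

Theorem theorem7p2 (R : realType) (n d : nat) (p theta gamma : R)
    (hn : (1 <= n)%N) (hp : 1 < p) (hd : (1 <= d)%N)
    (hdp : ln 9 / ln 2 <= d%:R * p)
    (htheta : 1 < theta) (hgamma : 0 < gamma < 1) :
  (forall E : set ('rV[R]_n * R), E !=set0 -> closed E ->
    ((exists c delta, porous_with p d theta c delta E) <->
     (exists alpha c0 delta0 K, improving_with p d theta c0 delta0 alpha K E)) /\
    ((exists alpha c0 delta0 K, improving_with p d theta c0 delta0 alpha K E) <->
     (exists beta C, A1plus_with p gamma beta C E)))
  /\
  (* (i) => (ii) and (ii) => (i) *)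
  ((forall c delta, exists c0 delta0 alpha K,
     forall E : set ('rV[R]_n * R), E !=set0 -> closed E ->
       porous_with p d theta c delta E ->
       improving_with p d theta c0 delta0 alpha K E) /\
   (forall c0 delta0 alpha K, exists c delta,
     forall E : set ('rV[R]_n * R), E !=set0 -> closed E ->
       improving_with p d theta c0 delta0 alpha K E ->
       porous_with p d theta c delta E))
  /\
  (* (ii) => (iii) and (iii) => (ii) *)
  ((forall c0 delta0 alpha K, exists beta C,
     forall E : set ('rV[R]_n * R), E !=set0 -> closed E ->
       improving_with p d theta c0 delta0 alpha K E ->
       A1plus_with p gamma beta C E) /\
   (forall beta C, exists c0 delta0 alpha K,
     forall E : set ('rV[R]_n * R), E !=set0 -> closed E ->
       A1plus_with p gamma beta C E ->
       improving_with p d theta c0 delta0 alpha K E))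
  /\
  (* (i) => (iii) and (iii) => (i) *)
  ((forall c delta, exists beta C,
     forall E : set ('rV[R]_n * R), E !=set0 -> closed E ->
       porous_with p d theta c delta E ->
       A1plus_with p gamma beta C E) /\
   (forall beta C, exists c delta,
     forall E : set ('rV[R]_n * R), E !=set0 -> closed E ->
       A1plus_with p gamma beta C E ->
       porous_with p d theta c delta E)).
Proof.
have a9 : 9 <= 2 `^ (d%:R * p) :> R by apply: powR_ge_of_ln => //; rewrite ltr1n.
have i_iii c delta := @porous_A1plus R n p theta gamma c delta d hn hp hd a9 htheta hgamma.
have iii_ii (beta C : R) : exists c0 delta0 alpha K, forall E : set ('rV[R]_n * R), E !=set0 ->
    A1plus_with p gamma beta C E -> improving_with p d theta c0 delta0 alpha K E.
  have [b0|b0] := ltP 0 beta; last first.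
    by exists 0, 0, 0, 0 => E _ []; rewrite ltNge b0.
  have [C0|C0] := ltP 0 C; last first.
    by exists 0, 0, 0, 0 => E _ [_]; rewrite ltNge C0.
  exact: (A1plus_improving hp a9 hd hgamma hn htheta b0 C0).
split; [|split; [split|split; split]].
- move=> E E0 _; split; split.
  + move=> [c [delta porousE]]; have [beta [C A1]] := i_iii c delta.
    have [c0 [delta0 [alpha [K imp]]]] := iii_ii beta C.
    by exists alpha, c0, delta0, K; exact/imp/A1.
  + by move=> [alpha [c0 [delta0 [K [porousE _ _ _]]]]]; exists c0, delta0.
  + move=> [alpha [c0 [delta0 [K [porousE _ _ _]]]]].
    by have [beta [C A1]] := i_iii c0 delta0; exists beta, C; exact: A1.
  + move=> [beta [C A1E]]; have [c0 [delta0 [alpha [K imp]]]] := iii_ii beta C.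
    by exists alpha, c0, delta0, K; exact: imp.
- move=> c delta; have [beta [C A1]] := i_iii c delta.
  have [c0 [delta0 [alpha [K imp]]]] := iii_ii beta C.
  by exists c0, delta0, alpha, K => E E0 _ porousE; exact/imp/A1.
- by move=> c0 delta0 alpha K; exists c0, delta0 => E _ _ [].
- move=> c0 delta0 alpha K; have [beta [C A1]] := i_iii c0 delta0.
  by exists beta, C => E E0 _ [porousE _ _ _]; exact: A1.
- move=> beta C; have [c0 [delta0 [alpha [K imp]]]] := iii_ii beta C.
  by exists c0, delta0, alpha, K => E E0 _; exact: imp.
- move=> c delta; have [beta [C A1]] := i_iii c delta.
  by exists beta, C => E E0 _; exact: A1.
- move=> beta C; have [c0 [delta0 [alpha [K imp]]]] := iii_ii beta C.
  by exists c0, delta0 => E E0 _ /(imp E E0)[].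
Qed.
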